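(* Let $\Omega\subset\mathbb R^n$ be open, non-empty, bounded and let $q_1,q_2\in L^\infty(\Omega)$. Let $s\in(0,1)$ and let $$L(D)u(x)=\int_{\mathbb R^n}\big(2u(x)-u(x+y)-u(x-y)\big)\frac{a(y/|y|)}{|y|^{n+2s}}\,dy,$$ where $a:\mathbb S^{n-1}\to\mathbb R$ satisfies conditions (A1)–(A3) of the context, with associated cone $\mathcal C$. Suppose that $q_1,q_2$ are such that for $j\in\{1,2\}$ the Dirichlet problem $$(L(D)+q_j)u=0\ \text{ in }\Omega,\qquad u=f\ \text{ on }\mathcal C(\Omega)\setminus\overline\Omega$$ is well-posed and gives rise to a well-defined Poisson operator $P_{q_j}:H^s(\mathcal C(\Omega)\setminus\overline\Omega)\to H^s(\mathcal C(\Omega))$. Assume that $L(D)$ is $(-\mathcal C\cup\mathcal C)$-antilocal. Let $W_1,W_2$ be open, non-empty sets such that $W_j\subset\mathcal C(\Omega)\setminus\overline\Omega$ and $\Omega\subset\mathcal C(W_j)$ for $j=1,2$. Assume that $$\Lambda_{q_1}(f)|_{W_2}=\Lambda_{q_2}(f)|_{W_2}\quad\text{for all }f\in C_c^\infty(W_1).$$ Then $q_1=q_2$.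
   Context: All functions are real-valued. A cone is a set closed under multiplication by $t>0$; for a set $U$, $\mathcal C(U):=U+(-\mathcal C\cup\mathcal C)$. Conditions on $a$: (A1) $a\in L^1(\mathbb S^{n-1})$ and $\int_{\mathbb S^{n-1}}|\xi\cdot\theta|^{2s}a(\theta)\,d\theta>0$ for all $\xi\in\mathbb R^n\setminus\{0\}$; (A2) $a(\theta)=a(-\theta)\ge0$ for all $\theta$; (A3) there is a convex, open, non-empty cone $\mathcal C\subset\mathbb R^n\setminus\{0\}$ such that $a(\theta)\neq0$ if and only if $\theta\in(-\mathcal C\cup\mathcal C)\cap\mathbb S^{n-1}$. Sobolev spaces: $H^s(\mathbb R^n)$ is the usual $L^2$-based space; for open $U$, $H^s(U)$ consists of restrictions to $U$ of elements of $H^s(\mathbb R^n)$ with the quotient norm; $\widetilde H^s(U)$ is the closure of $C_c^\infty(U)$ in $H^s(\mathbb R^n)$. $\mathcal E_Uu$ is the extension of $u:U\to\mathbb R$ by zero. Bilinear form: $$B_q(u,v)=\frac12\int_{\mathcal C(\Omega)}\int_{\mathcal C(\Omega)}(u(x)-u(y))(v(x)-v(y))\frac{a\big(\frac{x-y}{|x-y|}\big)}{|x-y|^{n+2s}}\,dy\,dx+\int_\Omega quv\,dx .$$ Weak solution for $f\in H^s(\mathcal C(\Omega)\setminus\overline\Omega)$: $u\in H^s(\mathcal C(\Omega))$ with $B_q(u,v)=0$ for all $v\in\widetilde H^s(\Omega)$ and $\mathcal E_{\mathcal C(\Omega)}(u-\tilde f)\in\widetilde H^s(\Omega)$ for any $\tilde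 f\in H^s(\mathcal C(\Omega))$ with $\tilde f|_{\mathcal C(\Omega)\setminus\overline\Omega}=f$. Well-posedness: for every $f$ there is a unique weak solution $u=:P_qf$, with $\|u\|_{H^s(\mathcal C(\Omega))}\le C\|f\|_{H^s(\mathcal C(\Omega)\setminus\overline\Omega)}$. Dirichlet-to-Neumann map: $\langle\Lambda_qf,h\rangle:=B_q(P_qf,\tilde h)$, where $\tilde h\in H^s(\mathcal C(\Omega))$ extends $h$; for $h\in C_c^\infty(W_2)$ one takes $\tilde h=h$ extended by zero. Equality $\Lambda_{q_1}(f)|_{W_2}=\Lambda_{q_2}(f)|_{W_2}$ means $B_{q_1}(P_{q_1}f,h)=B_{q_2}(P_{q_2}f,h)$ for all $h\in C_c^\infty(W_2)$. Antilocality: $L(D)$ is $(-\mathcal C\cup\mathcal C)$-antilocal if, whenever $f\in C_c^\infty(\mathbb R^n)$ and $f=L(D)f=0$ in an open non-empty set $U$, then $f=0$ in $U+(-\mathcal C\cup\mathcal C)$. *)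

(* Defs.v *)
From HB Require Import structures.
From mathcomp Require Import all_boot all_order all_algebra.
From mathcomp Require Import all_classical all_reals all_analysis.
From mathcomp Require Import measurable_realfun.

Set Implicit Arguments.
Unset Strict Implicit.
Unset Printing Implicit Defensive.

Import Order.TTheory GRing.Theory Num.Theory.
Import numFieldNormedType.Exports.

Local Open Scope classical_set_scope.
Local Open Scope ring_scope.

Section rV_measurable.
Context {R : realType} {n : nat}.

Let coors : 'I_n -> 'rV[R]_n -> R := fun i x => x ord0 i.

Let rV_set0 : g_sigma_preimage coors set0.
Proof. exact: sigma_algebra0. Qed.

Let rV_setC A : g_sigma_preimage coors A -> g_sigma_preimage coors (~` A).
Proof. exact: sigma_algebraC. Qed.

Let rV_bigcup (F : (set 'rV[R]_n)^nat) :
  (forall i, g_sigma_preimage coors (F i)) ->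
  g_sigma_preimage coors (\bigcup_i (F i)).
Proof. exact: sigma_algebra_bigcup. Qed.

(* The sigma-algebra generated by the coordinates, i.e. the Borel sets. *)
HB.instance Definition _ := @isMeasurable.Build default_measure_display
  'rV[R]_n (g_sigma_preimage coors) rV_set0 rV_setC rV_bigcup.

End rV_measurable.

Section rV_measurable_theory.
Context {R : realType}.

Lemma measurable_coord n (i : 'I_n) :
  measurable_fun [set: 'rV[R]_n] (fun x : 'rV[R]_n => x ord0 i).
Proof.
move=> _ Y mY; rewrite setTI; apply: sub_sigma_algebra => /=.
rewrite -bigcup_seq/=; exists i => /=; first by rewrite mem_index_enum.
by exists Y => //; rewrite setTI.
Qed.

Lemma measurable_fun_rV d (T : measurableType d) n (f : T -> 'rV[R]_n) :
  (forall i, measurable_fun [set: T] (fun t => f t ord0 i)) ->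
  measurable_fun [set: T] f.
Proof.
move=> mf.
suff H : g_sigma_preimage (fun (i : 'I_n) (x : 'rV[R]_n) => x ord0 i)
    `<=` image_set_system setT f measurable.
  by move=> _ A mA; exact: (H _ mA).
apply: smallest_sub.
  by apply: sigma_algebra_image; exact: sigma_algebra_measurable.
rewrite -bigcup_seq => A [i _ [B mB <-]].
by rewrite /image_set_system /= setTI -comp_preimage; exact: mf.
Qed.

Definition rcons_rV n (p : 'rV[R]_n * R) : 'rV[R]_(1 + n) :=
  row_mx (const_mx p.2) p.1.

Lemma measurable_rcons_rV n : measurable_fun setT (@rcons_rV n).
Proof.
apply: measurable_fun_rV => i; rewrite /rcons_rV.
case: (split_ordP i) => j ->.
  by under eq_fun do rewrite row_mxEl mxE; exact: measurable_snd.
under eq_fun do rewrite row_mxEr.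
exact: (measurableT_comp (measurable_coord j) measurable_fst).
Qed.

End rV_measurable_theory.

Section lebesgue_rV.
Context {R : realType}.
Local Open Scope ereal_scope.

(* Lebesgue measure on R^n as an iterated product; see lebesgue_rV_box. *)
Fixpoint lebesgue_rV n : set 'rV[R]_n -> \bar R :=
  match n with
  | 0 => @dirac _ 'rV[R]_0 0%R R
  | n'.+1 => pushforward (@lebesgue_rV n' \x @lebesgue_measure R) (@rcons_rV R n')
  end.

Let lebesgue_rV_measure n :
  {m : {measure set 'rV[R]_n -> \bar R} | @lebesgue_rV n = m}.
Proof.
elim: n => [|n [m mE]] /=; first by exists (@dirac _ 'rV[R]_0 0%R R).
rewrite mE.
by exists (measure_function_pushforward__canonical__measure_function_Measure
  (m \x @lebesgue_measure R)%E (@measurable_rcons_rV R n)).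
Qed.

Let lebesgue_rV0 n : @lebesgue_rV n set0 = 0.
Proof. by have [m ->] := lebesgue_rV_measure n. Qed.

Let lebesgue_rV_ge0 n A : 0 <= @lebesgue_rV n A.
Proof. by have [m ->] := lebesgue_rV_measure n. Qed.

Let lebesgue_rV_semi_sigma_additive n : semi_sigma_additive (@lebesgue_rV n).
Proof.
by have [m ->] := lebesgue_rV_measure n; exact: measure_semi_sigma_additive.
Qed.

HB.instance Definition _ n := isMeasure.Build _ _ _ (@lebesgue_rV n)
  (@lebesgue_rV0 n) (@lebesgue_rV_ge0 n) (@lebesgue_rV_semi_sigma_additive n).

Lemma lebesgue_rV_box n (A : 'I_n -> set R) : (forall i, measurable (A i)) ->
  lebesgue_rV [set x : 'rV[R]_n | forall i, A i (x ord0 i)] =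
  \prod_(i < n) lebesgue_measure (A i).
Proof.
elim: n A => [|n ih] A mA.
  by rewrite big_ord0 /= diracE mem_set// => -[].
rewrite big_ord_recl /= /pushforward.
have -> : @rcons_rV R n @^-1` [set x | forall i, A i (x ord0 i)] =
    [set x : 'rV[R]_n | forall i, A (lift ord0 i) (x ord0 i)] `*` A ord0.
  apply/seteqP; split => [[x t] /= Axt|[x t] /= [Ax At] i].
    split=> [i|].
      have := Axt (lift ord0 i); rewrite /rcons_rV /=.
      rewrite (_ : lift ord0 i = @rshift 1 n i); last exact/val_inj.
      by rewrite row_mxEr.
    have := Axt (@lshift 1 n ord0); rewrite /rcons_rV /= row_mxEl mxE /=.
    by rewrite (_ : @lshift 1 n ord0 = ord0)//; exact/val_inj.
  have [j ->|j ->] := @split_ordP 1 n i; rewrite /rcons_rV /=.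
    by rewrite row_mxEl mxE/= ord1 (_ : @lshift 1 n ord0 = ord0)//; exact/val_inj.
  by rewrite row_mxEr (_ : @rshift 1 n j = lift ord0 j)//; exact/val_inj.
have mB : measurable [set x : 'rV[R]_n | forall i, A (lift ord0 i) (x ord0 i)].
  rewrite (_ : mkset _ =
    \bigcap_(i in [set: 'I_n]) ((fun x : 'rV[R]_n => x ord0 i) @^-1` A (lift ord0 i))).
    apply: fin_bigcap_measurable => // i _.
    by rewrite -[X in measurable X]setTI; exact: measurable_coord.
  by apply/seteqP; split => x /= Ax i => [_|]; exact: Ax.
rewrite product_measure1E//; last exact: mA.
by rewrite muleC; congr (_ * _); exact: ih.
Qed.

End lebesgue_rV.

Section euclidean.
Context {R : realType} {n : nat}.
Implicit Types x y : 'rV[R]_n.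

Definition dotp x y : R := \sum_(i < n) x ord0 i * y ord0 i.

(* The norm carried by 'rV[R]_n in the library is the sup norm. *)
Definition enorm x : R := Num.sqrt (dotp x x).

Definition sphere : set 'rV[R]_n := [set x | enorm x = 1].

Definition unit_dir x : 'rV[R]_n := (enorm x)^-1 *: x.

Definition punctured_ball : set 'rV[R]_n := [set x | 0 < enorm x <= 1].

Lemma measurable_enorm : measurable_fun [set: 'rV[R]_n] enorm.
Proof.
apply: measurableT_comp.
  by apply: continuous_measurable_fun; exact: sqrt_continuous.
by apply: measurable_sum => i; apply: measurable_funM; exact: measurable_coord.
Qed.

Lemma measurable_unit_dir : measurable_fun [set: 'rV[R]_n] unit_dir.
Proof.
apply: measurable_fun_rV => i.
under eq_fun do rewrite mxE -powR_inv1 ?sqrtr_ge0//.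
apply: measurable_funM; last exact: measurable_coord.
exact: (measurableT_comp (measurable_powR (-1)) measurable_enorm).
Qed.

Lemma measurable_punctured_ball : measurable punctured_ball.
Proof.
rewrite (_ : punctured_ball = enorm @^-1` `]0, 1]%classic); last first.
  by apply/seteqP; split => x /=; rewrite in_itv.
by rewrite -[X in measurable X]setTI; exact: measurable_enorm.
Qed.

(* Surface measure: sigma(A) = n * |{t theta : theta in A, 0 < t <= 1}|
   (counting measure on the two points of the sphere if n = 1). *)
Definition sphere_measure (A : set 'rV[R]_n) : \bar R :=
  (n%:R%:E * lebesgue_rV (unit_dir @^-1` A `&` punctured_ball))%E.

HB.instance Definition _ := Measure.copy sphere_measure
  (mscale n%:R%:nng
    (measure_function_pushforward__canonical__measure_function_Measure
      (mrestr (@lebesgue_rV R n) measurable_punctured_ball)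
      measurable_unit_dir)).

End euclidean.

Section function_spaces.
Context {R : realType} {n : nat}.
Implicit Types (U W : set 'rV[R]_n) (f u w : 'rV[R]_n -> R).

Local Notation mu := (@lebesgue_rV R n).

Definition pderivs (l : seq 'I_n) f : 'rV[R]_n -> R :=
  foldr (fun i g => 'D_(delta_mx ord0 i) g) f l.

Definition smooth f := forall l : seq 'I_n,
  continuous (pderivs l f) /\
  forall i x, derivable (pderivs l f) x (delta_mx ord0 i).

Definition tsupp f : set 'rV[R]_n := closure [set x | f x != 0].

(* C_c^oo(U), with functions extended by zero to all of R^n *)
Definition Cc_smooth U f := [/\ smooth f, compact (tsupp f) & tsupp f `<=` U].

Definition gagliardo_sq (s : R) f : \bar R :=
  (\int[mu]_x \int[mu]_y
     ((f x - f y) ^+ 2 / enorm (x - y) `^ (n%:R + 2 * s))%:E)%E.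

Definition Hs_norm (s : R) f : \bar R :=
  ((\int[mu]_x ((f x) ^+ 2)%:E + gagliardo_sq s f) `^ 2^-1)%E.

(* H^s(R^n) for 0 < s < 1 in its Sobolev-Slobodeckij form. Elements of
   function spaces are represented by measurable functions, and equality in
   these spaces is equality almost everywhere. *)
Definition Hs (s : R) f := f \in Lfun mu 2%:E /\ (gagliardo_sq s f < +oo)%E.

(* H^s(U); only the values on U of the representative u matter. *)
Definition Hs_on (s : R) U u :=
  measurable_fun U u /\ exists2 w, Hs s w & w = u %[ae mu in U].

Definition Hs_on_norm (s : R) U u : \bar R :=
  ereal_inf [set Hs_norm s w | w in [set w | Hs s w /\ w = u %[ae mu in U]]].

Definition Hs_tilde (s : R) U u :=
  Hs s u /\ forall e : R, 0 < e ->
    exists2 f, Cc_smooth U f & (Hs_norm s (u \- f)%R < e%:E)%E.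

Definition Linfty U q := q \_ U \in Lfun mu +oo%E.

End function_spaces.

Section operator.
Context {R : realType} {n : nat}.
Implicit Types (a u v f g h q : 'rV[R]_n -> R) (C U : set 'rV[R]_n).

Local Notation mu := (@lebesgue_rV R n).
Local Notation sigma := (@sphere_measure R n).

Definition condA1 (s : R) a :=
  sigma.-integrable sphere (EFin \o a) /\
  forall xi : 'rV[R]_n, xi != 0 ->
    (0 < \int[sigma]_(th in sphere) (`|dotp xi th| `^ (2 * s) * a th)%:E)%E.

Definition condA2 a :=
  forall th : 'rV[R]_n, sphere th -> a th = a (- th) /\ 0 <= a th.

Definition dcone C : set 'rV[R]_n := [set - x | x in C] `|` C.

Definition is_cone C := forall (t : R) x, 0 < t -> C x -> C (t *: x).

Definition condA3 C a :=
  [/\ convex_set C, open C, C !=set0, is_cone C & ~ C 0] /\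
  forall th : 'rV[R]_n, sphere th -> (a th != 0 <-> dcone C th).

(* C(U) = U + (-C \cup C) *)
Definition cone_nbhd C U : set 'rV[R]_n :=
  [set x + y | x in U & y in dcone C].

Definition jump_kernel (s : R) a (y : 'rV[R]_n) : R :=
  a (unit_dir y) / enorm y `^ (n%:R + 2 * s).

Definition LD (s : R) a u (x : 'rV[R]_n) : R :=
  \int[mu]_y ((2 * u x - u (x + y) - u (x - y)) * jump_kernel s a y).

Definition antilocal (s : R) a C := forall f U,
  Cc_smooth setT f -> open U -> U !=set0 ->
  (forall x, U x -> f x = 0 /\ LD s a f x = 0) ->
  forall x, cone_nbhd C U x -> f x = 0.

End operator.

Section dirichlet_problem.
Context {R : realType} {n : nat} (s : R) (a : 'rV[R]_n -> R)
  (C Omega : set 'rV[R]_n) (q : 'rV[R]_n -> R).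
Implicit Types u v f g h : 'rV[R]_n -> R.

Local Notation mu := (@lebesgue_rV R n).
Local Notation COmega := (cone_nbhd C Omega).

Definition exterior : set 'rV[R]_n := COmega `\` closure Omega.

Definition Bform u v : R :=
  2^-1 * fine (\int[mu]_(x in COmega) \int[mu]_(y in COmega)
                 ((u x - u y) * (v x - v y) * jump_kernel s a (x - y))%:E)%E
  + \int[mu]_(x in Omega) (q x * u x * v x).

(* [g \_ U] is the extension by zero of the restriction of g to U. *)
Definition weak_solution f u :=
  [/\ Hs_on s COmega u,
      forall v, Hs_tilde s Omega v -> Bform u v = 0
    & forall g, Hs_on s COmega g -> g = f %[ae mu in exterior] ->
        Hs_tilde s Omega ((u \- g) \_ COmega)].

Definition well_posed := exists K : R,
  forall f, Hs_on s exterior f -> exists u,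
    [/\ weak_solution f u,
        forall u', weak_solution f u' -> u' = u %[ae mu in COmega]
      & (Hs_on_norm s COmega u <= K%:E * Hs_on_norm s exterior f)%E].

(* The weak solution; meaningful when the problem is well-posed. *)
Definition poisson f : 'rV[R]_n -> R := xget (cst 0) (weak_solution f).

(* <Lambda_q f, h>, where h is an H^s(C(Omega)) extension of the test datum *)
Definition DN f h : R := Bform (poisson f) h.

End dirichlet_problem.

(* Main.v *)
(* Write E(u, v) for the integral of (u x - u y) (v x - v y) k(x - y), k being
   the jump kernel, and X for the closure of C_c^oo(Omega) in the energy norm.

   (1) If w in X satisfies E(w, h) = 0 for all h in C_c^oo(W) and Omega lies in
   C(W), then w = 0. Indeed the convolution of w with a bump supported close to
   0 is a test function vanishing together with its image under L(D) near any
   given point of W, hence it vanishes on the cone through that point; varying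
   the (anisotropic) bump kills the integral of w over all small boxes of Omega.

   (2) As the kernel is bounded below on a piece of an open cone, E(u, u)
   controls the L^2 norm of u(. + z) - u by a small constant when z is small.
   Averaging over the cells of a grid, the L^2 norm on X is bounded by
   delta E(u, u) plus the squares of finitely many linear functionals, so that
   the form of L(D) + q is coercive on X up to finitely many functionals.

   By (1) on W2, the two solutions with exterior datum f in C_c^oo(W1) agree, so
   (q1 - q2) u_f = 0 in Omega. If q1 <> q2 on a set F of positive measure, all
   u_f vanish on F. By (2) and orthogonal projection there is phi in X, nonzero
   on F, which is orthogonal for the form to all elements of X vanishing on F.
   Testing the equation of u_f against phi gives E(f, phi) = 0 for all f, hence
   phi = 0 by (1) on W1, a contradiction. *)

From HB Require Import structures.
Require Import Defs.
From mathcomp Require Import all_boot all_order all_algebra.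
From mathcomp Require Import all_classical all_reals all_analysis.
From mathcomp Require Import measurable_realfun ess_sup_inf ring lra zify.

Set Implicit Arguments.
Unset Strict Implicit.
Unset Printing Implicit Defensive.

Import Order.TTheory GRing.Theory Num.Theory.
Import numFieldNormedType.Exports.

Local Open Scope classical_set_scope.
Local Open Scope ring_scope.

(** * Boxes and Lebesgue measure on R^n *)

(** Three obstacles shape the argument. [Bform] only sees C(Omega), while the energy E is taken over
    the whole space; the two agree as soon as one argument vanishes off Omega, because k(x - y) is
    zero unless x - y lies in the double cone. Next, antilocality is assumed for test functions
    only, whereas the functions to be killed merely have finite energy and no pointwise L(D);
    mollification reduces everything to one absolutely convergent double integral. Finally q has no
    sign, so the form of L(D) + q need not be coercive and orthogonal projection for it is not
    directly available. The form is therefore corrected by the squares of finitely many functionals,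
    independent elements are projected for the corrected form, and linear algebra selects a
    combination on which the correction disappears. This succeeds because the elements of X
    vanishing on F have infinite codimension: monomials in one coordinate times a bump stay
    independent on any set of positive measure where the bump is positive. The finite rank estimate
    plays the part of the compact embedding of X into L^2. *)

Section rV_sets.
Context {R : realType} {n : nat}.
Implicit Types (x y : 'rV[R]_n) (e : R).

Lemma rV_norm_leP x e : 0 <= e -> `|x| <= e <-> forall i, `|x ord0 i| <= e.
Proof.
move=> e0; rewrite [`|x|]mx_normrE; split => [xe i|xe].
  by apply: le_trans xe; apply: (le_bigmax _ (fun j => `|x j.1 j.2|) (ord0, i)).
by apply/bigmax_leP; split => // -[j i] _ /=; rewrite ord1.
Qed.

Lemma rV_norm_ltP x e : 0 < e -> `|x| < e <-> forall i, `|x ord0 i| < e.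
Proof.
move=> e0; rewrite [`|x|]mx_normrE; split => [xe i|xe].
  by apply: le_lt_trans xe; apply: (le_bigmax _ (fun j => `|x j.1 j.2|) (ord0, i)).
by apply/bigmax_ltP; split => // -[j i] _ /=; rewrite ord1.
Qed.

Lemma rV_coord_le x i : `|x ord0 i| <= `|x|.
Proof. by move/rV_norm_leP : (lexx `|x|); apply. Qed.

Definition obox (a b : 'rV[R]_n) : set 'rV[R]_n :=
  [set x | forall i, a ord0 i < x ord0 i < b ord0 i].

Lemma oboxE a b :
  obox a b = [set x | forall i, `]a ord0 i, b ord0 i[%classic (x ord0 i)].
Proof. by apply/seteqP; split => x /= + i => /(_ i); rewrite in_itv. Qed.

Lemma measurable_box (A : 'I_n -> set R) : (forall i, measurable (A i)) ->
  measurable [set x : 'rV[R]_n | forall i, A i (x ord0 i)].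
Proof.
move=> mA; rewrite (_ : mkset _ =
  \bigcap_(i in [set: 'I_n]) ((fun x : 'rV[R]_n => x ord0 i) @^-1` A i)).
  apply: fin_bigcap_measurable => [|i _]; first exact: finite_finset.
  by rewrite -[X in measurable X]setTI; exact: measurable_coord.
by apply/seteqP; split => x /= Ax i => [_|]; exact: Ax.
Qed.

Lemma measurable_obox a b : measurable (obox a b).
Proof.
rewrite oboxE; apply: (@measurable_box (fun i => `]a ord0 i, b ord0 i[%classic)).
by move=> i; exact: measurable_itv.
Qed.

Lemma lebesgue_obox a b : lebesgue_rV (obox a b) =
  (\prod_(i < n) (Num.max (b ord0 i - a ord0 i) 0)%:E)%E.
Proof.
rewrite oboxE (@lebesgue_rV_box _ _ (fun i => `]a ord0 i, b ord0 i[%classic))//; apply: eq_bigr => i _.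
rewrite lebesgue_measure_itv/= lte_fin; case: ltP => ab.
  by rewrite max_l// subr_ge0 ltW.
by rewrite max_r// subr_le0.
Qed.

Lemma prod_EFin (F : 'I_n -> R) : (\prod_(i < n) (F i)%:E = (\prod_(i < n) F i)%:E)%E.
Proof. by elim/big_ind2 : _ => // x y ? ? -> ->; rewrite EFinM. Qed.

Lemma lebesgue_obox_lty a b : (lebesgue_rV (obox a b) < +oo)%E.
Proof. by rewrite lebesgue_obox prod_EFin ltry. Qed.

Lemma oboxI a b c d : obox a b `&` obox c d =
  obox (\row_i Num.max (a ord0 i) (c ord0 i)) (\row_i Num.min (b ord0 i) (d ord0 i)).
Proof.
apply/seteqP; split => [x [xab xcd] i|x xabcd].
  have /andP[ax xb] := xab i; have /andP[cx xd] := xcd i.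
  by rewrite !mxE gt_max lt_min ax xb cx xd.
by split => i; have := xabcd i; rewrite !mxE gt_max lt_min
  => /andP[/andP[ax cx] /andP[xb xd]]; rewrite ?ax ?xb ?cx ?xd.
Qed.

Definition oboxes : set (set 'rV[R]_n) := [set obox a b | a in setT & b in setT].

Lemma obox_cover : \bigcup_k obox (const_mx (- k%:R)) (const_mx k%:R) = setT.
Proof.
rewrite -subTset => x _.
exists (Num.truncn `|x|).+1 => //= i; rewrite !mxE -ltr_norml.
by rewrite (le_lt_trans (rV_coord_le _ _))// truncnS_gt.
Qed.

(** Open boxes are stable under intersection, so once they generate the sigma-algebra they determine
    measures. A half-space bounding one coordinate from below is the union of boxes that grow in all
    other directions. *)
Lemma rV_measurableE : @measurable _ 'rV[R]_n = <<s oboxes >>.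
Proof.
apply/seteqP; split; last first.
  by apply: smallest_sub; [exact: sigma_algebra_measurable|
     move=> _ [a _ [b _ <-]]; exact: measurable_obox].
apply: smallest_sub; first exact: smallest_sigma_algebra.
rewrite -bigcup_seq => A [i _ [B mB <-]].
have : measurable_fun setT (fun x : g_sigma_algebraType oboxes => x ord0 i : R).
  apply: (measurability _ (RGenOInfty.measurableE R)) => _ [_ [c ->] <-].
  rewrite setTI (_ : _ @^-1` _ = \bigcup_k obox
    (\row_j if j == i then c else - k%:R) (const_mx k%:R)); last first.
    apply/seteqP; split => [x /=|x [k _ /(_ i)] /=]; last first.
      by rewrite !mxE eqxx => /andP[]; rewrite in_itv/= andbT.
    rewrite in_itv/= andbT => cx; exists (Num.truncn `|x|).+1 => // j.
    have : `|x ord0 j| < (Num.truncn `|x|).+1%:R.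
      by rewrite (le_lt_trans (rV_coord_le _ _))// truncnS_gt.
    by rewrite ltr_norml !mxE => /andP[xj ->]; case: eqP => [->|//]; rewrite ?cx ?xj.
  apply: bigcupT_measurable => k; apply: sub_sigma_algebra.
  by eexists => //; eexists.
by move=> /(_ measurableT B mB).
Qed.

Lemma rV_measure_unique (m1 m2 : {measure set 'rV[R]_n -> \bar R}) :
  (forall a b, m1 (obox a b) = m2 (obox a b)) ->
  (forall a b, (m1 (obox a b) < +oo)%E) ->
  forall A, measurable A -> m1 A = m2 A.
Proof.
move=> m12 m1oo; apply: (measure_unique oboxes
  (fun k => obox (const_mx (- k%:R)) (const_mx k%:R))) => //.
- exact: rV_measurableE.
- move=> _ _ [a _ [b _ <-]] [c _ [d _ <-]]; rewrite oboxI.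
  by eexists => //; eexists.
- by move=> k; eexists => //; eexists.
- exact: obox_cover.
- by move=> _ [a _ [b _ <-]].
Qed.

Lemma rV_ballE x e y : ball x e y <-> `|x - y| < e.
Proof. by rewrite mx_norm_ball. Qed.

Lemma nbhs_obox x (U : set 'rV[R]_n) : nbhs x U ->
  exists2 e : R, 0 < e & obox (x - const_mx e) (x + const_mx e) `<=` U.
Proof.
move=> /nbhs_ballP[e /= e0 eU]; exists e => // y xy; apply: eU.
apply/rV_ballE/rV_norm_ltP => // i; have := xy i; rewrite !mxE.
by rewrite distrC ltr_distl.
Qed.

Lemma obox_center x e : 0 < e -> obox (x - const_mx e) (x + const_mx e) x.
Proof. by move=> e0 i; rewrite !mxE ltrDl ltrBlDr ltrDl e0. Qed.

Lemma obox_open a b : open (obox a b).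
Proof.
rewrite (_ : obox a b = \bigcap_(i in [set: 'I_n])
  ((fun x : 'rV[R]_n => x ord0 i) @^-1` `]a ord0 i, b ord0 i[)); last first.
  apply/seteqP; split => [x xab i _ /=|x xab i]; first by rewrite in_itv/=.
  by have := xab i I; rewrite /= in_itv.
rewrite bigcap_fset_set; last exact: finite_finset.
apply: big_ind => [|A B oA oB|i _]; [exact: openT|exact: openI|].
by apply: open_comp; [move=> x _; exact: coord_continuous|exact: itv_open].
Qed.

Definition rVrat (p : 'rV[rat]_n) : 'rV[R]_n := map_mx ratr p.

Definition rat_box (U : set 'rV[R]_n) (p : 'rV[rat]_n * 'rV[rat]_n) :=
  exists2 e : R, 0 < e &
    obox (rVrat p.1 - const_mx e) (rVrat p.2 + const_mx e) `<=` U.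

(** Countability is the point: it makes open sets Borel, and later lets a property that holds almost
    everywhere near each point hold almost everywhere. *)
Lemma open_rat_boxes (U : set 'rV[R]_n) : open U ->
  U = \bigcup_(p in rat_box U) obox (rVrat p.1) (rVrat p.2).
Proof.
move=> oU; apply/seteqP; split => [x Ux|x [p [e e0 eU] px]]; last first.
  apply: eU => i; have := px i; rewrite !mxE => /andP[p1 p2].
  by rewrite ltrBlDr (lt_le_trans p1) ?lerDl ?ltW//= (lt_trans p2)// ltrDl.
have [e e0 eU] : exists2 e : R, 0 < e & obox (x - const_mx e) (x + const_mx e) `<=` U.
  by apply: nbhs_obox; exact: open_nbhs_nbhs.
have e2 : 0 < e / 2 by rewrite divr_gt0.
have rlt i : {r : rat | x ord0 i - e / 2 < ratr r < x ord0 i}.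
  by apply: cid; have [|r] := @rat_in_itvoo R (x ord0 i - e / 2) (x ord0 i);
    [rewrite ltrBlDr ltrDl|rewrite in_itv/=; exists r].
have rgt i : {r : rat | x ord0 i < ratr r < x ord0 i + e / 2}.
  by apply: cid; have [|r] := @rat_in_itvoo R (x ord0 i) (x ord0 i + e / 2);
    [rewrite ltrDl|rewrite in_itv/=; exists r].
exists (\row_i sval (rlt i), \row_i sval (rgt i)); last first.
  by move=> i; rewrite !mxE /=; case: (rlt i) => r /= /andP[_ ->];
    case: (rgt i) => q /= /andP[->].
exists (e / 2) => // y yp; apply: eU => i; have := yp i; rewrite !mxE/=.
case: (rlt i) => r /= /andP[r1 r2]; case: (rgt i) => q /= /andP[q1 q2] /andP[y1 y2].
by apply/andP; split; lra.
Qed.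

Lemma rV_open_measurable (U : set 'rV[R]_n) : open U -> measurable U.
Proof.
move=> /open_rat_boxes ->; rewrite bigcup_mkcond.
apply: countable_bigcupT_measurable => [|p]; first exact: countableP.
by case: ifPn => _; [exact: measurable_obox|exact: measurable0].
Qed.

Lemma rV_continuous_measurable (f : 'rV[R]_n -> R) :
  continuous f -> measurable_fun setT f.
Proof.
move=> cf; apply: (measurability _ (RGenOInfty.measurableE R)) => _ [_ [c ->] <-].
rewrite setTI; apply: rV_open_measurable; by apply: open_comp => //; exact: open_gt.
Qed.

End rV_sets.

Section rV_measure.
Context {R : realType} {n : nat}.
Local Notation mu := (@lebesgue_rV R n).

Lemma lebesgue_rV_sigma_finite : sigma_finite setT mu.
Proof.
exists (fun k => obox (const_mx (- k%:R)) (const_mx k%:R)); first by rewrite obox_cover.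
by move=> k; split; [exact: measurable_obox|exact: lebesgue_obox_lty].
Qed.

HB.instance Definition _ := Measure_isSigmaFinite.Build _ _ _ mu lebesgue_rV_sigma_finite.
End rV_measure.

Section rV_measure2.
Context {R : realType} {n : nat}.
Local Notation mu := (@lebesgue_rV R n).

Definition affm (t : R) (b x : 'rV[R]_n) := t *: x + b.

Lemma measurable_affm t b : measurable_fun setT (affm t b).
Proof.
apply: measurable_fun_rV => i; rewrite /affm; under eq_fun do rewrite !mxE.
apply: measurable_funD => //; apply: measurable_funM => //.
exact: measurable_coord.
Qed.

(** Both sides are measures in A, so it suffices to compare them on boxes. The preimage of a box is
    a box whose corners are exchanged when t < 0. *)
Lemma lebesgue_affm t b A : t != 0 -> measurable A ->
  (mu (affm t b @^-1` A) = (`|t| ^- n)%:E * mu A)%E.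
Proof.
move=> t0 mA.
have t0' : 0 < `|t| by rewrite normr_gt0.
have tn0 : 0 <= `|t| ^- n by rewrite invr_ge0 exprn_ge0.
pose m1 : {measure set 'rV[R]_n -> \bar R} :=
  measure_function_pushforward__canonical__measure_function_Measure mu (measurable_affm t b).
pose m2 : {measure set 'rV[R]_n -> \bar R} := mscale (NngNum tn0) mu.
rewrite -[LHS]/(m1 A) -[RHS]/(m2 A).
suff H a c : m1 (obox a c) = m2 (obox a c).
  apply: rV_measure_unique => // a c; rewrite H /m2 /= /mscale/=.
  by rewrite lte_mul_pinfty// lebesgue_obox_lty.
rewrite /m1 /m2 /= /pushforward /mscale /=.
have -> : affm t b @^-1` obox a c = if 0 < t then
    obox (t^-1 *: (a - b)) (t^-1 *: (c - b)) else obox (t^-1 *: (c - b)) (t^-1 *: (a - b)).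
  case: ltP => [tp|]; last rewrite le_eqVlt (negbTE t0)/= => tn.
    apply/seteqP; split => x /= + i => /(_ i);
    by rewrite !mxE ![t^-1 * _]mulrC ltr_pdivrMr// ltr_pdivlMr// ltrBlDr ltrBrDr [t * _]mulrC.
  apply/seteqP; split => x /= + i => /(_ i);
  by rewrite !mxE ![t^-1 * _]mulrC ltr_ndivrMr// ltr_ndivlMr// ltrBlDr ltrBrDr [t * _]mulrC andbC.
transitivity (\prod_(i < n) (`|t|^-1 * Num.max (c ord0 i - a ord0 i) 0))%:E; last first.
  rewrite lebesgue_obox prod_EFin -EFinM big_split/= prodr_const card_ord.
  by rewrite exprVn.
have eqt i : `|t|^-1 * Num.max (c ord0 i - a ord0 i) 0 = Num.max (`|t|^-1 * (c ord0 i - a ord0 i)) 0.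
  by rewrite maxr_pMr ?mulr0// invr_ge0.
case: ltP => [tp|]; last rewrite le_eqVlt (negbTE t0)/= => tn.
  rewrite lebesgue_obox prod_EFin; congr EFin; apply: eq_bigr => i _.
  by rewrite eqt !mxE gtr0_norm//; congr Num.max; ring.
rewrite lebesgue_obox prod_EFin; congr EFin; apply: eq_bigr => i _.
rewrite eqt !mxE ltr0_norm//; congr Num.max; rewrite invrN; ring.
Qed.

Lemma ge0_integral_affm t b (f : 'rV[R]_n -> \bar R) : t != 0 ->
  measurable_fun setT f -> (forall x, 0 <= f x)%E ->
  (\int[mu]_x f (affm t b x) = (`|t| ^- n)%:E * \int[mu]_x f x)%E.
Proof.
move=> t0 mf f0.
have tn0 : 0 <= `|t| ^- n by rewrite invr_ge0 exprn_ge0.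
have := @ge0_integral_pushforward _ _ _ _ R _ (measurable_affm t b) mu setT f measurableT mf.
rewrite preimage_setT => <-; last by move=> ? _.
rewrite -(ge0_integral_mscale mu measurableT (NngNum tn0))//.
apply: eq_measure_integral => [|mphi A mA _]; first exact: measurable_affm.
exact: lebesgue_affm.
Qed.

Lemma ge0_integral_shift b (f : 'rV[R]_n -> \bar R) :
  measurable_fun setT f -> (forall x, 0 <= f x)%E ->
  (\int[mu]_x f (x + b)%R = \int[mu]_x f x)%E.
Proof.
move=> mf f0; have := @ge0_integral_affm 1 b f (oner_neq0 _) mf f0.
rewrite normr1 expr1n invr1 mul1e => <-.
by apply: eq_integral => x _; rewrite /affm scale1r.
Qed.

Lemma ge0_integral_reflect b (f : 'rV[R]_n -> \bar R) :
  measurable_fun setT f -> (forall x, 0 <= f x)%E ->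
  (\int[mu]_x f (b - x)%R = \int[mu]_x f x)%E.
Proof.
move=> mf f0; have N10 : (-1 : R) != 0 by rewrite oppr_eq0 oner_neq0.
have := @ge0_integral_affm (-1) b f N10 mf f0.
rewrite normrN1 expr1n invr1 mul1e => <-.
by apply: eq_integral => x _; rewrite /affm scaleN1r addrC.
Qed.

Lemma bounded_rV_lty (A : set 'rV[R]_n) M : measurable A ->
  (forall x, A x -> `|x| <= M) -> (mu A < +oo)%E.
Proof.
move=> mA AM; apply: (@le_lt_trans _ _ (mu (obox (const_mx (- (`|M| + 1))) (const_mx (`|M| + 1))))).
  apply: le_measure; rewrite ?inE//; first exact: measurable_obox.
  move=> x /AM xM i; rewrite !mxE -ltr_norml (le_lt_trans (rV_coord_le _ _))//.
  by rewrite (le_lt_trans xM)// (le_lt_trans (ler_norm M))// ltrDl.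
exact: lebesgue_obox_lty.
Qed.
End rV_measure2.

(** * Test functions *)

Section flat_function.
Context {R : realType}.
Implicit Types (p : {poly R}) (t : R).

(** The flat function exp(-1/t) with an arbitrary polynomial in 1/t in front: the family is stable
    under differentiation, [dpsi] giving the new polynomial. *)
Definition psi p t : R := if 0 < t then p.[t^-1] * expR (- t^-1) else 0.

Definition dpsi p : {poly R} := 'X^2 * (p - p^`()).

Lemma horner_le p x : 1 <= x ->
  `|p.[x]| <= (\sum_(i < size p) `|p`_i|) * x ^+ size p.
Proof.
move=> x1; rewrite horner_coef (le_trans (ler_norm_sum _ _ _))//.
rewrite mulr_suml ler_sum// => i _; rewrite normrM normrX.
rewrite ler_wpM2l// ger0_norm ?(le_trans _ x1)//.
by rewrite ler_weXn2l// ltnW.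
Qed.

(** With x = 1/t and d = [size p], the polynomial is O(x^d) and exp(x) >= x^(d+2) / (d+2)!. The two
    spare powers give a vanishing derivative at 0. *)
Lemma psi_le p : exists2 M, 0 <= M & forall t, 0 < t <= 1 -> `|psi p t| <= M * t ^+ 2.
Proof.
exists ((\sum_(i < size p) `|p`_i|) * (size p).+2`!%:R) => [|t /andP[t0 t1]].
  by rewrite mulr_ge0// sumr_ge0.
rewrite /psi t0 normrM (ger0_norm (expR_ge0 _)) expRN.
have ti : 1 <= t^-1 by rewrite invf_ge1.
have ti0 : 0 < t^-1 by rewrite invr_gt0.
rewrite (le_trans (ler_wpM2r _ (horner_le p ti))) ?invr_ge0 ?expR_ge0//.
rewrite -!mulrA ler_wpM2l ?sumr_ge0//.
rewrite ler_pdivrMr ?expR_gt0//.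
have := expR_ge1Dxn (size p).+1 (ltW ti0).
set F : R := _`!%:R; move=> H.
have F0 : 0 < F by rewrite ltr0n fact_gt0.
apply: (@le_trans _ _ (F * t ^+ 2 * (t^-1 ^+ (size p).+2 / F))); last first.
  apply: ler_wpM2l; first by rewrite mulr_ge0 ?exprn_ge0 ?ltW.
  by apply: le_trans H; rewrite lerDr.
rewrite -(addn2 (size p)) exprD.
rewrite [leRHS](_ : _ = t^-1 ^+ size p)//.
have tn : t != 0 by rewrite gt_eqF.
have Fn : F != 0 by rewrite gt_eqF.
rewrite (mulrC (_ ^+ size p)) [X in X = _](_ : _ =
  (F / F) * (t^-1 ^+ 2 * t ^+ 2) * t^-1 ^+ size p); last by ring.
by rewrite divff// mul1r -exprMn mulVf// expr1n mul1r.
Qed.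

Lemma is_derive_psi p t : is_derive t 1 (psi p) (psi (dpsi p) t).
Proof.
have [t0|t0|->] := ltgtP t 0.
- have -> : psi (dpsi p) t = 0 by rewrite /psi ltNge ltW.
  apply: (@near_eq_is_derive _ _ _ (cst 0)).
  near=> x; rewrite /psi ifF//; apply/negbTE; rewrite -leNgt ltW//.
  near: x; exact: lt_nbhsl.
- have tn : t != 0 by rewrite gt_eqF.
  have dV : is_derive t 1 (fun x : R => x^-1) (- t^-1 ^+ 2).
    apply: DeriveDef; first exact: (@derivableV _ _ id).
    by rewrite (@deriveV _ _ id)// derive_id /GRing.scale/= mulr1 exprVn.
  have dp : is_derive t 1 (fun x : R => p.[x^-1]) (p^`().[t^-1] * (- t^-1 ^+ 2)).
    by apply: (@is_derive1_comp _ (horner p) (fun x => x^-1)).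
  have de : is_derive t 1 (fun x : R => expR (- x^-1)) (expR (- t^-1) * (t^-1 ^+ 2)).
    apply: (@is_derive1_comp _ expR (fun x => - x^-1)).
    by apply: (is_derive_eq (is_deriveN dV)); rewrite opprK.
  apply: (@near_eq_is_derive _ _ _
    ((fun x => p.[x^-1]) * (fun x => expR (- x^-1)))).
    near=> x; rewrite /psi ifT//; near: x; exact: lt_nbhsr.
  apply: (is_derive_eq (is_deriveM dp de)).
  rewrite /psi t0 /dpsi /GRing.scale/= !hornerE /=; ring.
- rewrite {2}/psi ltxx.
  have [M M0 HM] := psi_le p.
  have H : (fun h : R => h^-1 *: ((psi p \o shift 0) (h *: (1 : R)) - psi p 0)) @ 0^' --> (0 : R).
    apply/cvgrPdist_le => /= e e0.
    near=> h.
    have h0 : h != 0 by near: h; exact: nbhs_dnbhs_neq.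
    rewrite /= sub0r normrN addr0 /GRing.scale/= mulr1 {2}/psi ltxx subr0.
    have [hp|hn] := ltP 0 h; last by rewrite /psi ltNge hn/= mulr0 normr0 ltW.
    rewrite normrM normfV (gtr0_norm hp) mulrC ler_pdivrMr//.
    have : h < Num.min 1 (e / (M + 1)).
      near: h; apply: nbhs_dnbhs; apply: lt_nbhsl.
      by rewrite lt_min ltr01 divr_gt0// ltr_wpDl.
    rewrite lt_min => /andP[/ltW h1 /ltW h2].
    rewrite (le_trans (HM _ _)) ?hp ?h1//.
    rewrite expr2 mulrA ler_wpM2r ?ltW//.
    move: h2; rewrite ler_pdivlMr ?ltr_wpDl// => h2; lra.
  by apply: DeriveDef; [apply/cvg_ex; exists 0|exact: cvg_lim].
Unshelve. all: by end_near. Qed.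

End flat_function.

Section derive_line.
Context {R : realType} {n : nat}.

Lemma is_derive_line (f : 'rV[R]_n -> R) x v (t df : R) :
  is_derive t (1 : R) (fun h : R => f (h *: v + x)) df <->
  is_derive (t *: v + x) v f df.
Proof.
have E : (fun h : R => h^-1 *: (((fun h : R => f (h *: v + x)) \o shift t) (h *: (1 : R))
      - f (t *: v + x))) =
    (fun h => h^-1 *: ((f \o shift (t *: v + x)) (h *: v) - f (t *: v + x))).
  apply/funext => h /=; congr (_ *: (f _ - _)).
  by rewrite scalerDl addrA /GRing.scale/= mulr1.
by split => -[dr dv]; apply: DeriveDef; move: dr dv;
  rewrite /derivable /derive E.
Qed.

Lemma is_derive_line0 (f : 'rV[R]_n -> R) x v (df : R) :
  is_derive (0 : R) (1 : R) (fun h : R => f (h *: v + x)) df <-> is_derive x v f df.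
Proof. by rewrite is_derive_line scale0r add0r. Qed.

End derive_line.

Lemma is_derive_affine {R : realType} (a b t : R) :
  is_derive t (1 : R) (fun h : R => a * h + b) a.
Proof.
have := is_deriveD (is_deriveZ a (is_derive_id t (1 : R))) (is_derive_cst b t (1 : R)).
by move=> H; apply: (is_derive_eq H); rewrite addr0 /GRing.scale/= mulr1.
Qed.

Section elementary.
Context {R : realType} {n : nat}.
Implicit Types (f g : 'rV[R]_n -> R) (U : set 'rV[R]_n).

(** A class of continuous functions closed under partial derivatives, so that its members are smooth
    without any derivative being computed explicitly. *)
Inductive elem : ('rV[R]_n -> R) -> Prop :=
| elem_cst c : elem (cst c)
| elem_coord i : elem (fun x => x ord0 i)
| elem_psi p (al be : R) i : elem (fun x => psi p (al * x ord0 i + be))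
| elem_add f g : elem f -> elem g -> elem (f + g)
| elem_mul f g : elem f -> elem g -> elem (f * g).

Lemma delta_coord (i j : 'I_n) (h : R) (x : 'rV[R]_n) :
  (h *: delta_mx ord0 i + x) ord0 j = h * (i == j)%:R + x ord0 j.
Proof. by rewrite !mxE eqxx/= eq_sym. Qed.

Lemma elem_derive f : elem f -> forall i, exists2 g, elem g &
  forall x, is_derive x (delta_mx ord0 i) f (g x).
Proof.
elim => [c|j|p al be j|{}f g ef IHf eg IHg|{}f g ef IHf eg IHg] i.
- exists (cst 0) => [|x]; [exact: elem_cst|exact: is_derive_cst].
- exists (cst (i == j)%:R) => [|x]; first exact: elem_cst.
  apply/is_derive_line0; under eq_fun do rewrite delta_coord.
  under eq_fun do rewrite mulrC; exact: is_derive_affine.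
- exists (cst (al * (i == j)%:R) * (fun x => psi (dpsi p) (al * x ord0 j + be))) => [|x].
    by apply: elem_mul; [exact: elem_cst|exact: elem_psi].
  apply/is_derive_line0; under eq_fun do rewrite delta_coord.
  have -> : (fun h : R => psi p (al * (h * (i == j)%:R + x ord0 j) + be)) =
      (fun h => psi p ((al * (i == j)%:R) * h + (al * x ord0 j + be))).
    by apply/funext => h; congr psi; ring.
  have H := @is_derive1_comp R (psi p)
    (fun h => (al * (i == j)%:R) * h + (al * x ord0 j + be)) 0 _ _ (is_derive_psi p _)
    (is_derive_affine _ _ _).
  by apply: (is_derive_eq H); rewrite mulr0 add0r /= mulrC.
- have [f' ef' Hf] := IHf i; have [g' eg' Hg] := IHg i.
  by exists (f' + g') => [|x]; [exact: elem_add|exact: is_deriveD].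
- have [f' ef' Hf] := IHf i; have [g' eg' Hg] := IHg i.
  exists (f * g' + g * f') => [|x]; first by apply: elem_add; exact: elem_mul.
  exact: is_deriveM.
Qed.

Lemma psi_continuous p : continuous (@psi R p).
Proof.
move=> t; apply: differentiable_continuous; apply/derivable1_diffP.
by have [] := is_derive_psi p t.
Qed.

Lemma rV_coord_continuous i : continuous (fun x : 'rV[R]_n => x ord0 i).
Proof. by move=> x; exact: coord_continuous. Qed.

Lemma elem_continuous f : elem f -> continuous f.
Proof.
elim => [c|j|p al be j|{}f g ef IHf eg IHg|{}f g ef IHf eg IHg] x.
- exact: cst_continuous.
- exact: rV_coord_continuous.
- apply: (@continuous_comp _ _ _ (fun x : 'rV[R]_n => al * x ord0 j + be)).
    apply: (@continuousD _ _ _ (fun x : 'rV[R]_n => al * x ord0 j) (fun=> be)).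
      apply: (@continuousM _ _ (fun=> al) (fun x : 'rV[R]_n => x ord0 j)).
        exact: cst_continuous.
      exact: rV_coord_continuous.
    exact: cst_continuous.
  exact: psi_continuous.
- by apply: continuousD; [exact: IHf|exact: IHg].
- by apply: continuousM; [exact: IHf|exact: IHg].
Qed.

Lemma elem_smooth f : elem f -> smooth f.
Proof.
move=> ef; suff H l : elem (pderivs l f).
  move=> l; split => [|i x]; first exact: elem_continuous.
  by have [g _ /(_ x)[]] := elem_derive (H l) i.
elim: l => //= i l /elem_derive /(_ i)[g eg Hg].
rewrite (_ : 'D_(delta_mx ord0 i) _ = g)//.
by apply/funext => x; have [] := Hg x.
Qed.

Lemma smooth_derive f i : smooth f -> smooth ('D_(delta_mx ord0 i) f).
Proof.
move=> sf l; suff -> : pderivs l ('D_(delta_mx ord0 i) f) = pderivs (rcons l i) f.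
  exact: sf.
by rewrite /pderivs -cats1 foldr_cat.
Qed.

Lemma smoothD f g : smooth f -> smooth g -> smooth (f + g).
Proof.
move=> sf sg; suff H l : pderivs l (f + g) = pderivs l f + pderivs l g.
  move=> l; rewrite H; have [cf df] := sf l; have [cg dg] := sg l; split.
    by move=> x; apply: continuousD; [exact: cf|exact: cg].
  by move=> i x; apply: derivableD; [exact: df|exact: dg].
elim: l => //= i l ->; apply/funext => x /=.
by rewrite deriveD//; [have [_] := sf l; exact|have [_] := sg l; exact].
Qed.

Lemma smoothZ f c : smooth f -> smooth (c *: f).
Proof.
move=> sf; suff H l : pderivs l (c *: f) = c *: pderivs l f.
  move=> l; rewrite H; have [cf df] := sf l; split.
    by move=> x; apply: continuousZr; exact: cf.
  by move=> i x; apply: derivableZ; exact: df.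
elim: l => //= i l ->; apply/funext => x /=.
by rewrite deriveZ//; have [_] := sf l; exact.
Qed.

Lemma Cc_smooth_sub U f (K : set 'rV[R]_n) : smooth f -> compact K ->
  (forall x, f x != 0 -> K x) -> K `<=` U -> Cc_smooth U f.
Proof.
move=> sf cK fK KU.
have clK : closed K by apply: compact_closed => //; exact: norm_hausdorff.
have sK : tsupp f `<=` K by rewrite ((closure_id K).1 clK); apply: closure_subset.
split => //; last exact: subset_trans sK KU.
by apply: (subclosed_compact _ cK) => //; exact: closed_closure.
Qed.

Lemma Cc_smoothP U f : Cc_smooth U f -> exists K : set 'rV[R]_n,
  [/\ compact K, K `<=` U & forall x, f x != 0 -> K x].
Proof. by case=> sf cf sU; exists (tsupp f); split => // x fx; apply: subset_closure. Qed.

Lemma Cc_smoothD U f g : Cc_smooth U f -> Cc_smooth U g -> Cc_smooth U (f + g).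
Proof.
move=> /[dup] [[sf _ _]] /Cc_smoothP[K [cK KU fK]].
move=> /[dup] [[sg _ _]] /Cc_smoothP[K' [cK' KU' gK]].
apply: (@Cc_smooth_sub _ _ (K `|` K')).
- exact: smoothD.
- exact: compactU.
- move=> x fgx; have [fx|fx] := eqVneq (f x) 0; last by left; exact: fK.
  by right; apply: gK; apply: contra_neq fgx => gx; rewrite /= fctE fx gx addr0.
- by move=> x [/KU|/KU'].
Qed.

Lemma Cc_smoothZ U f c : Cc_smooth U f -> Cc_smooth U (c *: f).
Proof.
move=> /[dup] [[sf _ _]] /Cc_smoothP[K [cK KU fK]].
apply: (@Cc_smooth_sub _ _ K) => //; first exact: smoothZ.
by move=> x; rewrite fctE => fx; apply: fK; apply: contra_neq fx => ->; rewrite scaler0.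
Qed.

Lemma Cc_smooth_derive U f i : Cc_smooth U f ->
  Cc_smooth U ('D_(delta_mx ord0 i) f).
Proof.
move=> [sf cf sU]; apply: (@Cc_smooth_sub _ _ (tsupp f)) => //.
  exact: smooth_derive.
move=> x; apply: contraPP => xK; apply/negP; rewrite negbK; apply/eqP.
have : nbhs x (~` tsupp f).
  by apply: open_nbhs_nbhs; split => //; apply: closed_openC; exact: closed_closure.
move=> nx; have [_ <-] := is_derive_cst (0 : R) x (delta_mx ord0 i).
apply: near_eq_derive; near=> y => /=.
have : ~ tsupp f y by near: y.
by move=> h; apply/eqP; apply: contra_notT h => fy; apply: subset_closure.
Unshelve. all: by end_near. Qed.

Definition cbox (a b : 'rV[R]_n) : set 'rV[R]_n :=
  [set x | forall i, a ord0 i <= x ord0 i <= b ord0 i].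

Lemma cbox_compact a b : compact (cbox a b).
Proof.
rewrite (_ : cbox a b = [set x | forall i, `[a ord0 i, b ord0 i]%classic (x ord0 i)]).
  apply: (@rV_compact _ _ (fun i => `[a ord0 i, b ord0 i]%classic)) => i.
  exact: segment_compact.
by apply/seteqP; split => x /= + i => /(_ i); rewrite in_itv.
Qed.

Lemma obox_cbox a b : obox a b `<=` cbox a b.
Proof. by move=> x xab i; have /andP[/ltW -> /ltW ->] := xab i. Qed.

(** The parameter m is a steepness: as it grows the bump tends to the indicator of the box. Unequal
    sides are allowed so that integrals over all boxes can be reached. *)
Definition bump (m : R) (a b x : 'rV[R]_n) : R :=
  \prod_(i < n) (psi 1 (m * (x ord0 i - a ord0 i)) * psi 1 (m * (b ord0 i - x ord0 i))).

Lemma elem_bump m a b : elem (bump m a b).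
Proof.
have -> : bump m a b = \prod_(i < n)
    ((fun x => psi 1 (m * x ord0 i + - (m * a ord0 i))) *
     (fun x => psi 1 (- m * x ord0 i + m * b ord0 i))).
  apply/funext => x; rewrite /bump fct_prodE; apply: eq_bigr => i _ /=.
  by rewrite fctE/=; congr (psi _ _ * psi _ _); ring.
elim: (index_enum _) => [|i r IH]; first by rewrite big_nil; exact: elem_cst.
by rewrite big_cons; do 2 apply: elem_mul => //; exact: elem_psi.
Qed.

Lemma psi1_gt0 (t : R) : 0 < t -> 0 < psi 1 t.
Proof. by move=> t0; rewrite /psi t0 hornerC mul1r expR_gt0. Qed.

Lemma psi1_ge0 (t : R) : 0 <= psi 1 t.
Proof. by rewrite /psi; case: ifP => // _; rewrite hornerC mul1r expR_ge0. Qed.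

Lemma psi1_le1 (t : R) : psi 1 t <= 1.
Proof.
rewrite /psi; case: ifP => // t0; rewrite hornerC mul1r -expR0 ler_expR.
by rewrite oppr_le0 invr_ge0 ltW.
Qed.

Lemma bump_ge0 m a b x : 0 <= bump m a b x.
Proof. by apply: prodr_ge0 => i _; rewrite mulr_ge0// psi1_ge0. Qed.

Lemma bump_le1 m a b x : bump m a b x <= 1.
Proof.
apply: prodr_ile1 => i _.
by rewrite mulr_ge0 ?psi1_ge0//= mulr_ile1 ?psi1_ge0 ?psi1_le1.
Qed.

Lemma bump_gt0 m a b x : 0 < m -> obox a b x -> 0 < bump m a b x.
Proof.
move=> m0 xab; apply: prodr_gt0 => i _; have /andP[ax xb] := xab i.
by rewrite mulr_gt0// psi1_gt0// mulr_gt0// subr_gt0.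
Qed.

Lemma bump_neq0 m a b x : 0 < m -> bump m a b x != 0 -> obox a b x.
Proof.
move=> m0 /prodf_neq0 H i; have := H i isT; rewrite mulf_eq0 negb_or => /andP[].
rewrite /psi; case: ifPn => [|_]; last by rewrite eqxx.
rewrite pmulr_rgt0// subr_gt0 => -> _; case: ifPn => [|_]; last by rewrite eqxx.
by rewrite pmulr_rgt0// subr_gt0 => ->.
Qed.

Lemma elem_bump_Cc U g m a b : 0 < m -> elem g -> cbox a b `<=` U ->
  Cc_smooth U (g * bump m a b).
Proof.
move=> m0 eg abU; apply: (@Cc_smooth_sub _ _ (cbox a b)) => //.
- by apply: elem_smooth; apply: elem_mul => //; exact: elem_bump.
- exact: cbox_compact.
- move=> x; rewrite fctE mulf_eq0 negb_or => /andP[_ /bump_neq0].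
  by move=> /(_ m0); exact: obox_cbox.
Qed.

Lemma bump_Cc U m a b : 0 < m -> cbox a b `<=` U -> Cc_smooth U (bump m a b).
Proof.
move=> m0 abU; rewrite -[bump _ _ _]mul1r; apply: elem_bump_Cc => //.
exact: elem_cst.
Qed.

Lemma psi1_cvg (t : R) : 0 < t -> psi 1 (k%:R * t) @[k --> \oo] --> (1 : R).
Proof.
move=> t0.
have H : (fun k : nat => expR (- (k.+1%:R^-1 * t^-1))) @ \oo --> expR (- (0 * t^-1)).
  apply: continuous_cvg; first exact: continuous_expR.
  by apply: cvgN; apply: cvgM; [exact: cvg_harmonic|exact: cvg_cst].
rewrite mul0r oppr0 expR0 in H.
rewrite -cvg_shiftS/=; apply: cvg_trans H; apply: near_eq_cvg; near=> k.
by rewrite /psi pmulr_rgt0// t0 hornerC mul1r invfM.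
Unshelve. all: by end_near. Qed.

Lemma bump_cvg a b x : bump k%:R a b x @[k --> \oo] --> (\1_(obox a b) x : R).
Proof.
have [xab|xab] := pselect (obox a b x); last first.
  rewrite indicE memNset//=; apply: cvg_near_cst.
  near=> k; apply/eqP; apply: contra_notT xab; apply: bump_neq0.
  by rewrite ltr0n; near: k; exists 1%N.
rewrite indicE mem_set//= (_ : 1%:R = \prod_(i < n) (1 * 1 : R)); last first.
  by rewrite big1// => i _; rewrite mulr1.
have := @cvg_big R 'I_n *%R 1 xpredT (@mul_continuous R) nat \oo (index_enum 'I_n)
  (fun i k => psi 1 (k%:R * (x ord0 i - a ord0 i)) * psi 1 (k%:R * (b ord0 i - x ord0 i)))
  (fun=> 1 * 1).
apply => // i _.
have /andP[ax xb] := xab i.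
by apply: cvgM; apply: psi1_cvg; rewrite subr_gt0.
Unshelve. all: by end_near. Qed.

End elementary.

Section lipschitz.
Context {R : realType} {n : nat}.
Implicit Types (f g : 'rV[R]_n -> R) (U : set 'rV[R]_n).

Lemma Cc_bounded U f : Cc_smooth U f -> exists2 M, 0 <= M & forall x, `|f x| <= M.
Proof.
move=> [sf cf _]; have cnf : continuous f by have [] := sf [::].
have [M [Mr HM]] : bounded_set (f @` tsupp f).
  by apply: compact_bounded; apply: continuous_compact => //; exact: continuous_subspaceT.
exists (`|M| + 1) => [|x]; first by rewrite addr_ge0.
have [fx|fx] := eqVneq (f x) 0; first by rewrite fx normr0 addr_ge0.
apply: (HM (`|M| + 1)); first by rewrite (le_lt_trans (ler_norm M))// ltrDl.
by exists x => //; exact: subset_closure.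
Qed.

Lemma smooth_is_derive f i x : smooth f ->
  is_derive x (delta_mx ord0 i) f ('D_(delta_mx ord0 i) f x).
Proof. by move=> sf; apply: derivableP; have [_] := sf [::]; exact. Qed.

Lemma smooth_continuous f : smooth f -> continuous f.
Proof. by move=> /(_ [::])[]. Qed.

Lemma smooth_MVT f i x t : smooth f -> exists2 c, `|c| <= `|t| &
  f (t *: delta_mx ord0 i + x) - f x = 'D_(delta_mx ord0 i) f (c *: delta_mx ord0 i + x) * t.
Proof.
move=> sf; set e := delta_mx _ _; pose g (h : R) := f (h *: e + x).
have dg (h : R) : is_derive h (1 : R) g ('D_e f (h *: e + x)).
  by apply/is_derive_line; exact: smooth_is_derive.
have cg : continuous g.
  by move=> h; apply: differentiable_continuous; apply/derivable1_diffP; have [] := dg h.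
have g0 : f x = g 0 by rewrite /g scale0r add0r.
have [t0|t0] := leP 0 t.
  have [c] := MVT_segment t0 (fun h _ => dg h) (continuous_subspaceT cg).
  rewrite in_itv/= => /andP[c0 ct] E; exists c; first by rewrite !ger0_norm// (le_trans c0).
  by rewrite g0 -/(g t) E subr0.
have [c] := MVT_segment (ltW t0) (fun h _ => dg h) (continuous_subspaceT cg).
rewrite in_itv/= => /andP[tc c0] E; exists c; first by rewrite !ler0_norm ?lerN2// ltW.
by rewrite g0 -/(g t) -opprB E sub0r mulrN opprK.
Qed.

Lemma Cc_lipschitz U f : Cc_smooth U f ->
  exists2 L, 0 <= L & forall x y, `|f x - f y| <= L * `|x - y|.
Proof.
move=> Cf; have [sf _ _] := Cf.
have [M M0 HM] : exists2 M, 0 <= M & forall i x, `|'D_(delta_mx ord0 i) f x| <= M.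
  have H i := Cc_bounded (Cc_smooth_derive i Cf).
  have {}H i : {M | 0 <= M & forall x, `|'D_(delta_mx ord0 i) f x| <= M} by exact/cid2/H.
  exists (\sum_i s2val (H i)) => [|i x]; first by apply: sumr_ge0 => i _; case: (H i).
  rewrite (bigD1 i)//= ler_wpDr//; last by case: (H i) => /=.
  by apply: sumr_ge0 => j _; case: (H j).
exists (n%:R * M) => [|x y]; first by rewrite mulr_ge0.
(* The path from y to x that changes one coordinate at a time; the mean value theorem bounds each of
   its n steps. *)
pose z k : 'rV[R]_n := \row_i if (i < k)%N then x ord0 i else y ord0 i.
have -> : f x - f y = f (z n) - f (z 0%N).
  by congr (f _ - f _); apply/rowP => i; rewrite mxE ?ltn_ord.
suff H k : (k <= n)%N -> `|f (z k) - f (z 0%N)| <= k%:R * M * `|x - y| by exact: H.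
elim: k => [|k IH] kn; first by rewrite subrr normr0 !mul0r.
have zk : z k.+1 = (x ord0 (Ordinal kn) - y ord0 (Ordinal kn)) *: delta_mx ord0 (Ordinal kn) + z k.
  apply/rowP => i; rewrite !mxE eqxx/= ltnS leq_eqVlt.
  have [->|ik] := eqVneq i (Ordinal kn); first by rewrite eqxx ltnn /= mulr1 subrK.
  rewrite mulr0 add0r; case: eqP => //= ik'.
  by move: ik; rewrite -(inj_eq val_inj)/= ik' eqxx.
have [c _ E] := smooth_MVT (Ordinal kn) (z k) (x ord0 (Ordinal kn) - y ord0 (Ordinal kn)) sf.
rewrite -(subrKA (f (z k))) (le_trans (ler_normD _ _))//.
rewrite -(natr1 k) mulrDl mulrDl mul1r addrC lerD// ?IH// 1?ltnW//.
rewrite zk E normrM ler_pM// .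
by have := rV_coord_le (x - y) (Ordinal kn); rewrite !mxE.
Qed.

End lipschitz.

Section integral_bounded.
Local Open Scope ereal_scope.
Context d (T : measurableType d) (R : realType) (m : {measure set T -> \bar R}).

Lemma integrable_mul_bounded (w g : T -> R) M : m.-integrable setT (EFin \o w) ->
  measurable_fun setT g -> (forall x, (`|g x| <= M)%R) ->
  m.-integrable setT (EFin \o (w \* g)%R).
Proof.
move=> iw mg gM; have mw : measurable_fun setT w.
  by have /measurable_EFinP := measurable_int m iw.
apply: (@le_integrable _ _ _ m setT measurableT _ (fun x => M%:E * (EFin \o w) x)).
- by apply/measurable_EFinP; exact: measurable_funM.
- move=> x _; rewrite /= lee_fin !normrM mulrC ler_wpM2r//.
  by rewrite (le_trans (gM x))// ler_norm.
- exact: integrableZl.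
Qed.

Lemma Rintegral_mul_bounded (w g : T -> R) M : m.-integrable setT (EFin \o w) ->
  measurable_fun setT g -> (forall x, (`|g x| <= M)%R) ->
  (`| \int[m]_x (w x * g x) | <= M * \int[m]_x `|w x|)%R.
Proof.
move=> iw mg gM; have iwg := integrable_mul_bounded iw mg gM.
apply: (le_trans (le_normr_Rintegral measurableT iwg)).
have inw : m.-integrable setT (fun x => (`|w x|)%:E) by exact: integrable_norm.
rewrite -RintegralZl//; apply: le_Rintegral => //.
- exact: (integrable_norm iwg).
- exact: (integrableZl _ _ inw).
- by move=> x _; rewrite normrM mulrC ler_wpM2r.
Qed.
End integral_bounded.

Section lipschitz_continuous.
Context {R : realType} {n : nat}.
Implicit Types (f : 'rV[R]_n -> R).

Lemma lipschitz_rV_continuous f L : 0 <= L ->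
  (forall x y, `|f x - f y| <= L * `|x - y|) -> continuous f.
Proof.
move=> L0 HL x; apply/(@cvgrPdist_lt _ _ _ _ (nbhs_filter x)) => /= e e0.
apply/nbhs_ballP; exists (e / (L + 1)) => /=; first by rewrite divr_gt0// ltr_wpDl.
move=> y /rV_ballE; rewrite ltr_pdivlMr ?ltr_wpDl// => xy.
rewrite (le_lt_trans (HL _ _))// (le_lt_trans _ xy)//.
by rewrite mulrC ler_wpM2l// lerDl.
Qed.

Lemma continuous_reflect f (x : 'rV[R]_n) : continuous f -> continuous (fun y : 'rV[R]_n => f (x - y)).
Proof.
move=> cf y; apply: (@continuous_comp _ _ _ (fun y : 'rV[R]_n => x - y)); last exact: cf.
apply: (@continuousB R 'rV[R]_n 'rV[R]_n (fun=> x) id); first exact: cst_continuous.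
by move=> ?.
Qed.

Lemma measurable_reflect f (x : 'rV[R]_n) :
  continuous f -> measurable_fun setT (fun y : 'rV[R]_n => f (x - y)).
Proof. by move=> cf; apply: rV_continuous_measurable; exact: continuous_reflect. Qed.

End lipschitz_continuous.

(** * Convolution of an integrable function with a test function *)

Section convolution.
Context {R : realType} {n : nat}.
Local Notation mu := (@lebesgue_rV R n).
Implicit Types (f g w : 'rV[R]_n -> R).

Definition conv w f (x : 'rV[R]_n) : R := \int[mu]_y (w y * f (x - y)).

Variables (w : 'rV[R]_n -> R) (iw : mu.-integrable setT (EFin \o w)).
Let I := (\int[mu]_y `|w y|)%R.
Let I0 : 0 <= I. Proof. exact: Rintegral_ge0. Qed.

Lemma conv_integrable U f x : Cc_smooth U f ->
  mu.-integrable setT (fun y => (w y * f (x - y))%:E).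
Proof.
move=> Cf; have [M M0 HM] := Cc_bounded Cf.
have H : measurable_fun setT (fun y : 'rV[R]_n => f (x - y)).
  by apply: measurable_reflect; apply: smooth_continuous; case: Cf.
exact: (integrable_mul_bounded iw H (fun y => HM (x - y))).
Qed.

Lemma conv_continuous U f : Cc_smooth U f -> continuous (conv w f).
Proof.
move=> Cf; have [L L0 HL] := Cc_lipschitz Cf; have [sf _ _] := Cf.
apply: (@lipschitz_rV_continuous _ _ _ (L * I)); first by rewrite mulr_ge0.
move=> x y; rewrite /conv -RintegralB//; try exact: (conv_integrable _ Cf).
under eq_Rintegral do rewrite -mulrBr.
have mg : measurable_fun setT (fun z : 'rV[R]_n => f (x - z) - f (y - z)).
  by apply: measurable_funB; apply: measurable_reflect; exact: smooth_continuous.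
have gle z : `|f (x - z) - f (y - z)| <= L * `|x - y|.
  by rewrite (le_trans (HL _ _))// opprB addrA subrK.
by rewrite (le_trans (Rintegral_mul_bounded iw mg gle))// mulrAC.
Qed.

(** The derivative of f is Lipschitz, so the difference quotient of f differs from it by O(h)
    uniformly in the point. Integrating this bound against |w| suffices. *)
Lemma conv_derive U f i x : Cc_smooth U f ->
  is_derive x (delta_mx ord0 i) (conv w f) (conv w ('D_(delta_mx ord0 i) f) x).
Proof.
move=> Cf; have CDf := Cc_smooth_derive i Cf.
have [L L0 HL] := Cc_lipschitz CDf; have [sf _ _] := Cf; have [sDf _ _] := CDf.
set e := delta_mx _ _.
suff H : (fun h : R => h^-1 *: ((conv w f \o shift x) (h *: e) - conv w f x)) @ 0^'
   --> conv w ('D_e f) x by apply: DeriveDef; [apply/cvg_ex; eexists; exact: H|exact: cvg_lim].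
apply/cvgrPdist_lt => /= eps eps0; near=> h.
have h0 : h != 0 by near: h; exact: nbhs_dnbhs_neq.
pose g (y : 'rV[R]_n) := 'D_e f (x - y) - h^-1 * (f (h *: e + x - y) - f (x - y)).
have mg : measurable_fun setT g.
  have m1 := measurable_reflect x (smooth_continuous sDf).
  apply: measurable_funB; first exact: m1.
  apply: measurable_funM => //.
  by apply: measurable_funB; apply: measurable_reflect; exact: smooth_continuous.
have gle y : `|g y| <= L * `|h|.
  rewrite /g -addrA; have [c ch ->] := smooth_MVT i (x - y) h sf.
  rewrite [X in _ - X]mulrC mulfK// (le_trans (HL _ _))// ler_wpM2l//.
  rewrite opprD addrCA subrr addr0 normrN mx_normZ.
  rewrite (le_trans _ ch)// ler_piMr//.
  apply/rV_norm_leP => // j; rewrite mxE eqxx/= ger0_norm//.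
  by case: (j == i).
have -> : conv w ('D_e f) x - h^-1 *: (conv w f (h *: e + x) - conv w f x) =
    \int[mu]_y (w y * g y).
  rewrite /conv /GRing.scale/= -RintegralB//; try exact: (conv_integrable _ Cf).
  have iD : mu.-integrable setT
      (fun y => (w y * f (h *: e + x - y) - w y * f (x - y))%:E).
    exact: (integrableB measurableT (conv_integrable (h *: e + x) Cf) (conv_integrable x Cf)).
  rewrite -RintegralZl// -RintegralB//; [|exact: (conv_integrable _ CDf)|].
    by apply: eq_Rintegral => y _; rewrite /g; ring.
  exact: (integrableZl measurableT h^-1 iD).
rewrite (le_lt_trans (Rintegral_mul_bounded iw mg gle))// -/I.
have : `|h| < eps / (L * I + 1).
  near: h; apply: nbhs_dnbhs; apply/nbhs_ballP.
  exists (eps / (L * I + 1)) => /=; first by rewrite divr_gt0// ltr_wpDl// mulr_ge0.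
  by move=> z /=; rewrite /ball/= sub0r normrN.
rewrite ltr_pdivlMr ?ltr_wpDl// ?mulr_ge0// => hl.
rewrite (le_lt_trans _ hl)// mulrAC mulrC ler_wpM2l// lerDl//.
Unshelve. all: by end_near. Qed.

Lemma conv_smooth U f : Cc_smooth U f -> smooth (conv w f).
Proof.
move=> Cf.
have CP l : Cc_smooth U (pderivs l f).
  by elim: l => //= i l; exact: Cc_smooth_derive.
suff H l : pderivs l (conv w f) = conv w (pderivs l f).
  move=> l; rewrite H; split; first exact: conv_continuous (CP l).
  by move=> i x; have [] := conv_derive i x (CP l).
elim: l => //= i l ->; apply/funext => x.
by have [] := conv_derive i x (CP l).
Qed.

Lemma conv_Cc U f r : (forall x, r < `|x| -> w x = 0) -> Cc_smooth U f ->
  Cc_smooth setT (conv w f).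
Proof.
move=> w0 Cf; have [K [cK _ fK]] := Cc_smoothP Cf.
have [M [Mr HM]] := compact_bounded cK.
pose B := `|r| + (`|M| + 1).
apply: (@Cc_smooth_sub _ _ _ _ (cbox (const_mx (- B)) (const_mx B))) => //.
- exact: conv_smooth Cf.
- exact: cbox_compact.
move=> x; apply: contraPP => xB; apply/negP; rewrite negbK; apply/eqP.
transitivity (\int[mu]_(y in setT) (0 : R)); last by rewrite Rintegral_cst// mul0r.
apply: eq_Rintegral => y _.
have [ry|ry] := ltP r `|y|; first by rewrite w0// mul0r.
have [->|/fK/(HM (`|M| + 1))] := eqVneq (f (x - y)) 0; first by rewrite mulr0.
rewrite (le_lt_trans (ler_norm M)) ?ltrDl// => /(_ isT) xyM.
exfalso; apply: xB => i; rewrite !mxE -ler_norml (le_trans (rV_coord_le _ _))//.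
rewrite -(subrK y x) addrC (le_trans (ler_normD _ _))// lerD//.
by rewrite (le_trans ry)// ler_norm.
Qed.

End convolution.

(** * Square-integrable functions *)

Section square_integrable.
Context d (T : measurableType d) (R : realType) (m : {measure set T -> \bar R}).
Implicit Types (f g h : T -> R).

Definition sqint f := measurable_fun setT f /\ (\int[m]_x ((f x) ^+ 2)%:E < +oo)%E.

Definition ip f g : R := \int[m]_x (f x * g x).

Lemma measurable_sq f : measurable_fun setT f -> measurable_fun setT (fun x => ((f x) ^+ 2)%:E).
Proof. by move=> mf; apply/measurable_EFinP; exact: measurable_funX. Qed.

Lemma sqintD f g : sqint f -> sqint g -> sqint (fun x => f x + g x).
Proof.
move=> [mf f2] [mg g2]; split; first exact: measurable_funD.
have H x : (((f x + g x) ^+ 2)%:E <= 2%:E * ((f x) ^+ 2)%:E + 2%:E * ((g x) ^+ 2)%:E)%E.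
  rewrite -!EFinM -EFinD lee_fin; have : 0 <= (f x - g x) ^+ 2 by exact: sqr_ge0.
  rewrite !expr2; nra.
apply: (@le_lt_trans _ _ (\int[m]_x (2%:E * ((f x) ^+ 2)%:E + 2%:E * ((g x) ^+ 2)%:E))%E).
  apply: ge0_le_integral => //.
  - by move=> x _; rewrite lee_fin sqr_ge0.
  - by apply: measurable_sq; exact: measurable_funD.
  - by apply: emeasurable_funD; apply: measurable_funeM; exact: measurable_sq.
rewrite ge0_integralD//.
- rewrite !ge0_integralZl//; try exact: measurable_sq; try by move=> x _; rewrite lee_fin sqr_ge0.
  by rewrite lte_add_pinfty// lte_mul_pinfty.
- by move=> x _; rewrite -EFinM lee_fin mulr_ge0// sqr_ge0.
- by apply: measurable_funeM; exact: measurable_sq.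
- by move=> x _; rewrite -EFinM lee_fin mulr_ge0// sqr_ge0.
- by apply: measurable_funeM; exact: measurable_sq.
Qed.

Lemma sqint_bM f h M : sqint f -> measurable_fun setT h -> (forall x, `|h x| <= M) ->
  sqint (fun x => h x * f x).
Proof.
move=> [mf f2] mh hM; split; first exact: measurable_funM.
apply: (@le_lt_trans _ _ (\int[m]_x ((M ^+ 2)%:E * ((f x) ^+ 2)%:E))%E).
  apply: ge0_le_integral => //.
  - by move=> x _; rewrite lee_fin sqr_ge0.
  - by apply: measurable_sq; exact: measurable_funM.
  - by apply: measurable_funeM; exact: measurable_sq.
  - move=> x _; rewrite -EFinM lee_fin exprMn ler_wpM2r ?sqr_ge0//.
    by rewrite -(real_normK (num_real (h x))) ler_pXn2r// nnegrE (le_trans _ (hM x)).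
rewrite ge0_integralZl//; [|exact: measurable_sq| |].
- by rewrite lte_mul_pinfty// lee_fin sqr_ge0.
- by move=> x _; rewrite lee_fin sqr_ge0.
- by rewrite lee_fin sqr_ge0.
Qed.

Lemma sqintZ f c : sqint f -> sqint (fun x => c * f x).
Proof. by move=> sf; apply: (sqint_bM (h := fun=> c) (M := `|c|)). Qed.

Lemma sqintB f g : sqint f -> sqint g -> sqint (fun x => f x - g x).
Proof.
move=> sf sg; have := sqintD sf (sqintZ (-1) sg).
by rewrite (_ : (fun x => f x + -1 * g x) = (fun x => f x - g x))//; apply/funext => x; rewrite mulN1r.
Qed.

Lemma sqint_ip f g : sqint f -> sqint g -> m.-integrable setT (fun x => (f x * g x)%:E).
Proof.
move=> sf sg; have [mf f2] := sf; have [mg g2] := sg.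
apply/integrableP; split; first by apply/measurable_EFinP; exact: measurable_funM.
apply: (@le_lt_trans _ _ (\int[m]_x (((f x) ^+ 2)%:E + ((g x) ^+ 2)%:E))%E).
  apply: ge0_le_integral => //.
  - apply: measurableT_comp => //; apply/measurable_EFinP; exact: measurable_funM.
  - by apply: emeasurable_funD; exact: measurable_sq.
  - move=> x _; rewrite -EFinD lee_fin.
    have := sqr_ge0 (f x - g x); have := sqr_ge0 (f x + g x).
    rewrite !expr2 => H1 H2; rewrite ler_norml; apply/andP; split; nra.
rewrite ge0_integralD//.
- by rewrite lte_add_pinfty.
- by move=> x _; rewrite lee_fin sqr_ge0.
- exact: measurable_sq.
- by move=> x _; rewrite lee_fin sqr_ge0.
- exact: measurable_sq.
Qed.

Lemma ipC f g : ip f g = ip g f.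
Proof. by apply: eq_Rintegral => x _; rewrite mulrC. Qed.

Lemma ipDl f g h : sqint f -> sqint g -> sqint h ->
  ip (fun x => f x + g x) h = ip f h + ip g h.
Proof.
move=> sf sg sh; rewrite -RintegralD//; [|exact: sqint_ip|exact: sqint_ip].
by apply: eq_Rintegral => x _; rewrite mulrDl.
Qed.

Lemma ipZl f h c : sqint f -> sqint h -> ip (fun x => c * f x) h = c * ip f h.
Proof.
move=> sf sh; rewrite -RintegralZl//; last exact: sqint_ip.
by apply: eq_Rintegral => x _; rewrite mulrA.
Qed.

Lemma ipE f : sqint f -> (ip f f)%:E = (\int[m]_x ((f x) ^+ 2)%:E)%E.
Proof.
move=> [mf f2]; rewrite /ip /Rintegral; under eq_integral do rewrite -expr2.
have f0 : (0 <= \int[m]_x ((f x) ^+ 2)%:E)%E.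
  by apply: integral_ge0 => x _; rewrite lee_fin sqr_ge0.
by rewrite fineK// ge0_fin_numE.
Qed.

Lemma ip_ge0 f : 0 <= ip f f.
Proof. by apply: Rintegral_ge0 => // x _; rewrite -expr2 sqr_ge0. Qed.

Lemma ip_ae f g h : measurable_fun setT f -> measurable_fun setT g -> measurable_fun setT h ->
  {ae m, forall x, f x = g x} -> ip f h = ip g h.
Proof.
move=> mf mg mh fg; rewrite /ip /Rintegral; congr fine.
apply: ae_eq_integral => //; try by apply/measurable_EFinP; exact: measurable_funM.
by apply: filterS fg => x fgx _; rewrite fgx.
Qed.

Lemma ip_CS f g : sqint f -> sqint g -> ip f g ^+ 2 <= ip f f * ip g g.
Proof.
move=> sf sg.
have P t : 0 <= ip f f + 2 * t * ip f g + t ^+ 2 * ip g g.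
  have stg := sqintZ t sg.
  have := ip_ge0 (fun x => f x + t * g x).
  rewrite ipDl//; last exact: sqintD.
  rewrite ipZl//; last exact: sqintD.
  rewrite ![ip _ (fun x => _ + _)]ipC !ipDl// !ipZl// (ipC g f).
  by congr (_ <= _); ring.
have [g0|g0] := eqVneq (ip g g) 0.
  rewrite g0 mulr0; have [->|fg0] := eqVneq (ip f g) 0; first by rewrite expr0n.
  (* The polynomial is affine here, and this t gives it the value -1. *)
  have := P (- (ip f f + 1) / (2 * ip f g)); rewrite g0 mulr0 addr0.
  rewrite (_ : 2 * _ * _ = - (ip f f + 1)); last by field.
  by rewrite opprD addrA subrr add0r ler0N1.
have gp : 0 < ip g g by rewrite lt_neqAle eq_sym g0 ip_ge0.
have := P (- ip f g / ip g g).
rewrite (_ : _ + _ = ip f f - ip f g ^+ 2 / ip g g); last by field.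
by rewrite subr_ge0 ler_pdivrMr.
Qed.

(* Chebyshev in disguise: [4^k ||u_(k+1) - u_k||^2] is summable along a fast
   subsequence, which forces geometric pointwise convergence. *)
Lemma sqint_cauchy_subseq (u : nat -> T -> R) : (forall k, sqint (u k)) ->
  (forall e : R, 0 < e -> exists N, forall k l, (N <= k)%N -> (N <= l)%N ->
     ip (fun x => u k x - u l x) (fun x => u k x - u l x) < e) ->
  exists phi : nat -> nat, (forall j, (j <= phi j)%N) /\
    exists2 v : T -> R, measurable_fun setT v &
      {ae m, forall x, u (phi j) x @[j --> \oo] --> v x}.
Proof.
move=> su cu.
have {}cu j : {N | forall k l, (N <= k)%N -> (N <= l)%N ->
     ip (fun x => u k x - u l x) (fun x => u k x - u l x) < 8^-1 ^+ j}.
  by apply: cid; apply: cu; rewrite exprn_gt0// invr_gt0.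
pose phi j := (j + \sum_(i < j.+1) sval (cu i))%N.
have phiS j : (phi j <= phi j.+1)%N by rewrite /phi [in leqRHS]big_ord_recr/= addSn; lia.
have phiN j : (sval (cu j) <= phi j)%N by rewrite /phi big_ord_recr/=; lia.
exists phi; split; first by move=> j; rewrite leq_addr.
pose dd j x := u (phi j.+1) x - u (phi j) x.
have sd j : sqint (dd j) by exact: sqintB.
have dle j : ip (dd j) (dd j) <= 8^-1 ^+ j.
  apply/ltW; have := svalP (cu j) (phi j.+1) (phi j); apply; last exact: phiN.
  exact: leq_trans (phiN j) (phiS j).
pose F j x := ((4 ^+ j * (dd j x) ^+ 2)%:E : \bar R).
have F0 j x : (0 <= F j x)%E by rewrite lee_fin; apply: mulr_ge0; [exact: exprn_ge0|exact: sqr_ge0].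
have mF j : measurable_fun setT (F j).
  apply/measurable_EFinP; apply: measurable_funM => //.
  by apply: measurable_funX; have [] := sd j.
pose S x := (\sum_(j <oo) F j x)%E.
have S0 x : (0 <= S x)%E by exact: nneseries_ge0.
have mS : measurable_fun setT S by apply: ge0_emeasurable_sum.
have iS : m.-integrable setT S.
  apply/integrableP; split => //.
  under eq_integral do rewrite gee0_abs//.
  rewrite integral_nneseries//.
  apply: (@le_lt_trans _ _ (\sum_(j <oo) (2^-1 ^+ j)%:E)%E).
    apply: lee_nneseries => [j _ _|j _]; first exact: integral_ge0.
    under eq_integral do rewrite /F EFinM.
    have mdj : measurable_fun setT (fun x => ((dd j x) ^+ 2)%:E).
      by apply: measurable_sq; have [] := sd j.
    rewrite (ge0_integralZl m measurableT mdj); last 2 first.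
    - by move=> x _; rewrite lee_fin sqr_ge0.
    - by rewrite lee_fin exprn_ge0.
    rewrite -ipE// -EFinM lee_fin.
    apply: (@le_trans _ _ (4 ^+ j * 8^-1 ^+ j)); first by rewrite ler_wpM2l ?exprn_ge0.
    by rewrite -exprMn (_ : 4 * 8^-1 = 2^-1 :> R)//; lra.
  have h2 : `|2^-1 : R| < 1 by rewrite ger0_norm ?invr_ge0// invf_lt1// ltr1n.
  rewrite (_ : (\sum_(j <oo) (2^-1 ^+ j)%:E)%E = ((1 - 2^-1)^-1)%:E) ?ltry//.
  have H := cvg_geometric_series (a := 1) h2.
  apply/cvg_lim => //; rewrite -(mul1r (1 - _)^-1).
  apply: cvg_EFin.
    by apply: nearW => k /=; rewrite sumEFin.
  apply: cvg_trans H; apply: near_eq_cvg; apply: nearW => k.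
  rewrite /series/= /geometric/= sumEFin /=.
  by apply: eq_bigr => i _; rewrite mul1r.
have aeS : {ae m, forall x, S x \is a fin_num}.
  by apply: filterS (integrable_ae measurableT iS) => x /= /(_ I).
have cv x : S x \is a fin_num -> cvgn (fun j => u (phi j) x).
  move=> Sf.
  have dS j : `|dd j x| <= Num.sqrt (fine (S x)) * 2^-1 ^+ j.
    have Fle : 4 ^+ j * (dd j x) ^+ 2 <= fine (S x).
      rewrite -lee_fin fineK//.
      apply: le_trans (nneseries_lim_ge j.+1 (fun k _ _ => F0 k x)).
      by rewrite big_mkord big_ord_recr/= leeDr// sume_ge0.
    rewrite -sqrtr_sqr -ler_pdivrMr ?exprn_gt0 ?invr_gt0// exprVn invrK.
    rewrite -[2 ^+ j]ger0_norm ?exprn_ge0// -sqrtr_sqr -sqrtrM ?sqr_ge0//.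
    apply: ler_wsqrtr; rewrite mulrC -exprM mulnC exprM.
    by rewrite (_ : 2 ^+ 2 = 4 :> R)//; ring.
  have cs : cvgn (series (fun j => dd j x)).
    apply: normed_cvg; apply: (series_le_cvg (v_ := geometric (Num.sqrt (fine (S x))) 2^-1)).
    - by move=> k; exact: normr_ge0.
    - by move=> k; rewrite /geometric/= mulr_ge0 ?sqrtr_ge0// exprn_ge0// invr_ge0.
    - exact: dS.
    - apply: is_cvg_geometric_series.
      by rewrite ger0_norm ?invr_ge0// invf_lt1// ltr1n.
  rewrite (_ : (fun j => u (phi j) x) = (fun j => u (phi 0%N) x + series (fun j => dd j x) j)).
    by apply: is_cvgD => //; exact: is_cvg_cst.
  apply/funext => j; rewrite /series/= (telescope_sumr (fun i => u (phi i) x))//.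
  by rewrite addrC subrK.
(* Truncation to 0 on the null set where the series diverges makes the sequence converge everywhere,
   so that its limit is measurable. *)
pose mk j x := if S x \is a fin_num then u (phi j) x else 0.
pose v x := limn (fun j => mk j x).
have mkcv x : mk j x @[j --> \oo] --> v x.
  rewrite /v; have [Sx|Sx] := boolP (S x \is a fin_num).
    have -> : mk ^~ x = (fun j => u (phi j) x) by apply/funext => j; rewrite /mk Sx.
    exact: cv.
  have -> : mk ^~ x = (fun=> 0) by apply/funext => j; rewrite /mk (negbTE Sx).
  exact: is_cvg_cst.
exists v.
  apply: (measurable_fun_cvg (h := mk)) => // j.
  apply: measurable_fun_ifT => //.
    rewrite (_ : (fun x => S x \is a fin_num) = (fun x => (S x < +oo)%E)).
      exact: (@measurable_fun_lte _ _ _ _ S (cst +oo%E)).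
    by apply/funext => x; rewrite ge0_fin_numE.
  by have [] := su (phi j).
apply: filterS aeS => x Sx; have := mkcv x.
by have -> : mk ^~ x = (fun j => u (phi j) x) by apply/funext => j; rewrite /mk Sx.
Unshelve. all: by end_near. Qed.

(** The form of Fatou's lemma that transfers Cauchy bounds to an almost everywhere limit; the
    sequence is shifted by N because the bound only holds eventually. *)
Lemma fatou_ae (f : nat -> T -> R) (g : T -> R) (e : \bar R) :
  (forall j, measurable_fun setT (f j)) -> (forall j x, 0 <= f j x) ->
  measurable_fun setT g -> (forall x, 0 <= g x) ->
  {ae m, forall x, f j x @[j --> \oo] --> g x} ->
  (exists N, forall j, (N <= j)%N -> (\int[m]_x (f j x)%:E <= e)%E) ->
  (\int[m]_x (g x)%:E <= e)%E.
Proof.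
move=> mf f0 mg g0 fg [N HN].
have F := @fatou _ _ _ m setT measurableT (fun j x => (f (j + N)%N x)%:E).
have mfj j : measurable_fun setT (fun x => (f (j + N)%N x)%:E) by exact/measurable_EFinP.
have f0j j x : setT x -> (0 <= (f (j + N)%N x)%:E)%E by rewrite lee_fin.
apply: (le_trans _ (le_trans (F mfj f0j) _)).
  apply: ae_ge0_le_integral => //.
  - by move=> x _; rewrite lee_fin.
  - exact/measurable_EFinP.
  - move=> x _; rewrite limn_einf_lim; apply: lime_ge; first exact: is_cvg_einfs.
    by near=> k; apply: le_ereal_inf_tmp => _ [i _ <-]; exact: f0j.
  - rewrite (_ : (fun _ => _) =
        (fun x => - limn_esup (-%E \o (fun j => (f (j + N)%N x)%:E)))%E); last first.
      by apply/funext => x; rewrite limn_esupN oppeK.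
    apply: measurableT_comp => //; apply: measurable_fun_limn_esup => j.
    by apply: measurableT_comp => //.
  apply: filterS fg => x fgx _.
  have : (f (j + N)%N x)%:E @[j --> \oo] --> (g x)%:E.
    apply/cvg_EFin; first by near=> j.
    rewrite -(cvg_shiftn N) in fgx; exact: fgx.
  by move=> /cvg_limn_einf_sup[-> _].
rewrite limn_einf_lim; apply: lime_le; first exact: is_cvg_einfs.
by near=> j; apply: (le_trans (ereal_inf_lbound _)); [exists j => //=|apply: HN; exact: leq_addl].
Unshelve. all: by end_near. Qed.

End square_integrable.

(** * Translations and the energy *)

Section translation_modulus.
Context {R : realType} {n : nat}.
Local Notation mu := (@lebesgue_rV R n).
Local Notation V := 'rV[R]_n.
Implicit Types (u : V -> R).

Lemma measurable_addrV : measurable_fun setT (fun p : V * V => p.1 + p.2).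
Proof.
apply: measurable_fun_rV => i; under eq_fun do rewrite mxE.
apply: measurable_funD.
  exact: (measurableT_comp (measurable_coord i) measurable_fst).
exact: (measurableT_comp (measurable_coord i) measurable_snd).
Qed.

Lemma measurable_opprV : measurable_fun setT (fun x : V => - x).
Proof.
apply: measurable_fun_rV => i; under eq_fun do rewrite mxE.
by apply: measurableT_comp => //; exact: measurable_coord.
Qed.

Lemma measurable_subrV : measurable_fun setT (fun p : V * V => p.1 - p.2).
Proof.
apply: measurable_fun_rV => i; under eq_fun do rewrite !mxE.
apply: measurable_funB.
  exact: (measurableT_comp (measurable_coord i) measurable_fst).
exact: (measurableT_comp (measurable_coord i) measurable_snd).
Qed.

Lemma measurable_shiftrV (z : V) : measurable_fun setT (fun x : V => x + z).
Proof.
apply: measurable_fun_rV => i; under eq_fun do rewrite mxE.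
by apply: measurable_funD => //; exact: measurable_coord.
Qed.

(** The squared L^2 modulus of continuity under the translation z. Energies for different kernels
    are compared through it, each being an integral of [om] against its kernel. *)
Definition om u (z : V) : \bar R := (\int[mu]_x ((u (x + z)%R - u x) ^+ 2)%:E)%E.

Section fixed_function.
Variables (u : V -> R) (mu_ : measurable_fun setT u).

Let msq (z : V) : measurable_fun setT (fun x : V => ((u (x + z) - u x) ^+ 2)%:E).
Proof.
apply: measurable_sq; apply: measurable_funB => //.
exact: (measurableT_comp mu_ (measurable_shiftrV z)).
Qed.

Let msq2 : measurable_fun setT (fun p : V * V => ((u (p.2 + p.1) - u p.2) ^+ 2)%:E).
Proof.
apply: measurable_sq; apply: measurable_funB.
  apply: (measurableT_comp mu_); under eq_fun do rewrite addrC; exact: measurable_addrV.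
exact: (measurableT_comp mu_ measurable_snd).
Qed.

Lemma om_ge0 z : (0 <= om u z)%E.
Proof. by apply: integral_ge0 => x _; rewrite lee_fin sqr_ge0. Qed.

Lemma measurable_om : measurable_fun setT (om u).
Proof.
have := @measurable_fun_fubini_tonelli_F _ _ _ _ R mu
  (fun p : V * V => ((u (p.2 + p.1) - u p.2) ^+ 2)%:E) msq2.
by apply => x; rewrite lee_fin sqr_ge0.
Qed.

Lemma omN z : om u (- z) = om u z.
Proof.
rewrite /om -(@ge0_integral_shift _ _ z (fun x : V => ((u (x - z) - u x) ^+ 2)%:E)).
- by apply: eq_integral => x _; rewrite addrK -sqrrN opprB.
- by have := msq (- z).
- by move=> x; rewrite lee_fin sqr_ge0.
Qed.

Lemma omD z z' : (om u (z + z') <= 2%:E * om u z + 2%:E * om u z')%E.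
Proof.
rewrite /om -(@ge0_integral_shift _ _ z' (fun x : V => ((u (x + z) - u x) ^+ 2)%:E)) //; last first.
  by move=> x; rewrite lee_fin sqr_ge0.
have m1 : measurable_fun setT (fun x : V => ((u (x + z' + z) - u (x + z')) ^+ 2)%:E).
  exact: (measurableT_comp (msq z) (measurable_shiftrV z')).
rewrite -!ge0_integralZl//; try by move=> x _; rewrite lee_fin sqr_ge0.
rewrite -ge0_integralD//.
- apply: ge0_le_integral => //.
  + by move=> x _; rewrite lee_fin sqr_ge0.
  + by apply: emeasurable_funD; apply: measurable_funeM.
  + move=> x _; rewrite -!EFinM -EFinD lee_fin.
    rewrite (_ : x + (z + z') = x + z' + z); last by rewrite -addrA (addrC z').
    have := sqr_ge0 ((u (x + z' + z) - u (x + z')) - (u (x + z') - u x)).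
    by rewrite !expr2; nra.
- by move=> x _; rewrite -EFinM lee_fin mulr_ge0// sqr_ge0.
- exact: measurable_funeM.
- by move=> x _; rewrite -EFinM lee_fin mulr_ge0// sqr_ge0.
- exact: measurable_funeM.
Qed.

Lemma omB z z' : (om u (z - z') <= 2%:E * om u z + 2%:E * om u z')%E.
Proof. by rewrite -(omN z'); exact: omD. Qed.

Lemma om_le z : (om u z <= 4%:E * \int[mu]_x ((u x) ^+ 2)%:E)%E.
Proof.
have mu2 := measurable_sq mu_.
rewrite (_ : 4%:E = 2%:E + 2%:E)%E; last by rewrite -EFinD; congr EFin; ring.
rewrite ge0_muleDl ?lee_fin//.
rewrite -{1}(@ge0_integral_shift _ _ z (fun x => ((u x) ^+ 2)%:E)) //; last first.
  by move=> x; rewrite lee_fin sqr_ge0.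
have m1 : measurable_fun setT (fun x : V => ((u (x + z)) ^+ 2)%:E).
  exact: (measurableT_comp mu2 (measurable_shiftrV z)).
rewrite -!ge0_integralZl//; try by move=> x _; rewrite lee_fin sqr_ge0.
rewrite -ge0_integralD//.
- apply: ge0_le_integral => //.
  + by move=> x _; rewrite lee_fin sqr_ge0.
  + by apply: emeasurable_funD; apply: measurable_funeM.
  + move=> x _; rewrite -!EFinM -EFinD lee_fin.
    have := sqr_ge0 (u (x + z) + u x).
    by rewrite !expr2; nra.
- by move=> x _; rewrite -EFinM lee_fin mulr_ge0// sqr_ge0.
- exact: measurable_funeM.
- by move=> x _; rewrite -EFinM lee_fin mulr_ge0// sqr_ge0.
- exact: measurable_funeM.
Qed.

Variables (k : V -> R) (mk : measurable_fun setT k) (k0 : forall z, 0 <= k z).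

(** The square root of the kernel is absorbed into the difference, so that the energy becomes an
    ordinary L^2 inner product on the product space. *)
Definition dif (p : V * V) : R := (u p.1 - u p.2) * Num.sqrt (k (p.1 - p.2)).

Lemma measurable_dif : measurable_fun setT dif.
Proof.
apply: measurable_funM.
  apply: measurable_funB; first exact: (measurableT_comp mu_ measurable_fst).
  exact: (measurableT_comp mu_ measurable_snd).
apply: (@measurableT_comp _ _ _ _ _ _ (@Num.sqrt R)).
  by apply: continuous_measurable_fun; exact: sqrt_continuous.
exact: (measurableT_comp mk measurable_subrV).
Qed.

Lemma dif_sq p : dif p ^+ 2 = (u p.1 - u p.2) ^+ 2 * k (p.1 - p.2).
Proof. by rewrite /dif exprMn sqr_sqrtr. Qed.

(** Tonelli, with the substitution x = y + z for fixed y. *)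
Lemma energy_om : (\int[mu \x mu]_p ((dif p) ^+ 2)%:E = \int[mu]_z ((k z)%:E * om u z))%E.
Proof.
have mF : measurable_fun setT (fun p : V * V => (((dif p) ^+ 2)%:E : \bar R)).
  by apply: measurable_sq; exact: measurable_dif.
rewrite fubini_tonelli2//; last by move=> p; rewrite lee_fin sqr_ge0.
pose G (p : V * V) : \bar R := ((u (p.2 + p.1) - u p.2) ^+ 2 * k p.1)%:E.
have G0 p : (0 <= G p)%E by rewrite lee_fin mulr_ge0 ?sqr_ge0.
have mG : measurable_fun setT G.
  apply/measurable_EFinP; apply: measurable_funM; first by have /measurable_EFinP := msq2.
  exact: (measurableT_comp mk measurable_fst).
transitivity (\int[mu]_y \int[mu]_z G (z, y))%E.
  apply: eq_integral => y _; rewrite /fubini_G.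
  rewrite -(@ge0_integral_shift _ _ y (fun x => ((dif (x, y)) ^+ 2)%:E)).
  - by apply: eq_integral => z _; rewrite dif_sq /G /= addrK (addrC z y).
  - exact: (measurableT_comp mF (pair2_measurable y)).
  - by move=> x; rewrite lee_fin sqr_ge0.
rewrite -(fubini_tonelli G mG G0); apply: eq_integral => z _.
rewrite /G /om -ge0_integralZl//.
- by apply: eq_integral => x _; rewrite /= mulrC EFinM.
- by move=> x _; rewrite lee_fin sqr_ge0.
- by rewrite lee_fin.
Qed.

End fixed_function.
End translation_modulus.

Lemma ge0_integral_scale d (T : measurableType d) (R : realType)
    (m : {measure set T -> \bar R}) (D : set T) (f : T -> \bar R) (c : \bar R) :
  measurable D -> measurable_fun setT f -> (forall x, 0 <= f x)%E -> (0 <= c)%E ->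
  (\int[m]_(x in D) (c * f x) = c * \int[m]_(x in D) f x)%E.
Proof.
move=> mD mf f0 c0; apply: ge0_integralZl => //; exact: measurable_funTS.
Qed.

Section geometric.
Context {R : realType}.

Lemma geometric_lty (c r : R) : 0 <= r < 1 -> (\sum_(j <oo) (c * r ^+ j)%:E < +oo)%E.
Proof.
move=> /andP[r0 r1]; have h : `|r| < 1 by rewrite ger0_norm.
rewrite (_ : (\sum_(j <oo) (c * r ^+ j)%:E)%E = (c * (1 - r)^-1)%:E) ?ltry//.
have H := cvg_geometric_series (a := c) h.
apply/cvg_lim => //; apply: cvg_EFin.
  by apply: nearW => k /=; rewrite sumEFin.
apply: cvg_trans H; apply: near_eq_cvg; apply: nearW => k.
by rewrite /series/= /geometric/= sumEFin.
Qed.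

Lemma powR_expr (x e : R) j : 0 <= x -> (x ^+ j) `^ e = (x `^ e) ^+ j.
Proof.
move=> x0; rewrite -powR_mulrn// -powRrM mulrC powRrM powR_mulrn//; exact: powR_ge0.
Qed.

Lemma expr4_ge (x : R) : exists j, x < 4 ^+ j.
Proof.
exists (Num.truncn `|x|).+1; rewrite (le_lt_trans (ler_norm x))//.
rewrite (lt_le_trans (truncnS_gt _))//.
by rewrite -natrX ler_nat ltnW// ltn_expl.
Qed.

Lemma expr4_bracket (x : R) : 1 < x -> exists j, 4 ^+ j < x <= 4 ^+ j.+1.
Proof.
move=> x1; have ex : exists j, x <= 4 ^+ j by have [j /ltW] := expr4_ge x; exists j.
case: (ex_minnP ex) => -[|j]; first by rewrite expr0 leNgt x1.
move=> xj jmin; exists j; rewrite xj andbT ltNge; apply/negP => /jmin.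
by rewrite ltnn.
Qed.

Lemma expr4_bracket1 (x : R) : 0 < x <= 1 -> exists j, 4^-1 ^+ j.+1 < x <= 4^-1 ^+ j.
Proof.
move=> /andP[x0 x1].
have ex : exists j, x^-1 < 4 ^+ j by exact: expr4_ge.
case: (ex_minnP ex) => -[|j]; first by rewrite expr0 invf_lt1// ltNge x1.
move=> xj jmin; exists j.
rewrite !exprVn invf_plt ?posrE ?exprn_gt0// xj /=.
rewrite -[x]invrK lef_pV2 ?posrE ?exprn_gt0 ?invr_gt0// leNgt; apply/negP => /jmin.
by rewrite ltnn.
Qed.
End geometric.

(** * The Euclidean norm and the integrability of the jump kernel *)

Section euclidean_norm.
Context {R : realType} {n : nat}.
Implicit Types x : 'rV[R]_n.

Lemma enorm_ge0 x : 0 <= enorm x. Proof. exact: sqrtr_ge0. Qed.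

Lemma enormZ (t : R) x : enorm (t *: x) = `|t| * enorm x.
Proof.
rewrite /enorm -sqrtr_sqr -sqrtrM ?sqr_ge0//; congr Num.sqrt.
by rewrite /dotp mulr_sumr; apply: eq_bigr => i _; rewrite !mxE; ring.
Qed.

Lemma enormN x : enorm (- x) = enorm x.
Proof. by rewrite -scaleN1r enormZ normrN1 mul1r. Qed.

Lemma le_norm_enorm x : `|x| <= enorm x.
Proof.
apply/rV_norm_leP => [|i]; first exact: enorm_ge0.
rewrite -sqrtr_sqr; apply: ler_wsqrtr; rewrite /dotp (bigD1 i)//= -expr2 lerDl.
by apply: sumr_ge0 => j _; rewrite -expr2 sqr_ge0.
Qed.

Lemma le_enorm_norm x : enorm x <= Num.sqrt n%:R * `|x|.
Proof.
rewrite -[X in _ * X]ger0_norm// -sqrtr_sqr -sqrtrM//; apply: ler_wsqrtr.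
rewrite /dotp mulr_natl -[n in _ *+ n]card_ord -sumr_const; apply: ler_sum => i _.
by rewrite -expr2 -real_normK ?num_real// ler_pXn2r ?nnegrE// rV_coord_le.
Qed.

Lemma enorm_eq0 x : (enorm x == 0) = (x == 0).
Proof.
apply/eqP/eqP => [x0|->].
  by apply/eqP; rewrite -normr_le0 -x0 le_norm_enorm.
by rewrite -(scale0r (0 : 'rV[R]_n)) enormZ normr0 mul0r.
Qed.

Lemma enorm_gt0 x : (0 < enorm x) = (x != 0).
Proof. by rewrite lt_neqAle eq_sym enorm_eq0 enorm_ge0 andbT. Qed.

Lemma unit_dirZ (t : R) x : 0 < t -> unit_dir (t *: x) = unit_dir x.
Proof.
move=> t0; rewrite /unit_dir enormZ gtr0_norm// invfM scalerA mulrAC mulVf ?mul1r//.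
by rewrite gt_eqF.
Qed.

Lemma unit_dirN x : unit_dir (- x) = - unit_dir x.
Proof. by rewrite /unit_dir enormN scalerN. Qed.

Lemma sphere_unit_dir x : x != 0 -> sphere (unit_dir x).
Proof.
move=> x0; rewrite /sphere/= /unit_dir enormZ ger0_norm ?invr_ge0 ?enorm_ge0//.
by rewrite mulVf// enorm_eq0.
Qed.

Lemma measurable_sphere : measurable (@sphere R n).
Proof.
rewrite (_ : sphere = enorm @^-1` [set (1 : R)]); last by [].
rewrite -[X in measurable X]setTI; exact: measurable_enorm.
Qed.

End euclidean_norm.

Section jump_kernel_theory.
Context {R : realType} {n : nat} (s : R) (n_gt0 : (0 < n)%N) (s_gt0 : 0 < s) (s_lt1 : s < 1).
Local Notation mu := (@lebesgue_rV R n).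
Local Notation sigma := (@sphere_measure R n).
Local Notation V := 'rV[R]_n.
Variables (a : V -> R) (ia : sigma.-integrable sphere (EFin \o a)).
Hypothesis aA2 : condA2 a.
Local Notation k := (jump_kernel s a).
Local Notation p := (n%:R + 2 * s).

Let p0 : 0 < p. Proof. by rewrite ltr_wpDl// mulr_gt0. Qed.

(** A consequence of the conventions that 0 to a positive power is 0 and that the inverse of 0 is 0.
    It lets positivity and evenness of the kernel hold at the origin too. *)
Lemma jump_kernel0 : k 0 = 0.
Proof.
have e0 : enorm (0 : V) = 0 by apply/eqP; rewrite enorm_eq0.
by rewrite /jump_kernel e0 powR0 ?gt_eqF// invr0 mulr0.
Qed.

Lemma jump_kernel_ge0 x : 0 <= k x.
Proof.
have [->|x0] := eqVneq x 0; first by rewrite jump_kernel0.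
by rewrite mulr_ge0 ?invr_ge0 ?powR_ge0//; have [] := aA2 (sphere_unit_dir x0).
Qed.

Lemma jump_kernelN x : k (- x) = k x.
Proof.
have [->|x0] := eqVneq x 0; first by rewrite oppr0.
rewrite /jump_kernel unit_dirN enormN.
by have [<-] := aA2 (sphere_unit_dir x0).
Qed.

Lemma jump_kernelZ t x : 0 < t -> k (t *: x) = t `^ (- p) * k x.
Proof.
move=> t0; rewrite /jump_kernel unit_dirZ// enormZ gtr0_norm// powRM ?enorm_ge0 ?(ltW t0)//.
by rewrite invfM powRN mulrCA.
Qed.

(** The hypotheses only make a measurable on the sphere. Cutting it off there does not change the
    kernel and yields a function measurable everywhere. *)
Lemma jump_kernelE : k = (fun x => (a \_ sphere) (unit_dir x) / enorm x `^ p).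
Proof.
apply/funext => x; have [->|x0] := eqVneq x 0.
  have e0 : enorm (0 : V) = 0 by apply/eqP; rewrite enorm_eq0.
  by rewrite jump_kernel0 e0 powR0 ?gt_eqF// invr0 mulr0.
by rewrite /jump_kernel patchE mem_set//; exact: sphere_unit_dir.
Qed.

Lemma measurable_jump_dir : measurable_fun setT (fun x : V => (a \_ sphere) (unit_dir x)).
Proof.
have H : measurable_fun setT (a \_ sphere).
  apply: (measurable_restrictT a measurable_sphere).1.
  have /integrableP[mf _] := ia; exact/measurable_EFinP.
exact: (measurableT_comp H measurable_unit_dir).
Qed.

Lemma measurable_jump_kernel : measurable_fun setT k.
Proof.
rewrite jump_kernelE; apply: measurable_funM; first exact: measurable_jump_dir.
under eq_fun do rewrite -powRN.
exact: (measurableT_comp (measurable_powR (- p)) measurable_enorm).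
Qed.

(** Shells of ratio 4. By homogeneity the mass of the kernel on [shell t] is t^(-2s) times its mass
    on [shell 1], which turns integrals near and far from the origin into geometric series. *)
Definition shell (t : R) : set V := [set x | t / 4 < enorm x <= t].

Lemma measurable_shell t : measurable (shell t).
Proof.
rewrite (_ : shell t = enorm @^-1` `]t / 4, t]%classic); last first.
  by apply/seteqP; split => x /=; rewrite in_itv.
by rewrite -[X in measurable X]setTI; exact: measurable_enorm.
Qed.

Let g x := (a \_ sphere) (unit_dir x).

Let g0 x : 0 <= g x.
Proof. by rewrite /g patchE; case: ifPn => // /set_mem /aA2[]. Qed.

(** Surface measure is n times the push-forward of Lebesgue measure on the punctured ball under x ->
    x/|x|. Integrability of a on the sphere therefore amounts to integrability of a(x/|x|) on the
    ball, since n > 0. *)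
Lemma jump_dir_lty : (\int[mu]_(x in punctured_ball) (g x)%:E < +oo)%E.
Proof.
have mpb := @measurable_punctured_ball R n.
have mg : measurable_fun setT (fun x => (g x)%:E).
  by apply/measurable_EFinP; exact: measurable_jump_dir.
have mas : measurable_fun setT (fun x => ((a \_ sphere) x)%:E).
  apply/measurable_EFinP; apply: (measurable_restrictT a measurable_sphere).1.
  have /integrableP[mf _] := ia; exact/measurable_EFinP.
have as0 x : (0 <= ((a \_ sphere) x)%:E)%E.
  by rewrite lee_fin patchE; case: ifPn => // /set_mem /aA2[].
pose m1 : {measure set V -> \bar R} := mrestr mu mpb.
apply: (@le_lt_trans _ _ (\int[m1]_x (g x)%:E)%E).
  rewrite (@eq_measure_integral _ _ _ _ m1) => [|A mA AD]; last first.
    by rewrite /m1/= /mrestr setIidl.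
  by apply: ge0_subset_integral => // x _; rewrite lee_fin.
pose m2 : {measure set V -> \bar R} :=
  measure_function_pushforward__canonical__measure_function_Measure m1 measurable_unit_dir.
have E1 : (\int[m1]_x (g x)%:E = \int[m2]_x ((a \_ sphere) x)%:E)%E.
  have := @ge0_integral_pushforward _ _ _ _ R _ measurable_unit_dir m1 setT
    (fun x => ((a \_ sphere) x)%:E) measurableT mas.
  by rewrite preimage_setT => <-.
have E2 : (\int[sigma]_x ((a \_ sphere) x)%:E =
    n%:R%:E * \int[m2]_x ((a \_ sphere) x)%:E)%E.
  exact: (@ge0_integral_mscale _ _ _ m2 setT measurableT (n%:R%:nng) _ mas (fun x _ => as0 x)).
have : (\int[sigma]_x ((a \_ sphere) x)%:E < +oo)%E.
  have /integrableP[_] := ia; apply: le_lt_trans.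
  rewrite [leRHS]integral_mkcond; apply: ge0_le_integral => //.
  - apply: (measurable_restrictT (fun x => `|(EFin \o a) x|)%E measurable_sphere).1.
    by apply: measurableT_comp => //; have /integrableP[] := ia.
  - move=> x _; rewrite !patchE; case: ifPn => //= xs.
    by rewrite lee_fin ler_norm.
rewrite E2 E1; move: (\int[m2]_x ((a \_ sphere) x)%:E)%E => [r| |].
- by move=> _; exact: ltry.
- by rewrite mulry gtr0_sg ?mul1e// ltr0n.
- by [].
Qed.

Lemma jump_kernel_le x t : 0 < t -> shell t x -> k x <= (t / 4) `^ (- p) * g x.
Proof.
move=> t0 /andP[tx xt]; rewrite jump_kernelE powRN [leRHS]mulrC.
apply: ler_wpM2l; first exact: g0.
rewrite lef_pV2 ?posrE ?powR_gt0 ?divr_gt0//; last first.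
  by rewrite (lt_trans _ tx)// divr_gt0.
by rewrite ge0_ler_powR ?nnegrE ?(ltW p0) ?enorm_ge0 ?divr_ge0 ?(ltW t0)// ltW.
Qed.

Definition shell_mass := (\int[mu]_(x in shell 1) (k x)%:E)%E.

Let mkE : measurable_fun setT (fun x => (k x)%:E).
Proof. by apply/measurable_EFinP; exact: measurable_jump_kernel. Qed.

Lemma shell_mass_lty : (shell_mass < +oo)%E.
Proof.
have mg : measurable_fun setT (fun x => (g x)%:E).
  by apply/measurable_EFinP; exact: measurable_jump_dir.
apply: (@le_lt_trans _ _ (\int[mu]_(x in punctured_ball) (((1 / 4) `^ (- p))%:E * (g x)%:E))%E).
  apply: (@le_trans _ _ (\int[mu]_(x in shell 1) (((1 / 4) `^ (- p))%:E * (g x)%:E))%E).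
    apply: ge0_le_integral => //.
    - exact: measurable_shell.
    - by move=> x _; rewrite lee_fin jump_kernel_ge0.
    - exact: measurable_funTS.
    - by apply: measurable_funTS; exact: measurable_funeM.
    - by move=> x xs; rewrite -EFinM lee_fin jump_kernel_le.
  apply: ge0_subset_integral => //.
  - exact: measurable_shell.
  - exact: measurable_punctured_ball.
  - by apply: measurable_funTS; exact: measurable_funeM.
  - by move=> x _; rewrite -EFinM lee_fin mulr_ge0// powR_ge0.
  - by move=> x /andP[x1 x2]; rewrite /punctured_ball/= x2 andbT (lt_trans _ x1)// divr_gt0.
rewrite ge0_integralZl//.
- by rewrite lte_mul_pinfty ?jump_dir_lty// lee_fin powR_ge0.
- exact: measurable_punctured_ball.
- exact: measurable_funTS.
- by move=> x _; rewrite lee_fin.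
Qed.

Lemma shell_mass_ge0 : (0 <= shell_mass)%E.
Proof. by apply: integral_ge0 => x _; rewrite lee_fin jump_kernel_ge0. Qed.

Lemma integral_shell t : 0 < t ->
  (\int[mu]_(x in shell t) (k x)%:E = (t `^ (- (2 * s)))%:E * shell_mass)%E.
Proof.
move=> t0; have tn0 : t != 0 by rewrite gt_eqF.
have mS u : measurable_fun setT ((fun x => (k x)%:E) \_ (shell u)).
  by apply: (measurable_restrictT _ (measurable_shell u)).1; exact: measurable_funTS.
have S0 u x : (0 <= ((fun x => (k x)%:E) \_ (shell u)) x)%E.
  by rewrite patchE; case: ifP => // _; rewrite lee_fin jump_kernel_ge0.
rewrite /shell_mass !(integral_mkcond (shell _)).
have := @ge0_integral_affm R n t 0 _ tn0 (mS t) (S0 t).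
rewrite gtr0_norm// => /(congr1 (fun e => (t ^+ n)%:E * e)%E).
rewrite muleA -EFinM mulfV ?expf_neq0// mul1e => <-.
have m1 : measurable_fun setT
    (fun x => ((fun x => (k x)%:E) \_ (shell t)) (affm t 0 x)).
  exact: (measurableT_comp (mS t) (measurable_affm t 0)).
have tn : (0 <= (t ^+ n)%:E)%E by rewrite lee_fin exprn_ge0// ltW.
have tp : (0 <= (t `^ (- (2 * s)))%:E)%E by rewrite lee_fin powR_ge0.
rewrite -(ge0_integralZl mu measurableT m1 (fun x _ => S0 t _) tn).
rewrite -(ge0_integralZl mu measurableT (mS 1) (fun x _ => S0 1 _) tp).
apply: eq_integral => x _; rewrite /affm addr0 !patchE.
have -> : (t *: x \in shell t) = (x \in shell 1).
  have E : (t / 4 < t * enorm x <= t) = (1 / 4 < enorm x <= 1).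
    rewrite (_ : t / 4 = t * (1 / 4)); last by rewrite mul1r.
    by rewrite ltr_pM2l// ger_pMr.
  by apply/idP/idP => /set_mem xs; apply/mem_set; move: xs;
    rewrite /shell/= enormZ gtr0_norm// E.
case: ifP => _; last by rewrite !mule0.
rewrite jump_kernelZ// -!EFinM mulrA; congr (_ * _)%:E.
rewrite -powR_mulrn ?ltW// -powRD ?(negbTE tn0) ?implybT//; congr powR; ring.
Qed.

Lemma integral_shells (f : V -> \bar R) : measurable_fun setT f -> (forall x, 0 <= f x)%E ->
  (\int[mu]_(x in [set x : V | (0 < enorm x <= 1)%R]) f x <=
   \sum_(j <oo) \int[mu]_(x in shell (4^-1 ^+ j)) f x)%E.
Proof.
move=> mf f0.
under eq_eseriesr do rewrite integral_mkcond.
rewrite -integral_nneseries//; last 2 first.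
- by move=> j; apply: (measurable_restrictT _ (measurable_shell _)).1; exact: measurable_funTS.
- by move=> j x _; rewrite patchE; case: ifP.
rewrite [leLHS]integral_mkcond; apply: ge0_le_integral => //.
- by move=> x _; rewrite patchE; case: ifP.
- apply: (measurable_restrictT _ (@measurable_punctured_ball R n)).1; exact: measurable_funTS.
- apply: ge0_emeasurable_sum => [j x _ _|j _]; first by rewrite patchE; case: ifP.
  by apply: (measurable_restrictT _ (measurable_shell _)).1; exact: measurable_funTS.
move=> x _; rewrite patchE; case: ifPn => [/set_mem/= x1|_]; last first.
  by apply: nneseries_ge0 => j _ _; rewrite patchE; case: ifP.
have [j /andP[xj jx]] := expr4_bracket1 x1.
apply: le_trans (nneseries_lim_ge j.+1 _); last by move=> i _ _; rewrite patchE; case: ifP.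
rewrite big_mkord big_ord_recr/= [X in (_ + X)%E]patchE mem_set; last first.
  by rewrite /shell/= jx andbT -exprSr.
by rewrite leeDr// sume_ge0// => i _; rewrite patchE; case: ifP.
Qed.

Lemma integral_far_shells (f : V -> \bar R) : measurable_fun setT f -> (forall x, 0 <= f x)%E ->
  (\int[mu]_(x in [set x : V | (1 < enorm x)%R]) f x <=
   \sum_(j <oo) \int[mu]_(x in shell (4 ^+ j.+1)) f x)%E.
Proof.
move=> mf f0.
have mD : measurable [set x : V | (1 < enorm x)%R].
  rewrite (_ : mkset _ = enorm @^-1` `]1, +oo[%classic); last first.
    by apply/seteqP; split => x /=; rewrite in_itv/= andbT.
  by rewrite -[X in measurable X]setTI; exact: measurable_enorm.
under eq_eseriesr do rewrite integral_mkcond.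
rewrite -integral_nneseries//; last 2 first.
- by move=> j; apply: (measurable_restrictT _ (measurable_shell _)).1; exact: measurable_funTS.
- by move=> j x _; rewrite patchE; case: ifP.
rewrite [leLHS]integral_mkcond; apply: ge0_le_integral => //.
- by move=> x _; rewrite patchE; case: ifP.
- apply: (measurable_restrictT _ mD).1; exact: measurable_funTS.
- apply: ge0_emeasurable_sum => [j x _ _|j _]; first by rewrite patchE; case: ifP.
  by apply: (measurable_restrictT _ (measurable_shell _)).1; exact: measurable_funTS.
move=> x _; rewrite patchE; case: ifPn => [/set_mem/= x1|_]; last first.
  by apply: nneseries_ge0 => j _ _; rewrite patchE; case: ifP.
have [j /andP[xj jx]] := expr4_bracket x1.
apply: le_trans (nneseries_lim_ge j.+1 _); last by move=> i _ _; rewrite patchE; case: ifP.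
rewrite big_mkord big_ord_recr/= [X in (_ + X)%E]patchE mem_set; last first.
  by rewrite /shell/= jx andbT exprSr mulfK.
by rewrite leeDr// sume_ge0// => i _; rewrite patchE; case: ifP.
Qed.

(** A geometric series of ratio 4^(-2s), less than 1 because s > 0. *)
Lemma jump_kernel_far_lty : (\int[mu]_(x in [set x : V | (1 < enorm x)%R]) (k x)%:E < +oo)%E.
Proof.
apply: (le_lt_trans (integral_far_shells mkE _)); first by move=> x; rewrite lee_fin jump_kernel_ge0.
pose K := fine shell_mass.
have KE : shell_mass = K%:E by rewrite fineK// ge0_fin_numE ?shell_mass_lty// shell_mass_ge0.
apply: (@le_lt_trans _ _ (\sum_(j <oo) ((4 `^ (- (2 * s)) * K) * (4 `^ (- (2 * s))) ^+ j)%:E)%E).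
  apply: lee_nneseries => [j _ _|j _]; first by apply: integral_ge0 => x _; rewrite lee_fin jump_kernel_ge0.
  rewrite integral_shell ?exprn_gt0// KE -EFinM lee_fin.
  rewrite -powR_mulrn// -powRrM mulrC [_ * - _]mulrC powRrM powR_mulrn ?powR_ge0// exprS.
  by rewrite mulrA (mulrC K) -mulrA (mulrC K) mulrA mulrAC.
apply: geometric_lty; rewrite powR_ge0/=.
rewrite powRN invf_lt1 ?powR_gt0//.
have s2 : 0 < 2 * s by rewrite mulr_gt0.
have := @gt0_ltr_powR R (2 * s) s2 1 4; rewrite powR1; apply; rewrite ?nnegrE//.
by rewrite ltr1n.
Qed.

(** The factor |x|^2 turns the masses of the shells of radius 4^-j into a series of ratio 4^(2s-2),
    less than 1 because s < 1. *)
Lemma jump_kernel_near_lty :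
  (\int[mu]_(x in [set x : V | (0 < enorm x <= 1)%R]) ((enorm x) ^+ 2 * k x)%:E < +oo)%E.
Proof.
have mf : measurable_fun setT (fun x => ((enorm x) ^+ 2 * k x)%:E).
  apply/measurable_EFinP; apply: measurable_funM; last exact: measurable_jump_kernel.
  by apply: measurable_funX; exact: measurable_enorm.
have f0 x : (0 <= ((enorm x) ^+ 2 * k x)%:E)%E.
  by rewrite lee_fin mulr_ge0 ?sqr_ge0// jump_kernel_ge0.
apply: (le_lt_trans (integral_shells mf f0)).
pose K := fine shell_mass.
have K0 : 0 <= K by rewrite fine_ge0// shell_mass_ge0.
have KE : shell_mass = K%:E by rewrite fineK// ge0_fin_numE ?shell_mass_lty// shell_mass_ge0.
apply: (@le_lt_trans _ _ (\sum_(j <oo) (K * (4^-1 ^+ 2 * 4^-1 `^ (- (2 * s))) ^+ j)%:E)%E).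
  apply: lee_nneseries => [j _ _|j _]; first exact: integral_ge0.
  have t0 : 0 < 4^-1 ^+ j :> R by rewrite exprn_gt0.
  apply: (@le_trans _ _ (\int[mu]_(x in shell (4^-1 ^+ j)) (((4^-1 ^+ j) ^+ 2)%:E * (k x)%:E))%E).
    apply: ge0_le_integral => //.
    - exact: measurable_shell.
    - exact: measurable_funTS.
    - by apply: measurable_funTS; exact: measurable_funeM.
    - move=> x /andP[_ xt]; rewrite -EFinM lee_fin ler_wpM2r ?jump_kernel_ge0//.
      by rewrite ler_pXn2r ?nnegrE ?enorm_ge0// ltW.
  rewrite (ge0_integral_scale _ (measurable_shell _) mkE); last 2 first.
  - by move=> x; rewrite lee_fin jump_kernel_ge0.
  - by rewrite lee_fin sqr_ge0.
  rewrite integral_shell// KE -!EFinM lee_fin.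
  rewrite powR_expr// exprMn (exprAC _ j 2) le_eqVlt; apply/orP; left; apply/eqP; ring.
apply: geometric_lty; rewrite mulr_ge0 ?powR_ge0 ?sqr_ge0//=.
rewrite -powR_mulrn ?invr_ge0// -powRD; last by rewrite invr_eq0 pnatr_eq0 implybT.
have s2 : 0 < 2 - 2 * s by rewrite subr_gt0 gtr_pMr.
have := @gt0_ltr_powR R (2 - 2 * s) s2 4^-1 1; rewrite powR1; apply; rewrite ?nnegrE//.
by rewrite invf_lt1// ltr1n.
Qed.

End jump_kernel_theory.

(** * Control of the energy by the Gagliardo seminorm *)

Section energy_gagliardo.
Context {R : realType} {n : nat} (s : R) (n_gt0 : (0 < n)%N) (s_gt0 : 0 < s) (s_lt1 : s < 1).
Local Notation mu := (@lebesgue_rV R n).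
Local Notation sigma := (@sphere_measure R n).
Local Notation V := 'rV[R]_n.
Local Notation p := (n%:R + 2 * s).
Implicit Types u : V -> R.

Let p0 : 0 < p. Proof. by rewrite ltr_wpDl// mulr_gt0. Qed.

(** The constant 1 satisfies the hypotheses made on a, so the Gagliardo seminorm is itself an energy
    and inherits the theory above. *)
Lemma sphere_integrable_cst1 : sigma.-integrable sphere (EFin \o (fun=> 1)).
Proof.
apply/integrableP; split; first exact: measurable_cst.
under eq_integral do rewrite /= normr1.
rewrite integral_cst; last exact: measurable_sphere.
rewrite mul1e /sphere_measure lte_mul_pinfty// ?lee_fin//.
apply: (@bounded_rV_lty _ _ _ 1).
  apply: measurableI; last exact: measurable_punctured_ball.
  by rewrite -[X in measurable X]setTI; apply: measurable_unit_dir => //; exact: measurable_sphere.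
by move=> x [_ /andP[_]]; apply: le_trans; exact: le_norm_enorm.
Qed.

Lemma condA2_cst1 : @condA2 R n (fun=> 1). Proof. by move=> th _. Qed.

Definition gag_kernel : V -> R := jump_kernel s (fun=> 1).

Lemma gag_kernel_ge0 x : 0 <= gag_kernel x.
Proof. exact: (jump_kernel_ge0 s_gt0 condA2_cst1 x). Qed.

Lemma measurable_gag_kernel : measurable_fun setT gag_kernel.
Proof. exact: (measurable_jump_kernel s_gt0 sphere_integrable_cst1). Qed.

Lemma gagliardoE u : measurable_fun setT u ->
  gagliardo_sq s u = (\int[mu]_z ((gag_kernel z)%:E * om u z))%E.
Proof.
move=> mu_.
have mF := measurable_sq (measurable_dif mu_ measurable_gag_kernel).
rewrite -(energy_om mu_ measurable_gag_kernel gag_kernel_ge0).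
rewrite (fubini_tonelli1 _ mF (fun q => sqr_ge0 (dif u gag_kernel q))).
apply: eq_integral => x _; apply: eq_integral => y _.
by rewrite (dif_sq _ gag_kernel_ge0)/= /gag_kernel /jump_kernel mul1r.
Qed.

(** The ratio 4 leaves room for both y and z - y when |z| <= t and all coordinates of y are between
    2t and 3t, and still makes the shells of radii 4^-j disjoint. *)
Definition sup_shell (t : R) : set V := [set y | t < `|y| <= 4 * t].

Lemma measurable_rVnorm : measurable_fun setT (fun y : V => `|y|).
Proof. by apply: rV_continuous_measurable => x; exact: norm_continuous. Qed.

Lemma measurable_sup_shell t : measurable (sup_shell t).
Proof.
rewrite (_ : sup_shell t = (fun y : V => `|y|) @^-1` `]t, 4 * t]%classic); last first.
  by apply/seteqP; split => x /=; rewrite in_itv.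
by rewrite -[X in measurable X]setTI; exact: measurable_rVnorm.
Qed.

Lemma obox_sup_shell t (y z : V) : 0 < t -> (forall i, `|z ord0 i| <= t) ->
  obox (const_mx (2 * t)) (const_mx (3 * t)) y -> sup_shell t (z - y).
Proof.
move=> t0 zt yb; rewrite /sup_shell/=; apply/andP; split.
  have := zt (Ordinal n_gt0); have := yb (Ordinal n_gt0); rewrite !mxE => /andP[y1 y2].
  rewrite ler_norml => /andP[z1 z2].
  have := rV_coord_le (z - y) (Ordinal n_gt0); rewrite !mxE; apply: lt_le_trans.
  by rewrite ltr0_norm ?opprB; lra.
apply/rV_norm_leP => [|i]; first by rewrite mulr_ge0// ltW.
have := zt i; have := yb i; rewrite !mxE => /andP[y1 y2]; rewrite ler_norml => /andP[z1 z2].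
by rewrite ler_norml; apply/andP; split; lra.
Qed.

(* Average om z <= 2 om (z - y) + 2 om y over a box of points y of size t. *)
Lemma om_shell_le u t z : measurable_fun setT u -> 0 < t -> `|z| <= t ->
  ((t ^+ n)%:E * om u z <= 4%:E * \int[mu]_(y in sup_shell t) om u y)%E.
Proof.
move=> mu_ t0 zt.
have zt' i : `|z ord0 i| <= t by rewrite (le_trans (rV_coord_le _ _)).
set A := obox (const_mx (2 * t)) (const_mx (3 * t)) : set V.
have mA : measurable A by exact: measurable_obox.
have om0 y := om_ge0 u y.
have mom := measurable_om mu_.
have muA : mu A = (t ^+ n)%:E.
  rewrite lebesgue_obox prod_EFin; congr EFin.
  transitivity (\prod_(i < n) t); last by rewrite prodr_const card_ord.
  apply: eq_bigr => i _.
  by rewrite !mxE max_l; [ring|rewrite subr_ge0 ler_wpM2r ?ltW// ltr_nat].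
have mS := measurable_sup_shell t.
have mrefl : measurable_fun setT (fun y : V => om u (z - y)).
  apply: (measurableT_comp mom); under eq_fun do rewrite addrC.
  exact: (measurableT_comp (measurable_shiftrV z) measurable_opprV).
have momS : measurable_fun setT (om u \_ (sup_shell t)).
  by apply: (measurable_restrictT _ mS).1; exact: measurable_funTS.
have omS0 y : (0 <= (om u \_ (sup_shell t)) y)%E by rewrite patchE; case: ifP.
have I1 : (\int[mu]_(y in A) om u y <= \int[mu]_(y in sup_shell t) om u y)%E.
  apply: ge0_subset_integral => //; first exact: measurable_funTS.
  move=> y Ay; have := obox_sup_shell (z := 0) t0 _ Ay; rewrite sub0r /sup_shell/= normrN.
  by apply => i; rewrite mxE normr0 ltW.
have I2 : (\int[mu]_(y in A) om u (z - y)%R <= \int[mu]_(y in sup_shell t) om u y)%E.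
  rewrite [leRHS]integral_mkcond -(@ge0_integral_reflect _ _ z)// integral_mkcond.
  apply: ge0_le_integral => //.
  - by move=> y _; rewrite patchE; case: ifP.
  - by apply: (measurable_restrictT _ mA).1; exact: measurable_funTS.
  - apply: (measurableT_comp momS); under eq_fun do rewrite addrC.
    exact: (measurableT_comp (measurable_shiftrV z) measurable_opprV).
  - move=> y _; rewrite !patchE; case: ifPn => [/set_mem Ay|_]; last by case: ifP.
    by rewrite mem_set//; exact: obox_sup_shell.
have E : (\int[mu]_(y in A) om u z = (t ^+ n)%:E * om u z)%E.
  by rewrite (integral_cst mu mA) -muA muleC.
rewrite -E.
apply: (@le_trans _ _ (\int[mu]_(y in A) (2%:E * om u (z - y)%R + 2%:E * om u y))%E).
  apply: ge0_le_integral => //.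
  - by apply: measurable_funTS; apply: emeasurable_funD; exact: measurable_funeM.
  - by move=> y _; rewrite -{1}(subrK y z); exact: omD.
rewrite ge0_integralD//; last 4 first.
- by move=> y _; rewrite mule_ge0.
- by apply: measurable_funTS; exact: measurable_funeM.
- by move=> y _; rewrite mule_ge0.
- by apply: measurable_funTS; exact: measurable_funeM.
rewrite (ge0_integral_scale _ mA mrefl)// (ge0_integral_scale _ mA mom)//.
rewrite (_ : 4%:E = 2%:E + 2%:E)%E; last by rewrite -EFinD; congr EFin; ring.
rewrite ge0_muleDl ?lee_fin ?ler0n//.
have two0 : (0 <= 2%:E :> \bar R)%E by rewrite lee_fin ler0n.
by apply: leeD; [exact: (lee_wpmul2l two0 I2)|exact: (lee_wpmul2l two0 I1)].
Qed.

Lemma sup_shell_gag t y : 0 < t -> sup_shell t y ->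
  1 <= (4 * t * Num.sqrt n%:R) `^ p * gag_kernel y.
Proof.
move=> t0 /andP[ty yt]; have e0 : 0 < enorm y.
  by rewrite (lt_le_trans _ (le_norm_enorm _))// (lt_trans t0).
rewrite /gag_kernel /jump_kernel mul1r ler_pdivlMr ?powR_gt0// mul1r.
apply: ge0_ler_powR; rewrite ?nnegrE ?enorm_ge0 ?(ltW p0)//.
  by rewrite !mulr_ge0 ?sqrtr_ge0// ltW.
rewrite (le_trans (le_enorm_norm _))// mulrC ler_wpM2r// sqrtr_ge0//.
Qed.

(** On the shell the Gagliardo kernel is at least of order t^-(n+2s). Division by the volume t^n of
    the averaging box leaves t^(2s), exactly what the mass t^(-2s) of the jump kernel on a shell
    cancels. *)
Lemma om_near_le u t z : measurable_fun setT u -> 0 < t -> `|z| <= t ->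
  (om u z <= (4 * (4 * Num.sqrt n%:R) `^ p * t `^ (2 * s))%:E *
     \int[mu]_(y in sup_shell t) ((gag_kernel y)%:E * om u y))%E.
Proof.
move=> mu_ t0 zt.
have tn0 : 0 < t ^+ n by rewrite exprn_gt0.
have mom := measurable_om mu_.
have om0 y := om_ge0 u y.
have mgk : measurable_fun setT (fun y => (gag_kernel y)%:E).
  by apply/measurable_EFinP; exact: measurable_gag_kernel.
have mS := measurable_sup_shell t.
have H1 := om_shell_le mu_ t0 zt.
have H2 : (\int[mu]_(y in sup_shell t) om u y <= ((4 * t * Num.sqrt n%:R) `^ p)%:E *
    \int[mu]_(y in sup_shell t) ((gag_kernel y)%:E * om u y))%E.
  have mg : measurable_fun setT (fun y => (gag_kernel y)%:E * om u y)%E by exact: emeasurable_funM.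
  rewrite -(ge0_integral_scale _ mS mg).
  - apply: ge0_le_integral => //.
    + exact: measurable_funTS.
    + by apply: measurable_funTS; apply: measurable_funeM; exact: emeasurable_funM.
    + move=> y yS; rewrite muleA -EFinM -[leLHS]mul1e lee_wpmul2r// lee_fin.
      exact: sup_shell_gag.
  - by move=> y; rewrite mule_ge0// lee_fin gag_kernel_ge0.
  - by rewrite lee_fin powR_ge0.
rewrite -(@lee_pmul2l _ (t ^+ n)%:E) ?lte_fin//.
apply: (le_trans H1); apply: (le_trans (lee_wpmul2l _ H2)) => //.
rewrite !muleA -!EFinM lee_wpmul2r//.
  by apply: integral_ge0 => y _; rewrite mule_ge0// lee_fin gag_kernel_ge0.
rewrite lee_fin (mulrAC 4) (powRM _ _ (ltW t0)); last by rewrite mulr_ge0// sqrtr_ge0.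
rewrite [t `^ (n%:R + _)]powRD; last by rewrite gt_eqF ?implybT.
rewrite powR_mulrn ?(ltW t0)//.
rewrite le_eqVlt; apply/orP; left; apply/eqP; ring.
Qed.

Variables (a : V -> R) (ia : sigma.-integrable sphere (EFin \o a)).
Hypothesis aA2 : condA2 a.
Local Notation k := (jump_kernel s a).

(** As a is merely integrable, the jump kernel is not bounded pointwise by the Gagliardo kernel.
    Instead [om u] is bounded uniformly on each small shell by the Gagliardo energy of a comparable
    shell, and far away by 4 times the squared L^2 norm. *)
Lemma energy_le_gagliardo : exists2 C : R, 0 <= C & forall u, measurable_fun setT u ->
  (\int[mu]_z ((k z)%:E * om u z) <=
    C%:E * (\int[mu]_x ((u x) ^+ 2)%:E + gagliardo_sq s u))%E.
Proof.
pose K := fine (@shell_mass R n s a).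
have K0 : 0 <= K by rewrite fine_ge0//; exact: shell_mass_ge0.
have KE : @shell_mass R n s a = K%:E.
  by rewrite fineK// ge0_fin_numE; [exact: shell_mass_lty|exact: shell_mass_ge0].
set c := 4 * (4 * Num.sqrt n%:R) `^ p.
have c0 : 0 <= c by rewrite mulr_ge0// powR_ge0.
have k0 x : 0 <= k x by exact: jump_kernel_ge0.
have mk : measurable_fun setT (fun x => (k x)%:E).
  by apply/measurable_EFinP; exact: measurable_jump_kernel.
pose F := (\int[mu]_(x in [set x : V | (1 < enorm x)%R]) (k x)%:E)%E.
have Ffin : F = (fine F)%:E.
  rewrite fineK// ge0_fin_numE; first exact: jump_kernel_far_lty.
  by apply: integral_ge0 => x _; rewrite lee_fin.
have F0 : 0 <= fine F by rewrite -lee_fin -Ffin; apply: integral_ge0 => x _; rewrite lee_fin.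
exists (4 * fine F + c * K); first by rewrite addr_ge0// mulr_ge0.
move=> u mu_.
have mom := measurable_om mu_.
have om0 y := om_ge0 u y.
have mf : measurable_fun setT (fun z => (k z)%:E * om u z)%E by exact: emeasurable_funM.
have f0 z : (0 <= (k z)%:E * om u z)%E by rewrite mule_ge0// lee_fin.
have mgk : measurable_fun setT (fun y => (gag_kernel y)%:E).
  by apply/measurable_EFinP; exact: measurable_gag_kernel.
have mg : measurable_fun setT (fun y => (gag_kernel y)%:E * om u y)%E by exact: emeasurable_funM.
have g0 y : (0 <= (gag_kernel y)%:E * om u y)%E by rewrite mule_ge0// lee_fin gag_kernel_ge0.
have mfar : measurable [set x : V | (1 < enorm x)%R].
  rewrite (_ : mkset _ = enorm @^-1` `]1, +oo[%classic); last first.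
    by apply/seteqP; split => x /=; rewrite in_itv/= andbT.
  by rewrite -[X in measurable X]setTI; exact: measurable_enorm.
have mnear : measurable [set x : V | (0 < enorm x <= 1)%R] by exact: measurable_punctured_ball.
have near_le : (\int[mu]_(z in [set x : V | (0 < enorm x <= 1)%R]) ((k z)%:E * om u z) <=
    (c * K)%:E * gagliardo_sq s u)%E.
  apply: (le_trans (integral_shells mf f0)).
  apply: (@le_trans _ _ (\sum_(j <oo) ((c * K)%:E *
      \int[mu]_(y in sup_shell (4^-1 ^+ j)) ((gag_kernel y)%:E * om u y)))%E).
    apply: lee_nneseries => [j _ _|j _]; first exact: integral_ge0.
    set t := 4^-1 ^+ j; have t0 : 0 < t by rewrite exprn_gt0.
    set I := (\int[mu]_(y in sup_shell t) _)%E.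
    have I0 : (0 <= I)%E by exact: integral_ge0.
    apply: (@le_trans _ _ (\int[mu]_(z in shell t) (((c * t `^ (2 * s))%:E * I) * (k z)%:E))%E).
      apply: ge0_le_integral => //.
      - exact: measurable_shell.
      - exact: measurable_funTS.
      - by apply: measurable_funTS; exact: measurable_funeM.
      - move=> z /andP[_ zt]; rewrite muleC lee_wpmul2r ?lee_fin//.
        have zt' : `|z| <= t by rewrite (le_trans (le_norm_enorm _)).
        exact: om_near_le.
    rewrite (ge0_integral_scale _ (measurable_shell _) mk); last 2 first.
    - by move=> z; rewrite lee_fin.
    - by rewrite mule_ge0// lee_fin mulr_ge0// powR_ge0.
    rewrite (integral_shell s_gt0 ia aA2 t0) KE muleAC -!EFinM lee_wpmul2r// lee_fin.
    rewrite mulrA -(mulrA c) -powRD; last by rewrite (gt_eqF t0) implybT.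
    by rewrite subrr powRr0 mulr1.
  rewrite nneseriesZl; last by move=> j _; exact: integral_ge0.
  rewrite gagliardoE// lee_wpmul2l ?lee_fin ?mulr_ge0//.
  (* Disjointness bounds the sum over all shells by a single Gagliardo integral. *)
  have tS : trivIset setT (fun j => sup_shell (4^-1 ^+ j)).
    apply/trivIsetP => i j _ _ ij; apply/seteqP; split => // y [] /=.
    wlog {ij} ij : i j / (i < j)%N.
      move=> H yi yj; have [ij'|ij'|ij'] := ltngtP i j.
      - exact: H ij' yi yj.
      - exact: H ij' yj yi.
      - by rewrite ij' eqxx in ij.
    move=> /andP[iy _] /andP[_ yj].
    have := lt_le_trans iy yj; rewrite -(subnK ij) addnS exprS mulrA divff// mul1r.
    rewrite exprD ltNge ler_piMl ?exprn_ge0//; by rewrite exprn_ile1// invf_le1// ler1n.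
  rewrite -(ge0_integral_bigcup _ (fun j => measurable_sup_shell (4^-1 ^+ j))
    (measurable_funTS mg) (fun y _ => g0 y) tS).
  apply: ge0_subset_integral => //; apply: bigcupT_measurable => j.
  exact: measurable_sup_shell.
have far_le : (\int[mu]_(z in [set x : V | (1 < enorm x)%R]) ((k z)%:E * om u z) <=
    (4 * fine F)%:E * \int[mu]_x ((u x) ^+ 2)%:E)%E.
  rewrite (mulrC 4) EFinM -muleA -Ffin muleC.
  rewrite -(ge0_integral_scale _ mfar mk); last 2 first.
  - by move=> x; rewrite lee_fin.
  - by rewrite mule_ge0//; apply: integral_ge0 => x _; rewrite lee_fin sqr_ge0.
  apply: ge0_le_integral => //.
  - exact: measurable_funTS.
  - by apply: measurable_funTS; exact: measurable_funeM.
  - by move=> x _; rewrite muleC lee_wpmul2r ?lee_fin//; exact: om_le.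
have gs0 : (0 <= gagliardo_sq s u)%E by rewrite gagliardoE//; exact: integral_ge0.
have u20 : (0 <= \int[mu]_x ((u x) ^+ 2)%:E)%E by apply: integral_ge0 => x _; rewrite lee_fin sqr_ge0.
apply: (@le_trans _ _ (\int[mu]_(z in [set x : V | (1 < enorm x)%R] `|` [set x : V | (0 < enorm x <= 1)%R])
    ((k z)%:E * om u z))%E).
  rewrite [leRHS]integral_mkcond; apply: ge0_le_integral => //.
    by apply: (measurable_restrictT _ (measurableU _ _ mfar mnear)).1; exact: measurable_funTS.
  move=> z _; rewrite patchE; case: ifPn => // /negP zn.
  (* The origin belongs to neither region, but the integrand vanishes there. *)
  have [->|z0] := eqVneq z 0; first by rewrite jump_kernel0// mul0e.
  exfalso; apply: zn; apply/mem_set; have [z1|z1] := ltP 1 (enorm z); [by left|right].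
  by rewrite /= z1 enorm_gt0 z0.
rewrite ge0_integral_setU//; last 2 first.
- exact: measurable_funTS.
- apply/disj_setPS => z [/= z1 /andP[_ z2]]; by move: z1; rewrite ltNge z2.
rewrite ge0_muleDr//; apply: leeD.
  by apply: (le_trans far_le); rewrite lee_wpmul2r// lee_fin lerDl mulr_ge0.
by apply: (le_trans near_le); rewrite lee_wpmul2r// lee_fin lerDr mulr_ge0.
Qed.

End energy_gagliardo.

(** * Functions of finite energy *)

Section finite_energy.
Context {R : realType} {n : nat} (s : R) (n_gt0 : (0 < n)%N) (s_gt0 : 0 < s) (s_lt1 : s < 1).
Local Notation mu := (@lebesgue_rV R n).
Local Notation sigma := (@sphere_measure R n).
Local Notation V := 'rV[R]_n.
Implicit Types u v w f : V -> R.

Section one_kernel.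
Variables (a : V -> R) (ia : sigma.-integrable sphere (EFin \o a)).
Hypothesis aA2 : condA2 a.
Local Notation k := (jump_kernel s a).
Let k0 x : 0 <= k x. Proof. exact: jump_kernel_ge0. Qed.
Let mk : measurable_fun setT k. Proof. exact: measurable_jump_kernel. Qed.

Lemma Cc_support_le U f : Cc_smooth U f -> exists2 M, 0 <= M & forall x, f x != 0 -> `|x| <= M.
Proof.
move=> Cf; have [K [cK _ fK]] := Cc_smoothP Cf.
have [M [Mr HM]] := compact_bounded cK.
exists (`|M| + 1) => [|x /fK]; first by rewrite addr_ge0.
by apply: HM; rewrite (le_lt_trans (ler_norm M))// ltrDl.
Qed.

Lemma Cc_measurable U f : Cc_smooth U f -> measurable_fun setT f.
Proof. by case=> sf _ _; apply: rV_continuous_measurable; exact: smooth_continuous. Qed.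

Lemma measurable_le_ball M : measurable [set x : V | `|x| <= M].
Proof.
rewrite (_ : mkset _ = (fun y : V => `|y|) @^-1` `]-oo, M]%classic); last first.
  by apply/seteqP; split => x /=; rewrite in_itv.
by rewrite -[X in measurable X]setTI; exact: measurable_rVnorm.
Qed.

Lemma integral_bounded_support (g : V -> R) c M : measurable_fun setT g ->
  (forall x, 0 <= g x <= c) -> (forall x, g x != 0 -> `|x| <= M) ->
  (\int[mu]_x (g x)%:E <= c%:E * mu [set x : V | (`|x| <= M)%R])%E.
Proof.
move=> mg gc gM; have mB := measurable_le_ball M.
have c0 : 0 <= c by have /andP[] := gc 0; apply: le_trans.
rewrite -(integral_cst mu mB) [leRHS]integral_mkcond; apply: ge0_le_integral => //.
- by move=> x _; rewrite lee_fin; have /andP[] := gc x.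
- exact/measurable_EFinP.
- by apply: (measurable_restrictT _ mB).1; exact: measurable_cst.
- move=> x _; rewrite patchE; case: ifPn => [_|/negP xB].
    by rewrite lee_fin; have /andP[] := gc x.
  have [->//|/gM xM] := eqVneq (g x) 0.
  by exfalso; apply: xB; exact: mem_set.
Qed.

Lemma le_ball_lty M : (mu [set x : V | (`|x| <= M)%R] < +oo)%E.
Proof. by apply: (bounded_rV_lty (M := M)) => //; exact: measurable_le_ball. Qed.

Lemma Cc_sqint U f : Cc_smooth U f -> sqint mu f.
Proof.
move=> Cf; have [M M0 fM] := Cc_support_le Cf; have [B B0 fB] := Cc_bounded Cf.
have mf := Cc_measurable Cf; split => //.
apply: (@le_lt_trans _ _ ((B ^+ 2)%:E * mu [set x : V | (`|x| <= M)%R])%E).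
  apply: integral_bounded_support; first exact: measurable_funX.
  - move=> x; rewrite sqr_ge0/= -real_normK ?num_real// ler_pXn2r ?nnegrE//.
  - by move=> x; rewrite sqrf_eq0; exact: fM.
by rewrite lte_mul_pinfty ?le_ball_lty// lee_fin sqr_ge0.
Qed.

Lemma om_lipschitz U f : Cc_smooth U f -> exists2 c, 0 <= c & forall z, `|z| <= 1 ->
  (om f z <= (c * `|z| ^+ 2)%:E)%E.
Proof.
move=> Cf; have [M M0 fM] := Cc_support_le Cf; have [L L0 fL] := Cc_lipschitz Cf.
have mf := Cc_measurable Cf.
pose m := fine (mu [set x : V | (`|x| <= M + 1)%R]).
have mE : mu [set x : V | (`|x| <= M + 1)%R] = m%:E.
  by rewrite fineK// ge0_fin_numE// le_ball_lty.
have m0 : 0 <= m by rewrite fine_ge0.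
exists (L ^+ 2 * m) => [|z z1]; first by rewrite mulr_ge0// sqr_ge0.
apply: (@le_trans _ _ (((L * `|z|) ^+ 2)%:E * mu [set x : V | (`|x| <= M + 1)%R])%E).
  apply: integral_bounded_support.
  - apply: measurable_funX; apply: measurable_funB => //.
    exact: (measurableT_comp mf (measurable_shiftrV z)).
  - move=> x; rewrite sqr_ge0/= -real_normK ?num_real// ler_pXn2r ?nnegrE ?mulr_ge0//.
    by rewrite (le_trans (fL _ _))// addrC addKr.
  - move=> x; rewrite sqrf_eq0 => fx.
    have [fx0|/fM xM] := eqVneq (f x) 0; last by rewrite (le_trans xM)// lerDl.
    have /fM xz : f (x + z) != 0 by move: fx; rewrite fx0 subr0.
    by rewrite -(addrK z x) (le_trans (ler_normB _ _))// lerD.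
by rewrite mE -EFinM lee_fin exprMn mulrAC.
Qed.

Lemma integral_near_far (g : V -> \bar R) : measurable_fun setT g ->
  (forall x, 0 <= g x)%E -> g 0 = 0%E ->
  (\int[mu]_x g x <= \int[mu]_(x in [set x : V | (1 < enorm x)%R]) g x +
    \int[mu]_(x in [set x : V | (0 < enorm x <= 1)%R]) g x)%E.
Proof.
move=> mg g0 g00.
have mfar : measurable [set x : V | (1 < enorm x)%R].
  rewrite (_ : mkset _ = enorm @^-1` `]1, +oo[%classic); last first.
    by apply/seteqP; split => x /=; rewrite in_itv/= andbT.
  by rewrite -[X in measurable X]setTI; exact: measurable_enorm.
have mnear : measurable [set x : V | (0 < enorm x <= 1)%R] by exact: measurable_punctured_ball.
rewrite -ge0_integral_setU//; last 2 first.
- exact: measurable_funTS.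
- by apply/disj_setPS => z [/= z1 /andP[_ z2]]; move: z1; rewrite ltNge z2.
rewrite [leRHS]integral_mkcond; apply: ge0_le_integral => //.
  by apply: (measurable_restrictT _ (measurableU _ _ mfar mnear)).1; exact: measurable_funTS.
move=> z _; rewrite patchE; case: ifPn => // /negP zn.
have [->|z0] := eqVneq z 0; first by rewrite g00.
exfalso; apply: zn; apply/mem_set; have [z1|z1] := ltP 1 (enorm z); [by left|right].
by rewrite /= z1 enorm_gt0 z0.
Qed.

(** Near the origin [om f] is O(|z|^2), f being Lipschitz with compact support, and |z|^2 k(z) is
    integrable. Far away [om f] is bounded and k is integrable. *)
Lemma Cc_energy_lty U f : Cc_smooth U f -> (\int[mu]_z ((k z)%:E * om f z) < +oo)%E.
Proof.
move=> Cf; have mf := Cc_measurable Cf; have [_ f2] := Cc_sqint Cf.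
have [c c0 Hc] := om_lipschitz Cf.
have mom := measurable_om mf.
have om0 y := om_ge0 f y.
have mkE : measurable_fun setT (fun x => (k x)%:E) by exact/measurable_EFinP.
have mg : measurable_fun setT (fun z => (k z)%:E * om f z)%E by exact: emeasurable_funM.
apply: (le_lt_trans (integral_near_far mg _ _)).
- by move=> x; rewrite mule_ge0// lee_fin.
- by rewrite jump_kernel0// mul0e.
have mfar : measurable [set x : V | (1 < enorm x)%R].
  rewrite (_ : mkset _ = enorm @^-1` `]1, +oo[%classic); last first.
    by apply/seteqP; split => x /=; rewrite in_itv/= andbT.
  by rewrite -[X in measurable X]setTI; exact: measurable_enorm.
have mnear : measurable [set x : V | (0 < enorm x <= 1)%R] by exact: measurable_punctured_ball.
have I2 : (0 <= 4%:E * \int[mu]_x ((f x) ^+ 2)%:E)%E.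
  by rewrite mule_ge0//; apply: integral_ge0 => x _; rewrite lee_fin sqr_ge0.
rewrite lte_add_pinfty//.
- apply: (@le_lt_trans _ _ (\int[mu]_(x in [set x : V | (1 < enorm x)%R])
      ((4%:E * \int[mu]_x ((f x) ^+ 2)%:E) * (k x)%:E))%E).
    apply: ge0_le_integral => //.
    + by move=> x _; rewrite mule_ge0// lee_fin.
    + exact: measurable_funTS.
    + by apply: measurable_funTS; exact: measurable_funeM.
    + by move=> x _; rewrite muleC lee_wpmul2r ?lee_fin//; exact: om_le.
  rewrite (ge0_integral_scale _ mfar mkE)//.
  by rewrite lte_mul_pinfty ?jump_kernel_far_lty// ge0_fin_numE// lte_mul_pinfty.
- have me : measurable_fun setT (fun x : V => ((enorm x) ^+ 2 * k x)%:E).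
    apply/measurable_EFinP; apply: measurable_funM => //.
    by apply: measurable_funX; exact: measurable_enorm.
  apply: (@le_lt_trans _ _ (\int[mu]_(x in [set x : V | (0 < enorm x <= 1)%R])
      (c%:E * ((enorm x) ^+ 2 * k x)%:E))%E).
    apply: ge0_le_integral => //.
    + by move=> x _; rewrite mule_ge0// lee_fin.
    + exact: measurable_funTS.
    + by apply: measurable_funTS; exact: measurable_funeM.
    + move=> x /andP[_ x1]; have x1' : `|x| <= 1 by rewrite (le_trans (le_norm_enorm _)).
      have -> : (c%:E * (enorm x ^+ 2 * k x)%:E = (k x)%:E * (c * enorm x ^+ 2)%:E)%E.
        by rewrite -!EFinM; congr EFin; ring.
      rewrite lee_wpmul2l ?lee_fin// (le_trans (Hc x x1'))// lee_fin.
      by rewrite ler_wpM2l// ler_pXn2r ?nnegrE ?enorm_ge0// le_norm_enorm.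
  rewrite (ge0_integral_scale _ mnear me)//; last first.
    by move=> x; rewrite lee_fin mulr_ge0// sqr_ge0.
  by rewrite lte_mul_pinfty//; exact: jump_kernel_near_lty.
Qed.

Definition fe u := sqint mu u /\ sqint (mu \x mu)%E (dif u k).

Definition energy u v : R := ip (mu \x mu)%E (dif u k) (dif v k).

Lemma feE u : measurable_fun setT u -> (\int[mu]_x ((u x) ^+ 2)%:E < +oo)%E ->
  (\int[mu]_z ((k z)%:E * om u z) < +oo)%E -> fe u.
Proof.
move=> mu_ u2 ku; split; first by split.
by split; [exact: measurable_dif|rewrite energy_om].
Qed.

Lemma energyE u : fe u -> (energy u u)%:E = (\int[mu]_z ((k z)%:E * om u z))%E.
Proof. by move=> [[mu_ _] su]; rewrite ipE// energy_om. Qed.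

Lemma Cc_fe U f : Cc_smooth U f -> fe f.
Proof.
move=> Cf; have [mf f2] := Cc_sqint Cf.
by apply: feE => //; exact: Cc_energy_lty Cf.
Qed.

Lemma difD u v : dif (fun x => u x + v x) k = (fun p => dif u k p + dif v k p).
Proof. by apply/funext => p; rewrite /dif; ring. Qed.

Lemma difZ u c : dif (fun x => c * u x) k = (fun p => c * dif u k p).
Proof. by apply/funext => p; rewrite /dif; ring. Qed.

Lemma feD u v : fe u -> fe v -> fe (fun x => u x + v x).
Proof. by move=> [u1 u2] [v1 v2]; split; [exact: sqintD|rewrite difD; exact: sqintD]. Qed.

Lemma feZ u c : fe u -> fe (fun x => c * u x).
Proof. by move=> [u1 u2]; split; [exact: sqintZ|rewrite difZ; exact: sqintZ]. Qed.

Lemma feB u v : fe u -> fe v -> fe (fun x => u x - v x).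
Proof.
move=> fu fv; have := feD fu (feZ (-1) fv).
by rewrite (_ : (fun x => u x + -1 * v x) = (fun x => u x - v x))//; apply/funext => x; rewrite mulN1r.
Qed.

Lemma energyC u v : energy u v = energy v u.
Proof. exact: ipC. Qed.

Lemma energyDl u v w : fe u -> fe v -> fe w ->
  energy (fun x => u x + v x) w = energy u w + energy v w.
Proof. by move=> [_ su] [_ sv] [_ sw]; rewrite /energy difD ipDl. Qed.

Lemma energyZl u w c : fe u -> fe w -> energy (fun x => c * u x) w = c * energy u w.
Proof. by move=> [_ su] [_ sw]; rewrite /energy difZ ipZl. Qed.

Lemma energy_ge0 u : 0 <= energy u u. Proof. exact: ip_ge0. Qed.

Lemma energy_CS u v : fe u -> fe v -> energy u v ^+ 2 <= energy u u * energy v v.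
Proof. by move=> [_ su] [_ sv]; exact: ip_CS. Qed.

Definition enormsq u := ip mu u u + energy u u.

Lemma enormsq_ge0 u : 0 <= enormsq u.
Proof. by rewrite addr_ge0 ?ip_ge0 ?energy_ge0. Qed.

(** Approximation in H^s thereby implies approximation in the energy norm, which places [Hs_tilde]
    inside the energy space. *)
Lemma Hs_fe : exists2 C, 0 <= C & forall u, Hs s u -> fe u /\
  forall e, 0 <= e -> (Hs_norm s u <= e%:E)%E -> enormsq u <= C * e ^+ 2.
Proof.
have [C C0 HC] := energy_le_gagliardo n_gt0 s_gt0 ia aA2.
exists (1 + C) => [|u [Lu gu]]; first by rewrite addr_ge0.
have mu_ : measurable_fun setT u by move/sub_Lfun_mfun : Lu; rewrite inE.
have iu2 := Lfun2_integrable_sqr Lu.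
have u2 : (\int[mu]_x ((u x) ^+ 2)%:E < +oo)%E.
  have /integrableP[_] := iu2; apply: le_lt_trans.
  apply: ge0_le_integral => //.
  - by move=> x _; rewrite lee_fin sqr_ge0.
  - exact: measurable_sq.
  - by apply: measurableT_comp => //; exact: measurable_sq.
  - by move=> x _; rewrite /= lee_fin ler_norm.
have u20 : (0 <= \int[mu]_x ((u x) ^+ 2)%:E)%E by apply: integral_ge0 => x _; rewrite lee_fin sqr_ge0.
have g0 : (0 <= gagliardo_sq s u)%E.
  apply: integral_ge0 => x _; apply: integral_ge0 => y _.
  by rewrite lee_fin mulr_ge0 ?sqr_ge0// invr_ge0 powR_ge0.
have fu : fe u.
  apply: feE => //; apply: (le_lt_trans (HC u mu_)).
  by rewrite lte_mul_pinfty// lte_add_pinfty.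
split => // e e0 He.
have [su _] := fu.
rewrite -lee_fin /enormsq EFinD ipE// energyE//.
set S := (\int[mu]_x ((u x) ^+ 2)%:E + gagliardo_sq s u)%E.
have S0 : (0 <= S)%E by exact: adde_ge0.
have Sfin : S \is a fin_num by rewrite ge0_fin_numE// lte_add_pinfty.
have Se : (S <= (e ^+ 2)%:E)%E.
  have := He; rewrite /Hs_norm -/S -(fineK Sfin) poweR_EFin !lee_fin.
  rewrite powR12_sqrt ?fine_ge0// => h.
  by rewrite -(sqr_sqrtr (fine_ge0 S0)) ler_pXn2r// nnegrE sqrtr_ge0.
apply: (@le_trans _ _ (1%:E * S + C%:E * S)%E).
  by apply: leeD; [rewrite mul1e leeDl|exact: HC].
by rewrite -ge0_muleDl ?lee_fin// -EFinD EFinM lee_wpmul2l// lee_fin addr_ge0.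
Qed.

End one_kernel.

Lemma fe_Hs u : fe (fun=> 1) u -> Hs s u.
Proof.
move=> [[mu_ u2] [_ du]]; split.
  apply/andP; split; first by rewrite inE.
  rewrite inE /= /finite_norm unlock; apply: poweR_lty.
  rewrite (_ : (fun x => _) = (fun x => ((u x) ^+ 2)%:E))//.
  apply/funext => x /=; congr EFin.
  by rewrite powR_mulrn// real_normK ?num_real.
rewrite gagliardoE// -energy_om//; first exact: measurable_gag_kernel.
by move=> z; exact: gag_kernel_ge0.
Qed.

Lemma Cc_Hs U f : Cc_smooth U f -> Hs s f.
Proof.
by move=> Cf; apply: fe_Hs; exact: (Cc_fe sphere_integrable_cst1 condA2_cst1 Cf).
Qed.

Lemma HsB u v : Hs s u -> Hs s v -> Hs s (fun x => u x - v x).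
Proof.
have [C C0 HC] := Hs_fe sphere_integrable_cst1 condA2_cst1.
by move=> /HC[fu _] /HC[fv _]; apply: fe_Hs; exact: feB.
Qed.

End finite_energy.

Section product_ae.
Context d (T : measurableType d) (R : realType) (m : {sigma_finite_measure set T -> \bar R}).

Lemma ae_prod (P : T -> Prop) : {ae m, forall x, P x} ->
  {ae (m \x m)%E, forall p : T * T, P p.1 /\ P p.2}.
Proof.
move=> [N [mN N0 PN]]; exists ((N `*` setT) `|` (setT `*` N)); split.
- by apply: measurableU; exact: measurableX.
- apply/eqP; rewrite -measure_le0.
  apply: (@le_trans _ _ ((m \x m) (N `*` setT) + (m \x m) (setT `*` N))%E).
    by apply: measureU2; exact: measurableX.
  have E : (m N * m setT + m setT * m N = 0 :> \bar R)%E.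
    by rewrite N0 mul0e mule0 adde0.
  by rewrite !product_measure1E//; rewrite le_eqVlt; apply/orP; left; apply/eqP; exact: E.
- move=> p /= /not_andP[np|np]; [left|right]; split => //; exact: PN.
Qed.

(** Closedness in L^2 of the condition of vanishing on D. It serves for the complement of Omega and
    for the set where the potentials differ. *)
Lemma ae_eq0_on (u : T -> R) (D : set T) : measurable D -> sqint m u ->
  (forall e : R, 0 < e -> exists v, [/\ sqint m v, {ae m, forall x, D x -> v x = 0} &
     ip m (fun x => u x - v x) (fun x => u x - v x) < e]) ->
  {ae m, forall x, D x -> u x = 0}.
Proof.
move=> mD su H; have [mu_ u2] := su.
have mu2 : measurable_fun setT (fun x => ((u x) ^+ 2)%:E) by exact: measurable_sq.
have I0 : (\int[m]_(x in D) ((u x) ^+ 2)%:E = 0)%E.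
  apply/eqP; rewrite eq_le; apply/andP; split; last first.
    by apply: integral_ge0 => x _; rewrite lee_fin sqr_ge0.
  apply/lee_addgt0Pr => e e0; rewrite add0e.
  have [v [sv v0 uv]] := H e e0.
  have suv := sqintB su sv; have [muv _] := suv.
  apply: (@le_trans _ _ (\int[m]_(x in D) ((u x - v x) ^+ 2)%:E)%E).
    apply: ae_ge0_le_integral => //.
    - by move=> x _; rewrite lee_fin sqr_ge0.
    - exact: measurable_funTS.
    - by move=> x _; rewrite lee_fin sqr_ge0.
    - by apply: measurable_funTS; exact: measurable_sq.
    - by apply: filterS v0 => x vx Dx; rewrite vx// subr0.
  apply: (@le_trans _ _ (\int[m]_x ((u x - v x) ^+ 2)%:E)%E).
    apply: ge0_subset_integral => //; first exact: measurable_sq.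
    by move=> x _; rewrite lee_fin sqr_ge0.
  by rewrite -ipE// lee_fin ltW.
have := (ae_eq_integral_abs m mD (measurable_funTS mu2)).1.
rewrite (_ : integral _ _ _ = 0%E); last first.
  by rewrite -[RHS]I0; apply: eq_integral => x _; rewrite gee0_abs// lee_fin sqr_ge0.
move=> /(_ erefl); apply: filterS => x h Dx.
by have [/eqP] := h Dx; rewrite sqrf_eq0 => /eqP.
Qed.

End product_ae.

(** * The energy closure of the test functions *)

Section energy_space.
Context {R : realType} {n : nat} (s : R) (n_gt0 : (0 < n)%N) (s_gt0 : 0 < s) (s_lt1 : s < 1).
Local Notation mu := (@lebesgue_rV R n).
Local Notation sigma := (@sphere_measure R n).
Local Notation V := 'rV[R]_n.
Implicit Types u v w f : V -> R.
Variables (a : V -> R) (ia : sigma.-integrable sphere (EFin \o a)).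
Hypothesis aA2 : condA2 a.
Local Notation k := (jump_kernel s a).
Local Notation fe := (fe s a).
Local Notation energy := (energy s a).
Local Notation nrm := (enormsq s a).
Let k0 x : 0 <= k x. Proof. exact: jump_kernel_ge0. Qed.
Let mk : measurable_fun setT k. Proof. exact: measurable_jump_kernel. Qed.

Lemma ip_add_le d (T : measurableType d) (m : {measure set T -> \bar R}) (f g : T -> R) :
  sqint m f -> sqint m g ->
  ip m (fun x => f x + g x) (fun x => f x + g x) <= 2 * ip m f f + 2 * ip m g g.
Proof.
move=> sf sg; have sfg := sqintD sf sg; have sfg' := sqintB sf sg.
have := ip_ge0 m (fun x => f x - g x).
have E : (fun x => f x - g x) = (fun x => f x + -1 * g x).
  by apply/funext => x; rewrite mulN1r.
rewrite E in sfg' *; have sNg := sqintZ (-1) sg.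
rewrite !ipDl// !ipZl// ![ip m _ (fun x => _ + _)]ipC !ipDl// !ipZl// (ipC m g f).
lra.
Qed.

Lemma nrmD_le u v : fe u -> fe v -> nrm (fun x => u x + v x) <= 2 * nrm u + 2 * nrm v.
Proof.
move=> [su du] [sv dv]; rewrite /enormsq /energy difD.
by have := ip_add_le su sv; have := ip_add_le du dv; lra.
Qed.

Lemma nrmZ u c : fe u -> nrm (fun x => c * u x) = c ^+ 2 * nrm u.
Proof.
move=> [su du]; rewrite /enormsq /energy difZ.
have scu := sqintZ c su; have dcu := sqintZ c du.
by rewrite !ipZl// ![ip _ _ (fun x => c * _)]ipC !ipZl//; ring.
Qed.

Lemma nrmBC u v : nrm (fun x => u x - v x) = nrm (fun x => v x - u x).
Proof.
rewrite /enormsq /energy /ip; congr (_ + _).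
  by apply: eq_Rintegral => x _; ring.
by apply: eq_Rintegral => x _; rewrite /dif; ring.
Qed.

Lemma ip_le_nrm u : ip mu u u <= nrm u.
Proof. by rewrite lerDl energy_ge0. Qed.

(** The L^2 part provides a limit v almost everywhere along a subsequence. Since [dif] is computed
    pointwise, it converges almost everywhere on the product, and Fatou bounds both parts of the
    norm of u i - v. *)
Lemma fe_complete (u : nat -> V -> R) : (forall j, fe (u j)) ->
  (forall e, 0 < e -> exists N, forall i j, (N <= i)%N -> (N <= j)%N ->
     nrm (fun x => u i x - u j x) < e) ->
  exists2 v, fe v & forall e, 0 < e -> exists N, forall i, (N <= i)%N ->
     nrm (fun x => u i x - v x) < e.
Proof.
move=> fu cu.
have su j : sqint mu (u j) by have [] := fu j.
have [|phi [phij [v mv uv]]] := sqint_cauchy_subseq su.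
  move=> e /cu[N HN]; exists N => i j Ni Nj.
  exact: le_lt_trans (ip_le_nrm _) (HN i j Ni Nj).
have uv2 : {ae (mu \x mu)%E, forall p : V * V,
    (u (phi j) p.1 @[j --> \oo] --> v p.1) /\ (u (phi j) p.2 @[j --> \oo] --> v p.2)}.
  exact: ae_prod uv.
have key e : 0 < e -> exists N, forall i, (N <= i)%N ->
    [/\ fe (fun x => u i x - v x) & nrm (fun x => u i x - v x) <= 2 * e].
  move=> e0; have [N HN] := cu e e0; exists N => i Ni.
  have muv : measurable_fun setT (fun x => u i x - v x).
    by apply: measurable_funB => //; have [[]] := fu i.
  have I1 : (\int[mu]_x ((u i x - v x) ^+ 2)%:E <= e%:E)%E.
    apply: (@fatou_ae _ _ _ _ (fun j x => (u i x - u (phi j) x) ^+ 2)).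
    - by move=> j; apply: measurable_funX; apply: measurable_funB; [have [[]] := fu i|have [[]] := fu (phi j)].
    - by move=> j x; exact: sqr_ge0.
    - exact: measurable_funX.
    - by move=> x; exact: sqr_ge0.
    - apply: filterS uv => x ux.
      by apply: (@cvgM _ _ \oo _ (fun j => u i x - u (phi j) x) (fun j => u i x - u (phi j) x));
        apply: cvgB => //; exact: cvg_cst.
    - exists N => j Nj; have fij := feB (fu i) (fu (phi j)).
      rewrite -ipE; last by have [] := fij.
      rewrite lee_fin; apply: ltW; apply: le_lt_trans (ip_le_nrm _) (HN _ _ Ni _).
      exact: leq_trans Nj (phij j).
  have I2 : (\int[mu \x mu]_p ((dif (fun x => u i x - v x) k p) ^+ 2)%:E <= e%:E)%E.
    apply: (@fatou_ae _ _ _ _ (fun j p => (dif (fun x => u i x - u (phi j) x) k p) ^+ 2)).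
    - move=> j; apply: measurable_funX; apply: measurable_dif => //.
      by apply: measurable_funB; [have [[]] := fu i|have [[]] := fu (phi j)].
    - by move=> j x; exact: sqr_ge0.
    - by apply: measurable_funX; apply: measurable_dif.
    - by move=> x; exact: sqr_ge0.
    - apply: filterS uv2 => p [u1 u2].
      have H : (dif (fun x => u i x - u (phi j) x) k p) @[j --> \oo] -->
          dif (fun x => u i x - v x) k p.
        by apply: cvgM; [apply: cvgB; apply: cvgB => //; exact: cvg_cst|exact: cvg_cst].
      exact: (cvgM H H).
    - exists N => j Nj; have fij := feB (fu i) (fu (phi j)).
      rewrite -ipE; last by have [] := fij.
      rewrite lee_fin; apply: ltW; apply: le_lt_trans _ (HN _ _ Ni (leq_trans Nj (phij j))).
      by rewrite /enormsq lerDr ip_ge0.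
  have fuv : fe (fun x => u i x - v x).
    split; split => //.
    - exact: le_lt_trans I1 (ltry _).
    - exact: measurable_dif.
    - exact: le_lt_trans I2 (ltry _).
  split => //; move: I1 I2; have [s1 s2] := fuv.
  by rewrite -!ipE// !lee_fin /enormsq /energy; lra.
exists v.
  have [N /(_ N (leqnn N))[fN _]] := key 1 ltr01.
  have := feB (fu N) fN.
  by rewrite (_ : (fun x => u N x - (u N x - v x)) = v)//; apply/funext => x; rewrite subKr.
move=> e e0; have e4 : 0 < e / 4 by rewrite divr_gt0.
have [N HN] := key _ e4; exists N => i /HN[_]; move=> h; apply: le_lt_trans h _; lra.
Qed.

Variable Omega : set V.

(** The space X of the overview; the closure is taken in the norm for which the form is coercive up
    to finite rank. *)
Definition inX u := fe u /\ forall e, 0 < e ->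
  exists2 f, Cc_smooth Omega f & nrm (fun x => u x - f x) < e.

Lemma inX_fe u : inX u -> fe u. Proof. by case. Qed.

Lemma nrm0 : nrm (fun=> 0) = 0.
Proof.
rewrite /enormsq /energy /ip.
have -> : (\int[mu]_x (0 * 0 : R))%R = 0.
  by rewrite mulr0 Rintegral_cst// mul0r.
rewrite add0r; transitivity (\int[(mu \x mu)%E]_(p in setT) (0 : R)).
  by apply: eq_Rintegral => p _; rewrite /dif subrr mul0r mul0r.
by rewrite Rintegral_cst// mul0r.
Qed.

Lemma inX_Cc f : Cc_smooth Omega f -> inX f.
Proof.
move=> Cf; split; first exact: (Cc_fe n_gt0 s_gt0 s_lt1 ia aA2 Cf).
move=> e e0; exists f => //; rewrite (_ : (fun x => _) = (fun=> 0)) ?nrm0//.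
by apply/funext => x; rewrite subrr.
Qed.

Lemma inX_D u v : inX u -> inX v -> inX (fun x => u x + v x).
Proof.
move=> [fu Hu] [fv Hv]; split; first exact: feD.
move=> e e0; have e4 : 0 < e / 4 by rewrite divr_gt0.
have [f Cf uf] := Hu _ e4; have [g Cg vg] := Hv _ e4.
exists (f + g); first exact: Cc_smoothD.
have ff := Cc_fe n_gt0 s_gt0 s_lt1 ia aA2 Cf; have fg := Cc_fe n_gt0 s_gt0 s_lt1 ia aA2 Cg.
rewrite (_ : (fun x => _) = (fun x => (u x - f x) + (v x - g x))); last first.
  by apply/funext => x; rewrite fctE; ring.
apply: le_lt_trans (nrmD_le (feB fu ff) (feB fv fg)) _; lra.
Qed.

Lemma inX_Z u c : inX u -> inX (fun x => c * u x).
Proof.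
move=> [fu Hu]; split; first exact: feZ.
move=> e e0; have ce : 0 < e / (c ^+ 2 + 1) by rewrite divr_gt0// ltr_wpDl// sqr_ge0.
have [f Cf uf] := Hu _ ce; exists (c *: f); first exact: Cc_smoothZ.
have ff := Cc_fe n_gt0 s_gt0 s_lt1 ia aA2 Cf.
rewrite (_ : (fun x => _) = (fun x => c * (u x - f x))); last first.
  by apply/funext => x; rewrite fctE /GRing.scale/=; ring.
rewrite nrmZ; last exact: feB.
move: uf; rewrite ltr_pdivlMr ?ltr_wpDl ?sqr_ge0// => uf.
by apply: le_lt_trans uf; rewrite mulrC ler_wpM2l ?enormsq_ge0// lerDl.
Qed.

Lemma inX_Hs_tilde u : Hs_tilde s Omega u -> inX u.
Proof.
have [C C0 HC] := Hs_fe n_gt0 s_gt0 ia aA2.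
move=> [Hu Hf]; have [fu _] := HC u Hu; split => // e e0.
have r0 : 0 < Num.sqrt (e / (C + 1)) by rewrite sqrtr_gt0 divr_gt0// ltr_wpDl.
have [f Cf uf] := Hf _ r0; exists f => //.
have Hf' : Hs s f by exact: (Cc_Hs n_gt0 s_gt0 s_lt1 Cf).
have Hd : Hs s (fun x => u x - f x) by apply: HsB.
have [_ nH] := HC _ Hd.
apply: le_lt_trans (nH _ (ltW r0) (ltW uf)) _.
rewrite sqr_sqrtr ?divr_ge0 ?ltW// ?ltr_wpDl//.
by rewrite mulrA ltr_pdivrMr ?ltr_wpDl// mulrC ltr_pM2l// ltrDl.
Qed.

Lemma inX_complete (u : nat -> V -> R) : (forall j, inX (u j)) ->
  (forall e, 0 < e -> exists N, forall i j, (N <= i)%N -> (N <= j)%N ->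
     nrm (fun x => u i x - u j x) < e) ->
  exists2 v, inX v & forall e, 0 < e -> exists N, forall i, (N <= i)%N ->
     nrm (fun x => u i x - v x) < e.
Proof.
move=> Xu cu; have [v fv uv] := fe_complete (fun j => inX_fe (Xu j)) cu.
exists v => //; split => // e e0.
have e4 : 0 < e / 4 by rewrite divr_gt0.
have [N /(_ N (leqnn N)) vN] := uv _ e4.
have [fN Hf] := Xu N; have [f Cf uf] := Hf _ e4; exists f => //.
have ff := Cc_fe n_gt0 s_gt0 s_lt1 ia aA2 Cf.
rewrite (_ : (fun x => _) = (fun x => (v x - u N x) + (u N x - f x))); last first.
  by apply/funext => x; ring.
rewrite nrmBC in vN.
apply: le_lt_trans (nrmD_le (feB fv fN) (feB fN ff)) _; lra.
Qed.

Lemma inX_ae0 u : measurable Omega -> inX u -> {ae mu, forall x, (~` Omega) x -> u x = 0}.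
Proof.
move=> mO [[su _] Hu]; apply: (ae_eq0_on (measurableC mO) su) => e /Hu[f Cf uf].
exists f; split.
- exact: Cc_sqint Cf.
- apply: aeW => x Ox; apply/eqP; apply: contra_notT Ox => fx.
  by have [_ _] := Cf; apply; exact: subset_closure.
- exact: le_lt_trans (ip_le_nrm _) uf.
Qed.

End energy_space.

Lemma lebesgue_shift {R : realType} {n : nat} (z : 'rV[R]_n) (A : set 'rV[R]_n) :
  measurable A -> lebesgue_rV ((fun x : 'rV[R]_n => x + z) @^-1` A) = lebesgue_rV A.
Proof.
move=> mA; have E := @lebesgue_affm R n 1 z A (oner_neq0 _) mA.
have -> : (fun x : 'rV[R]_n => x + z) = affm 1 z.
  by apply/funext => x; rewrite /affm scale1r.
by rewrite E normr1 expr1n invr1 mul1e.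
Qed.

(** * Translations bounded by the energy *)

Section translation_estimate.
Context {R : realType} {n : nat} (s : R) (s_gt0 : 0 < s).
Local Notation mu := (@lebesgue_rV R n).
Local Notation sigma := (@sphere_measure R n).
Local Notation V := 'rV[R]_n.
Implicit Types u v w f : V -> R.
Variables (a : V -> R) (ia : sigma.-integrable sphere (EFin \o a)).
Hypothesis aA2 : condA2 a.
Variables (C : set V) (aA3 : condA3 C a).
Local Notation k := (jump_kernel s a).
Local Notation p := (n%:R + 2 * s).
Let k0 x : 0 <= k x. Proof. exact: jump_kernel_ge0. Qed.
Let mk : measurable_fun setT k. Proof. exact: measurable_jump_kernel. Qed.
Let mkE : measurable_fun setT (fun x => (k x)%:E). Proof. exact/measurable_EFinP. Qed.

Lemma cone_neq0 x : C x -> x != 0.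
Proof. by move=> Cx; apply/eqP => x0; case: aA3 => -[_ _ _ _]; rewrite -x0. Qed.

Lemma cone_kernel_gt0 x : C x -> 0 < k x.
Proof.
move=> Cx; have x0 := cone_neq0 Cx; have e0 : 0 < enorm x by rewrite enorm_gt0.
have [[_ _ _ cC _] aC] := aA3.
have sx := sphere_unit_dir x0.
have ax : a (unit_dir x) != 0.
  by apply/(aC _ sx); right; apply: cC => //; rewrite invr_gt0.
rewrite /jump_kernel divr_gt0 ?powR_gt0// lt_neqAle eq_sym ax/=.
by have [] := aA2 sx.
Qed.

(** The kernel is positive on the open cone but only measurable, so S is a superlevel set in a box B
    of half-side e inside the cone, missing at most measure e^n/4 of B. For |z| <= e/2 the
    concentric box of half-side e/2, of measure e^n, and its translate lie in B. Removing the
    missing part and its translate leaves measure at least e^n/2. *)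
Lemma kernel_bounded_below : exists (S : set V) (m rho c : R),
  [/\ measurable S, 0 < m, 0 < rho, 0 < c & (forall x, S x -> m < k x) /\
   forall z, `|z| <= rho -> (c%:E <= mu (S `&` (fun x : V => (x + z)%R) @^-1` S))%E].
Proof.
have [[_ oC [c Cc] _ _] _] := aA3.
have [e e0 eC] := nbhs_obox (open_nbhs_nbhs (conj oC Cc)).
pose B := obox (c - const_mx e) (c + const_mx e).
pose B' := obox (c - const_mx (e / 2)) (c + const_mx (e / 2)).
have mB : measurable B by exact: measurable_obox.
have mB' : measurable B' by exact: measurable_obox.
have muB h : 0 < h -> mu (obox (c - const_mx h) (c + const_mx h)) = ((2 * h) ^+ n)%:E.
  move=> h0; rewrite lebesgue_obox prod_EFin; congr EFin.
  transitivity (\prod_(i < n) (2 * h)); last by rewrite prodr_const card_ord.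
  apply: eq_bigr => i _.
  have -> : (c + const_mx h) ord0 i - (c - const_mx h) ord0 i = 2 * h by rewrite !mxE; ring.
  by rewrite max_l// mulr_ge0// ltW.
pose S M := B `&` [set x | (M.+1%:R)^-1 < k x].
have mS M : measurable (S M).
  apply: measurableI => //; rewrite (_ : mkset _ = k @^-1` `]M.+1%:R^-1, +oo[%classic).
    by rewrite -[X in measurable X]setTI; exact: mk.
  by apply/seteqP; split => x /=; rewrite in_itv/= andbT.
have SB : \bigcup_M S M = B.
  apply/seteqP; split => [x [M _ []]//|x Bx].
  have kx := cone_kernel_gt0 (eC _ Bx).
  exists (Num.truncn (k x)^-1) => //; split => //=.
  by rewrite invf_plt ?posrE// truncnS_gt.
have ndS : nondecreasing_seq S.
  apply/nondecreasing_seqP => M; rewrite subsetEset => x [Bx /= kx]; split => //=.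
  by apply: le_lt_trans kx; rewrite lef_pV2 ?posrE// ler_nat.
have cvS : mu (S M) @[M --> \oo] --> mu B.
  by rewrite -SB; apply: nondecreasing_cvg_mu => //; exact: bigcupT_measurable.
have en : 0 < e ^+ n by rewrite exprn_gt0.
have [M HM] : exists M, (((2 * e) ^+ n - e ^+ n / 4)%:E < mu (S M))%E.
  have H : ((((2 * e) ^+ n - e ^+ n / 4)%:E : \bar R) < mu B)%E.
    by rewrite muB// lte_fin ltrBlDr ltrDl divr_gt0.
  apply: contrapT => /forallNP H'.
  have : (limn (fun M => mu (S M)) <= ((2 * e) ^+ n - e ^+ n / 4)%:E)%E.
    apply: lime_le; first by apply/cvg_ex; eexists; exact: cvS.
    by apply: nearW => M; rewrite leNgt; apply/negP; exact: H'.
  by rewrite (cvg_lim _ cvS)// leNgt H.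
have muBS : (mu (B `\` S M) <= (e ^+ n / 4)%:E)%E.
  have muBE : mu B = ((2 * e) ^+ n)%:E by exact: muB.
  have muBfin : (mu B < +oo)%E by rewrite muBE ltry.
  rewrite measureD//.
  have -> : B `&` S M = S M by rewrite /S setIA setIid.
  have Sfin : mu (S M) \is a fin_num.
    rewrite ge0_fin_numE//; apply: le_lt_trans muBfin.
    by apply: le_measure; rewrite ?inE// => x [].
  have G : (mu B - mu (S M) <= (e ^+ n / 4)%:E)%E.
    rewrite muBE -(fineK Sfin) -EFinB lee_fin.
    by move: HM; rewrite -(fineK Sfin) lte_fin => HM; lra.
  exact: G.
exists (S M), (M.+1%:R)^-1, (e / 2), (e ^+ n / 2).
split; [exact: mS|by rewrite invr_gt0|by rewrite divr_gt0|by rewrite divr_gt0|].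
split; first by move=> x [].
move=> z ze; pose T := S M `&` (fun x : V => (x + z)%R) @^-1` S M.
have mSM := mS M.
clear - e0 mB mB' muB mSM HM muBS ze en T.
have mSz A : measurable A -> measurable ((fun x : V => (x + z)%R) @^-1` A).
  by move=> mA; rewrite -[X in measurable X]setTI; apply: measurable_shiftrV.
have mT : measurable T by apply: measurableI; [exact: mSM|exact: mSz].
  pose BS := B `\` S M.
  have mBS : measurable BS by exact: measurableD.
  pose BSz := (fun x : V => (x + z)%R) @^-1` BS.
  have mBSz : measurable BSz by exact: mSz.
  have shE : mu BSz = mu BS by exact: lebesgue_shift.
  have cover : B' `<=` T `|` (BS `|` BSz).
    move=> x B'x; have Bx : B x.
      by move=> i; have := B'x i; rewrite !mxE => /andP[x1 x2]; apply/andP; split; lra.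
    have Bxz : B (x + z).
      move=> i; have := B'x i; have := rV_coord_le z i; rewrite !mxE => z1 /andP[x1 x2].
      have := le_trans z1 ze; rewrite ler_norml => /andP[z2 z3].
      by apply/andP; split; lra.
    have [Sx|Sx] := pselect (S M x); last exact: (or_intror (or_introl (conj Bx Sx))).
    have [Sxz|Sxz] := pselect (S M (x + z)); last exact: (or_intror (or_intror (conj Bxz Sxz))).
    exact: (or_introl (conj Sx Sxz)).
  have : (mu B' <= mu T + (mu BS + mu BS))%E.
    rewrite -[X in (_ <= _ + (_ + X))%E]shE.
    apply: (@le_trans _ _ (mu (T `|` (BS `|` BSz)))).
      apply: le_measure; [exact: mem_set| |exact: cover].
      by apply: mem_set; apply: measurableU; [exact: mT|apply: measurableU; [exact: mBS|exact: mBSz]].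
    apply: (@le_trans _ _ (mu T + mu (BS `|` BSz))%E).
      by apply: measureU2; [exact: mT|apply: measurableU; [exact: mBS|exact: mBSz]].
    by apply: leeD2l; apply: measureU2; [exact: mBS|exact: mBSz].
  clear cover.
  rewrite muB ?divr_gt0// (_ : 2 * (e / 2) = e); last by field.
  move=> H; have {H} : ((e ^+ n)%:E <= mu T + (e ^+ n / 2)%:E)%E.
    apply: le_trans H _; rewrite leeD2l// (_ : e ^+ n / 2 = e ^+ n / 4 + e ^+ n / 4); last by field.
    by rewrite EFinD leeD.
  move: (mu T) => [r| |]; last by [].
  - by rewrite -EFinD !lee_fin => H; lra.
  - by move=> _; rewrite leey.
Qed.

(* z = (y + z) - y, with y and y + z in the set where the kernel is bounded below. *)
Lemma om_small_translation : exists A rho : R, [/\ 0 <= A, 0 < rho &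
  forall u z, measurable_fun setT u -> `|z| <= rho ->
   (om u z <= A%:E * \int[mu]_y ((k y)%:E * om u y))%E].
Proof.
have [S [m [rho [c [mS m0 rho0 c0 [Sk ST]]]]]] := kernel_bounded_below.
exists (4 / (c * m)), rho; split => //; first by rewrite divr_ge0// mulr_ge0// ltW.
move=> u z mu_ ze; have {ST} := ST z ze; set T := S `&` _ => muT.
have mT : measurable T.
  apply: measurableI; first exact: mS.
  by rewrite -[X in measurable X]setTI; apply: measurable_shiftrV.
have TS : T `<=` S by move=> x [].
have TSz x : T x -> S (x + z) by case.
clearbody T.
have om0 y := om_ge0 u y.
have mom := measurable_om mu_.
have mshift : measurable_fun setT (fun y : V => om u (y + z)).
  exact: (measurableT_comp mom (measurable_shiftrV z)).
pose J := (\int[mu]_y ((k y)%:E * om u y))%E.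
have J0 : (0 <= J)%E by apply: integral_ge0 => y _; rewrite mule_ge0// lee_fin.
have IS : (\int[mu]_(y in S) om u y <= m^-1%:E * J)%E.
  have mko : measurable_fun setT (fun y => (k y)%:E * om u y)%E by exact: emeasurable_funM.
  have mi : (0 <= (m^-1)%:E)%E by rewrite lee_fin invr_ge0 ltW.
  rewrite /J -(ge0_integral_scale _ measurableT mko)//; last first.
    by move=> y; rewrite mule_ge0// lee_fin.
  rewrite [leLHS]integral_mkcond; apply: ge0_le_integral => //.
  - by move=> y _; rewrite patchE; case: ifP.
  - by apply: (measurable_restrictT _ (mS)).1; exact: measurable_funTS.
  - exact: measurable_funeM.
  - move=> y _; rewrite patchE; case: ifPn => [/set_mem/Sk ky|_]; last first.
      by rewrite mule_ge0// mule_ge0// lee_fin.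
    rewrite muleA -EFinM -[leLHS]mul1e lee_wpmul2r// lee_fin.
    by rewrite mulrC ler_pdivlMr// mul1r ltW.
have I1 : (\int[mu]_(y in T) om u y <= \int[mu]_(y in S) om u y)%E.
  by apply: ge0_subset_integral => //; exact: measurable_funTS.
have I2 : (\int[mu]_(y in T) om u (y + z)%R <= \int[mu]_(y in S) om u y)%E.
  rewrite [leRHS]integral_mkcond.
  have mp : measurable_fun setT (om u \_ (S)).
    by apply: (measurable_restrictT _ (mS)).1; exact: measurable_funTS.
  have p0 y : (0 <= (om u \_ (S)) y)%E by rewrite patchE; case: ifP.
  rewrite -(ge0_integral_shift z mp p0) [leLHS]integral_mkcond; apply: ge0_le_integral => //.
  - by move=> y _; rewrite patchE; case: ifP.
  - by apply: (measurable_restrictT _ mT).1; exact: measurable_funTS.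
  - exact: (measurableT_comp mp (measurable_shiftrV z)).
  - move=> y _; rewrite !patchE; case: ifPn => [/set_mem/TSz yz|_]; last by case: ifP.
    by rewrite mem_set.
have H : (mu T * om u z <= 4%:E * (m^-1%:E * J))%E.
  rewrite muleC -(integral_cst mu mT).
  apply: (@le_trans _ _ (\int[mu]_(y in T) (2%:E * om u (y + z)%R + 2%:E * om u y))%E).
    apply: ge0_le_integral => //.
    - by move=> y _; exact: om0.
    - by apply: measurable_funTS; apply: emeasurable_funD; exact: measurable_funeM.
    - move=> y _; have := omB mu_ (y + z) y.
      by rewrite /cst addrC addKr.
  rewrite ge0_integralD//; last 4 first.
  - by move=> y _; rewrite mule_ge0.
  - by apply: measurable_funTS; exact: measurable_funeM.
  - by move=> y _; rewrite mule_ge0.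
  - by apply: measurable_funTS; exact: measurable_funeM.
  rewrite (ge0_integral_scale _ mT mshift)// (ge0_integral_scale _ mT mom)//.
  rewrite (_ : 4%:E = 2%:E + 2%:E)%E; last by rewrite -EFinD; congr EFin; ring.
  rewrite ge0_muleDl; [|by rewrite lee_fin|by rewrite lee_fin].
  apply: leeD; apply: lee_wpmul2l.
  - by rewrite lee_fin.
  - exact: le_trans I2 IS.
  - by rewrite lee_fin.
  - exact: le_trans I1 IS.
rewrite -(@lee_pmul2l _ c%:E) ?lte_fin//.
apply: (@le_trans _ _ (mu T * om u z)%E); first by rewrite lee_wpmul2r.
apply: le_trans H _; rewrite !muleA -!EFinM lee_wpmul2r// lee_fin.
rewrite le_eqVlt; apply/orP; left; apply/eqP; field; by rewrite !gt_eqF.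
Qed.

(** Rescaling of the previous estimate: for x -> u(t x) the modulus picks up t^-n and the energy
    t^(p - 2n) with p = n + 2s, which leaves t^(2s). *)
Lemma om_translation : exists A rho : R, [/\ 0 <= A, 0 < rho &
  forall u t z, measurable_fun setT u -> 0 < t -> `|z| <= rho * t ->
   (om u z <= (A * t `^ (2 * s))%:E * \int[mu]_y ((k y)%:E * om u y))%E].
Proof.
have [A [rho [A0 rho0 H]]] := om_small_translation; exists A, rho; split => // u t z mu_ t0 zt.
have t0' : t != 0 by rewrite gt_eqF.
pose v x := u (affm t 0 x).
have mv : measurable_fun setT v by exact: (measurableT_comp mu_ (measurable_affm t 0)).
have omv y : om v y = ((t ^- n)%:E * om u (t *: y))%E.
  have m1 : measurable_fun setT (fun x : V => ((u (x + t *: y) - u x) ^+ 2)%:E).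
    apply: measurable_sq; apply: measurable_funB => //.
    exact: (measurableT_comp mu_ (measurable_shiftrV _)).
  have := @ge0_integral_affm R n t 0 _ t0' m1 (fun x => _).
  rewrite gtr0_norm// => <-; last by move=> x; rewrite lee_fin sqr_ge0.
  by apply: eq_integral => x _; rewrite /v /affm scalerDr !addr0.
have mom := measurable_om mu_.
have om0 y := om_ge0 u y.
have mko : measurable_fun setT (fun y => (k y)%:E * om u y)%E by exact: emeasurable_funM.
have ko0 y : (0 <= (k y)%:E * om u y)%E by rewrite mule_ge0// lee_fin.
pose J := (\int[mu]_y ((k y)%:E * om u y))%E.
have J0 : (0 <= J)%E by exact: integral_ge0.
have E : (\int[mu]_y ((k y)%:E * om v y) = (t ^- n * t `^ p * t ^- n)%:E * J)%E.
  pose h y := ((k y)%:E * om u y)%E.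
  have E2 : (\int[mu]_y h (affm t 0 y) = (t ^- n)%:E * \int[mu]_y h y)%E.
    by have := ge0_integral_affm 0 t0' mko ko0; rewrite gtr0_norm.
  pose g y := h (affm t 0 y).
  have mg : measurable_fun setT g by exact: (measurableT_comp mko (measurable_affm t 0)).
  have g0 y : (0 <= g y)%E by exact: ko0.
  have cc : (0 <= (t ^- n * t `^ p)%:E)%E.
    by rewrite lee_fin mulr_ge0 ?powR_ge0// invr_ge0 exprn_ge0// ltW.
  rewrite EFinM -muleA -/h -E2 -(ge0_integral_scale mu measurableT mg g0 cc).
  apply: eq_integral => y _; rewrite /g /h omv /affm addr0 jump_kernelZ//.
  rewrite muleA -EFinM muleA -EFinM; congr ((_)%:E * _)%E.
  have tp : t `^ p * t `^ (- p) = 1.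
    by rewrite -powRD ?subrr ?powRr0// (negbTE t0') implybT.
  by rewrite [RHS]mulrA -(mulrA (t ^- n)) tp mulr1 mulrC.
have vz : `|t^-1 *: z| <= rho by rewrite normrZ gtr0_norm ?invr_gt0// ler_pdivrMl// mulrC.
have := H v (t^-1 *: z) mv vz; rewrite E omv scalerA mulfV// scale1r.
have tn : 0 < t ^+ n by rewrite exprn_gt0.
move=> /(lee_wpmul2l (_ : (0 <= (t ^+ n)%:E)%E)); rewrite lee_fin (ltW tn) => /(_ isT).
rewrite muleA -EFinM mulfV ?gt_eqF// mul1e => h; apply: le_trans h _.
rewrite !muleA -!EFinM lee_wpmul2r// lee_fin.
rewrite [t `^ (n%:R + _)]powRD; last by rewrite (negbTE t0') implybT.
rewrite powR_mulrn ?(ltW t0)// le_eqVlt; apply/orP; left; apply/eqP; field.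
by rewrite gt_eqF.
Qed.

End translation_estimate.

(** * Grid cells and the finite rank estimate *)

Section cells.
Context {R : realType} {n : nat}.
Local Notation mu := (@lebesgue_rV R n).
Local Notation V := 'rV[R]_n.

(** Cubes of side r counted from the corner with all coordinates -L, half-open so that they tile
    without overlap. *)
Definition cell (L r : R) M (j : {ffun 'I_n -> 'I_M}) : set V :=
  [set x | forall i, (j i)%:R * r <= x ord0 i + L < (j i).+1%:R * r].

Variables (L r : R) (M : nat) (r0 : 0 < r).
Implicit Types j : {ffun 'I_n -> 'I_M}.

Lemma cellE j : cell L r j =
  [set x | forall i, `[(j i)%:R * r - L, (j i).+1%:R * r - L[%classic (x ord0 i)].
Proof.
by apply/seteqP; split => x /= + i => /(_ i); rewrite in_itv/= lerBlDr ltrBrDr.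
Qed.

Lemma measurable_cell j : measurable (cell L r j).
Proof.
rewrite cellE; apply: (@measurable_box _ _ (fun i =>
  `[(j i)%:R * r - L, (j i).+1%:R * r - L[%classic)) => i; exact: measurable_itv.
Qed.

Lemma lebesgue_cell j : mu (cell L r j) = (r ^+ n)%:E.
Proof.
rewrite cellE (@lebesgue_rV_box _ _ (fun i =>
  `[(j i)%:R * r - L, (j i).+1%:R * r - L[%classic)); last first.
  by move=> i; exact: measurable_itv.
rewrite (eq_bigr (fun=> r%:E)); last first.
  move=> i _; rewrite lebesgue_measure_itv/= lte_fin ltrD2r ltr_pM2r// ltr_nat ltnSn.
  by rewrite -EFinB; congr EFin; rewrite -natr1; ring.
by rewrite prod_EFin prodr_const card_ord.
Qed.

Lemma cell_inj j j' x : cell L r j x -> cell L r j' x -> j = j'.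
Proof.
move=> jx jx'; apply/ffunP => i; apply/val_inj/eqP.
have /andP[h1 h2] := jx i; have /andP[h3 h4] := jx' i.
have := le_lt_trans h1 h4; have := le_lt_trans h3 h2.
by rewrite !ltr_pM2r// !ltr_nat !ltnS eqn_leq => -> ->.
Qed.

Lemma cell_diam j x y : cell L r j x -> cell L r j y -> `|x - y| <= r.
Proof.
move=> jx jy; apply/rV_norm_leP => [|i]; first exact: ltW.
have /andP[h1 h2] := jx i; have /andP[h3 h4] := jy i.
rewrite !mxE ler_norml; move: h1 h2 h3 h4; rewrite -natr1 mulrDl mul1r => *.
by apply/andP; split; lra.
Qed.

Lemma cell_cover (x : V) : 2 * L <= M%:R * r -> (forall i, - L <= x ord0 i < L) ->
  exists j : {ffun 'I_n -> 'I_M}, cell L r j x.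
Proof.
move=> LM xL.
have lt i : (Num.truncn ((x ord0 i + L) / r) < M)%N.
  have /andP[x1 x2] := xL i; rewrite truncn_lt_nat; last first.
    by rewrite divr_ge0 ?(ltW r0)//; lra.
  by rewrite ltr_pdivrMr//; lra.
exists [ffun i => Ordinal (lt i)] => i; rewrite ffunE /=.
have /andP[x1 x2] := xL i.
have := @truncn_itv R ((x ord0 i + L) / r); rewrite divr_ge0 ?(ltW r0)//; last lra.
move=> /(_ isT) /andP[h1 h2].
by rewrite -ler_pdivlMr// -ltr_pdivrMr// h1 h2.
Qed.

End cells.

Section cell_identity.
Context {R : realType} {n : nat}.
Local Notation mu := (@lebesgue_rV R n).
Local Notation V := 'rV[R]_n.
Variables (Q : set V) (m : R) (mQ : measurable Q) (muQ : mu Q = m%:E).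
Variables (u : V -> R) (su : sqint mu u).
Let I := \int[mu]_(x in Q) u x.
Let J := \int[mu]_(x in Q) (u x) ^+ 2.

Lemma integrable_sq_on : mu.-integrable Q (fun x => ((u x) ^+ 2)%:E).
Proof.
apply: (integrableS measurableT mQ (@subsetT _ Q)).
exact: (sqint_ip su su).
Qed.

Lemma integrable_cst_on (c : R) : mu.-integrable Q (fun=> c%:E).
Proof.
apply/integrableP; split; first exact: measurable_cst.
rewrite (integral_cst mu mQ `|c|%:E).
rewrite (_ : (_ * _)%E = (`|c| * m)%:E) ?ltry//.
by rewrite EFinM; congr (_ * _)%E; exact: muQ.
Qed.

Lemma integrable_on : mu.-integrable Q (EFin \o u).
Proof.
have [mu_ _] := su.
have i1 := integrableD mQ (integrable_cst_on 1) integrable_sq_on.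
apply: (le_integrable mQ _ _ i1).
  by apply/measurable_EFinP; exact: measurable_funTS.
move=> x _ /=; rewrite lee_fin.
rewrite [leRHS]ger0_norm; last by rewrite addr_ge0// sqr_ge0.
rewrite -(real_normK (num_real (u x))); have := sqr_ge0 (`|u x| - 1).
by have := normr_ge0 (u x); rewrite !expr2; nra.
Qed.

Lemma integral_quadratic (al be ga : R) :
  (\int[mu]_(x in Q) (al + be * u x + ga * (u x) ^+ 2)%:E =
   (al * m + be * I + ga * J)%:E)%E.
Proof.
have i0 := integrable_cst_on al.
have i1 : mu.-integrable Q (fun x => (be * u x)%:E) by exact: (integrableZl mQ be integrable_on).
have i2 : mu.-integrable Q (fun x => (ga * (u x) ^+ 2)%:E).
  exact: (integrableZl mQ ga integrable_sq_on).
have i01 : mu.-integrable Q (fun x => (al + be * u x)%:E) by exact: (integrableD mQ i0 i1).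
have i012 : mu.-integrable Q (fun x => (al + be * u x + ga * (u x) ^+ 2)%:E).
  exact: (integrableD mQ i01 i2).
rewrite -[LHS](fineK (integrable_fin_num mQ i012)); congr EFin.
transitivity (\int[mu]_(x in Q) (al + be * u x + ga * (u x) ^+ 2))%R; first by [].
rewrite (RintegralD mQ i01 i2) (RintegralD mQ i0 i1).
rewrite (RintegralZl be mQ integrable_on) (RintegralZl ga mQ integrable_sq_on).
have muQ' : fine (mu Q) = m by rewrite -[RHS]/(fine m%:E); congr fine; exact: muQ.
rewrite Rintegral_cst// /I /J; congr (_ * _ + _ + _); exact: muQ'.
Qed.

(** The variance identity: on a cell, the mean oscillation of u controls its L^2 norm up to one
    linear functional, the integral over the cell. *)
Lemma cell_identity :
  (\int[mu]_(x in Q) \int[mu]_(y in Q) ((u x - u y) ^+ 2)%:E = (2 * m * J - 2 * I ^+ 2)%:E)%E.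
Proof.
transitivity (\int[mu]_(x in Q) (J + (- 2 * I) * u x + m * (u x) ^+ 2)%:E)%E.
  apply: eq_integral => x _.
  transitivity (\int[mu]_(y in Q) ((u x) ^+ 2 + (- 2 * u x) * u y + 1 * (u y) ^+ 2)%:E)%E.
    by apply: eq_integral => y _; congr EFin; ring.
  by rewrite integral_quadratic; congr EFin; ring.
by rewrite integral_quadratic; congr EFin; ring.
Qed.

End cell_identity.

Section finite_rank.
Context {R : realType} {n : nat} (s : R) (s_gt0 : 0 < s).
Local Notation mu := (@lebesgue_rV R n).
Local Notation sigma := (@sphere_measure R n).
Local Notation V := 'rV[R]_n.
Implicit Types u v w f : V -> R.

(** Two points of one cell are at distance at most r and the cells are disjoint, so the left side is
    part of the double integral over |x - y| <= r. [energy_om], applied to the indicator of the ball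
    as kernel, evaluates the latter. *)
Lemma cells_le_om (L r : R) M u : 0 < r -> measurable_fun setT u ->
  (\sum_(j : {ffun 'I_n -> 'I_M}) \int[mu]_(x in cell L r j) \int[mu]_(y in cell L r j)
      ((u x - u y) ^+ 2)%:E <= \int[mu]_(z in [set z : V | (`|z| <= r)%R]) om u z)%E.
Proof.
move=> r0 mu_.
pose K : V -> R := \1_[set z : V | `|z| <= r].
have mB := @measurable_le_ball R n r.
have mK : measurable_fun setT K by exact: measurable_indic.
have K0 z : 0 <= K z by rewrite /K indicE.
pose F (q : V * V) : \bar R := ((dif u K q) ^+ 2)%:E.
have mF : measurable_fun setT F.
  by apply: measurable_sq; exact: measurable_dif.
have F0 q : (0 <= F q)%E by rewrite lee_fin sqr_ge0.
have -> : (\int[mu]_(z in [set z : V | (`|z| <= r)%R]) om u z = \int[mu]_x \int[mu]_y F (x, y))%E.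
  have := energy_om mu_ mK K0; rewrite (fubini_tonelli1 _ mF F0) => ->.
  rewrite integral_mkcond; apply: eq_integral => z _.
  by rewrite patchE /K indicE; case: ifP => _; rewrite ?mul1e ?mul0e.
pose G (j : {ffun 'I_n -> 'I_M}) x : \bar R :=
  (\int[mu]_(y in cell L r j) ((u x - u y) ^+ 2)%:E)%E.
have mG j : measurable_fun setT (G j).
  have mF1 : measurable_fun setT (fun q : V * V =>
      ((fun y => ((u q.1 - u y) ^+ 2)%:E) \_ (cell L r j)) q.2).
    rewrite (_ : (fun q => _) = (fun q : V * V => ((u q.1 - u q.2) ^+ 2 * \1_(cell L r j) q.2)%:E)).
      apply/measurable_EFinP; apply: measurable_funM.
        apply: measurable_funX; apply: measurable_funB.
          exact: (measurableT_comp mu_ measurable_fst).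
        exact: (measurableT_comp mu_ measurable_snd).
      have mi : measurable_fun setT (\1_(cell L r j) : V -> R).
        by apply: measurable_indic; exact: measurable_cell.
      exact: (measurableT_comp mi measurable_snd).
    apply/funext => q; rewrite patchE indicE; case: ifP => _; first by rewrite mulr1.
    by rewrite mulr0.
  have F10 q : (0 <= ((fun y => ((u q.1 - u y) ^+ 2)%:E) \_ (cell L r j)) q.2)%E.
    by rewrite patchE; case: ifP => // _; rewrite lee_fin sqr_ge0.
  have := @measurable_fun_fubini_tonelli_F _ _ _ _ R mu (fun q : V * V =>
      ((fun y => ((u q.1 - u y) ^+ 2)%:E) \_ (cell L r j)) q.2) mF1 F10.
  by apply: eq_measurable_fun => x _; rewrite /G [RHS]integral_mkcond.
have G0 j x : (0 <= G j x)%E by apply: integral_ge0 => y _; rewrite lee_fin sqr_ge0.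
under eq_bigr do rewrite integral_mkcond.
have mGp j : measurable_fun setT (G j \_ (cell L r j)).
  by apply: (measurable_restrictT _ (measurable_cell L r j)).1; exact: measurable_funTS.
have G0p j x : (0 <= (G j \_ (cell L r j)) x)%E by rewrite patchE; case: ifP.
rewrite -(ge0_integral_sum mu measurableT mGp (fun j x _ => G0p j x)).
have FF0 x : (0 <= \int[mu]_y F (x, y))%E by apply: integral_ge0 => y _; exact: F0.
apply: ge0_le_integral.
- exact: measurableT.
- by move=> x _; apply: sume_ge0 => j _; exact: G0p.
- by apply: emeasurable_sum => j; exact: mGp.
- exact: (@measurable_fun_fubini_tonelli_F _ _ _ _ R mu F mF F0).
move=> x _.
have [[j jx]|nx] := pselect (exists j : {ffun 'I_n -> 'I_M}, cell L r j x); last first.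
  rewrite big1; first exact: FF0.
  by move=> j _; rewrite patchE memNset// => jx; apply: nx; exists j.
rewrite (bigD1 j)//= big1 ?adde0; last first.
  move=> i ij; rewrite patchE memNset// => ix; move: ij.
  by rewrite (cell_inj r0 ix jx) eqxx.
rewrite patchE mem_set// /G integral_mkcond.
have m1 : measurable_fun setT (fun y => ((u x - u y) ^+ 2)%:E).
  by apply: measurable_sq; apply: measurable_funB.
apply: ge0_le_integral.
- exact: measurableT.
- by move=> y _; rewrite patchE; case: ifP => // _; rewrite lee_fin sqr_ge0.
- by apply: (measurable_restrictT _ (measurable_cell L r j)).1; exact: measurable_funTS.
- exact: (measurableT_comp mF (pair1_measurable x)).
move=> y _; rewrite patchE; case: ifPn => [/set_mem jy|_]; last exact: F0.
rewrite /F (dif_sq u K0)/= /K indicE mem_set/= ?mulr1//.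
exact: (cell_diam r0 jx jy).
Qed.

Variables (a : V -> R) (ia : sigma.-integrable sphere (EFin \o a)).
Hypothesis aA2 : condA2 a.
Variables (C : set V) (aA3 : condA3 C a).
Local Notation k := (jump_kernel s a).
Variables (Omega : set V) (Ob : bounded_set Omega).

(** On cells of side r the oscillation of u is bounded by translations of size at most r, hence by
    r^(2s) times the energy up to a constant; a fine grid makes this factor smaller than [de], and
    only the finitely many cell integrals remain. *)
Lemma finite_rank_estimate (de : R) : 0 < de ->
  exists (M : nat) (Q : {ffun 'I_n -> 'I_M} -> set V) (c : R),
  [/\ 0 <= c, forall j, measurable (Q j), forall j, (mu (Q j) < +oo)%E &
   forall u, fe s a u -> {ae mu, forall x, (~` Omega) x -> u x = 0} ->
     ip mu u u <= de * energy s a u u + c * \sum_j (\int[mu]_(x in Q j) u x) ^+ 2].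
Proof.
move=> de0.
have [A [rho [A0 rho0 HA]]] := om_translation s_gt0 ia aA2 aA3.
have [B [Br HB]] := Ob.
(* Omega has radius at most |B| + 1; the extra 1 gives the strict upper inequality that half-open
   cells require. *)
pose L := `|B| + 2.
have OL x i : Omega x -> - L <= x ord0 i < L.
  move=> Ox; have xB : `|x| <= `|B| + 1.
    by apply: HB => //; rewrite (le_lt_trans (ler_norm B))// ltrDl.
  have := le_trans (rV_coord_le x i) xB; rewrite ler_norml => /andP[x1 x2].
  by rewrite /L; apply/andP; split; lra.
(* The value wanted for t^(2s). The factor 4^n comes from enclosing the ball of radius r in a box of
   side 4r, and the added 1 avoids division by zero. *)
pose th := de / (4 ^+ n * A + 1).
have th0 : 0 < th by rewrite divr_gt0// ltr_wpDl// mulr_ge0// exprn_ge0.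
pose t := th `^ ((2 * s)^-1).
have t0 : 0 < t by rewrite powR_gt0.
have ts : t `^ (2 * s) = th.
  by rewrite /t -powRrM mulVf ?powRr1 ?(ltW th0)// gt_eqF// mulr_gt0.
pose r := rho * t; have r0 : 0 < r by rewrite mulr_gt0.
pose M := (Num.truncn (2 * L / r)).+1.
have LM : 2 * L <= M%:R * r.
  by rewrite -ler_pdivrMr// ltW// truncnS_gt.
have rn : 0 < r ^+ n by rewrite exprn_gt0.
exists M, (fun j => cell L r j), (r ^+ n)^-1; split.
- by rewrite invr_ge0 ltW.
- by move=> j; exact: measurable_cell.
- by move=> j; rewrite lebesgue_cell// ltry.
move=> u fu u0; have [su _] := fu; have [mu_ _] := su.
pose I (j : {ffun 'I_n -> 'I_M}) := \int[mu]_(x in cell L r j) u x.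
pose J (j : {ffun 'I_n -> 'I_M}) := \int[mu]_(x in cell L r j) (u x) ^+ 2.
have muQ (j : {ffun 'I_n -> 'I_M}) : mu (cell L r j) = (r ^+ n)%:E by exact: lebesgue_cell.
have mQ (j : {ffun 'I_n -> 'I_M}) : measurable (cell L r j) by exact: measurable_cell.
have uJ : ip mu u u <= \sum_j J j.
  have JE j : (J j)%:E = (\int[mu]_(x in cell L r j) ((u x) ^+ 2)%:E)%E.
    by rewrite /J /Rintegral fineK//; exact: (integrable_fin_num (mQ j) (integrable_sq_on (mQ j) su)).
  rewrite -lee_fin ipE// -sumEFin (eq_bigr _ (fun j _ => JE j)).
  under [leRHS]eq_bigr do rewrite integral_mkcond.
  pose g x : \bar R := ((u x) ^+ 2)%:E.
  have mg : measurable_fun setT g by exact: measurable_sq.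
  have mp (j : {ffun 'I_n -> 'I_M}) : measurable_fun setT (g \_ (cell L r j)).
    by apply: (measurable_restrictT g (mQ j)).1; exact: measurable_funTS.
  have p0 (j : {ffun 'I_n -> 'I_M}) x : (0 <= (g \_ (cell L r j)) x)%E.
    by rewrite patchE; case: ifP => // _; rewrite lee_fin sqr_ge0.
  rewrite -(ge0_integral_sum mu measurableT mp (fun j x _ => p0 j x)).
  apply: ae_ge0_le_integral.
  - exact: measurableT.
  - by move=> x _; rewrite lee_fin sqr_ge0.
  - exact: measurable_sq.
  - by move=> x _; apply: sume_ge0 => j _; exact: p0.
  - by apply: emeasurable_sum => j; exact: mp.
  apply: filterS u0 => x ux _.
  have [Ox|Ox] := pselect (Omega x); last first.
    by rewrite ux// expr0n/=; apply: sume_ge0 => j _; exact: p0.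
  have [j jx] := cell_cover r0 LM (fun i => OL x i Ox).
  rewrite (bigD1 j)//= patchE mem_set// leeDl//; apply: sume_ge0 => i _; exact: p0.
pose E := energy s a u u.
have EE : (E%:E = \int[mu]_z ((k z)%:E * om u z))%E by exact: (energyE s_gt0 ia aA2 fu).
have omle : (\int[mu]_(z in [set z : V | (`|z| <= r)%R]) om u z <= ((4 * r) ^+ n * (A * th * E))%:E)%E.
  have mB := @measurable_le_ball R n r.
  apply: (@le_trans _ _ (\int[mu]_(z in [set z : V | (`|z| <= r)%R]) (cst (A * th * E)%:E) z)%E).
    apply: ge0_le_integral.
    - exact: mB.
    - by move=> z _; exact: om_ge0.
    - by apply: measurable_funTS; exact: measurable_om.
    - exact: measurable_cst.
    - by move=> z zr; have := HA u t z mu_ t0 zr; rewrite ts -EE -EFinM.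
  rewrite (integral_cst mu mB) [leLHS]muleC [leRHS]EFinM; apply: lee_wpmul2r.
    rewrite lee_fin mulr_ge0 ?energy_ge0// mulr_ge0//; exact: ltW.
  apply: (@le_trans _ _ (mu (obox (const_mx (- (2 * r))) (const_mx (2 * r))))).
    apply: le_measure; [exact: mem_set|by apply: mem_set; exact: measurable_obox|].
    move=> z zr i; rewrite !mxE -ltr_norml.
    by rewrite (le_lt_trans (rV_coord_le _ _))// (le_lt_trans zr)// ltr_pMl// ltr1n.
  rewrite lebesgue_obox prod_EFin lee_fin le_eqVlt; apply/orP; left; apply/eqP.
  transitivity (\prod_(i < n) (4 * r)); last by rewrite prodr_const card_ord.
  apply: eq_bigr => i _; rewrite !mxE opprK max_l; first by ring.
  by rewrite addr_ge0// mulr_ge0// ltW.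
have SJ : \sum_j (2 * r ^+ n * J j - 2 * I j ^+ 2) <= (4 * r) ^+ n * (A * th * E).
  rewrite -lee_fin -sumEFin.
  under eq_bigr do rewrite -(cell_identity (mQ _) (muQ _) su).
  exact: (le_trans (cells_le_om L M r0 mu_) omle).
move: SJ; rewrite sumrB -!mulr_sumr => SJ.
apply: (le_trans uJ).
rewrite -/E -(ler_pM2l rn) mulrDr [X in _ <= _ + X]mulrA mulfV ?gt_eqF// mul1r.
have E0 : 0 <= E by exact: energy_ge0.
have Ade : 4 ^+ n * (A * th) <= 2 * de.
  rewrite /th mulrA [_ * (_ / _)]mulrA ler_pdivrMr; last by rewrite ltr_wpDl// mulr_ge0// exprn_ge0.
  have : 0 <= 4 ^+ n * A by rewrite mulr_ge0// exprn_ge0.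
  move=> h; nra.
have : (4 * r) ^+ n * (A * th * E) <= r ^+ n * (2 * de * E).
  rewrite (_ : (4 * r) ^+ n * (A * th * E) = r ^+ n * (4 ^+ n * (A * th) * E)).
    exact: (ler_wpM2l (ltW rn) (ler_wpM2r E0 Ade)).
  by rewrite exprMn; ring.
move: SJ; rewrite -/(I _); set X := _ ^+ n * (A * th * E); set SI := \sum_j I j ^+ 2.
set SJ := \sum_j J j => h1 h2.
nra.
Qed.

End finite_rank.

(** * The fundamental lemma and antilocality *)

Section density.
Context {R : realType} {n : nat}.
Local Notation mu := (@lebesgue_rV R n).
Local Notation V := 'rV[R]_n.
Local Open Scope ereal_scope.

Section density_measure.
Variables (f : V -> \bar R) (mf : measurable_fun setT f) (f0 : forall x, 0 <= f x).

(** The proofs are arguments so that a measure structure can be attached to the definition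
    itself. *)
Definition density of measurable_fun setT f & (forall x, 0 <= f x) :=
  fun A : set V => \int[mu]_(x in A) f x.

Let density_set0 : density mf f0 set0 = 0.
Proof. exact: integral_set0. Qed.

Let density_ge0 A : 0 <= density mf f0 A.
Proof. by apply: integral_ge0 => x _; exact: f0. Qed.

HB.instance Definition _ := isMeasure.Build _ _ _ (density mf f0)
  density_set0 density_ge0 (semi_sigma_additive_nng_induced mf f0).

End density_measure.

Lemma integral_obox_unique (f g : V -> \bar R) : measurable_fun setT f -> measurable_fun setT g ->
  (forall x, 0 <= f x) -> (forall x, 0 <= g x) ->
  (forall a b, \int[mu]_(x in obox a b) f x = \int[mu]_(x in obox a b) g x) ->
  (forall a b, \int[mu]_(x in obox a b) f x < +oo) ->
  forall A, measurable A -> \int[mu]_(x in A) f x = \int[mu]_(x in A) g x.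
Proof.
move=> mf mg f0 g0 fg foo A mA.
exact: (@rV_measure_unique _ _ (density mf f0) (density mg g0) fg foo A mA).
Qed.

End density.

Section fundamental_lemma.
Context {R : realType} {n : nat}.
Local Notation mu := (@lebesgue_rV R n).
Local Notation V := 'rV[R]_n.
Implicit Types (U : set V) (G h : V -> R).

Lemma Rintegral_ip_indic (Q : set V) (u : V -> R) : \int[mu]_(x in Q) u x = ip mu u \1_Q.
Proof.
rewrite Rintegral_mkcond; apply: eq_Rintegral => x _.
by rewrite patchE indicE; case: ifP => _; rewrite ?mulr1 ?mulr0.
Qed.

Lemma sqint_indic (Q : set V) : measurable Q -> (mu Q < +oo)%E -> sqint mu (\1_Q : V -> R).
Proof.
move=> mQ Qoo; split; first exact: measurable_indic.
rewrite (eq_integral (fun x => (\1_Q x)%:E)); last first.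
  by move=> x _; rewrite indicE; case: (_ \in _); rewrite ?expr1n ?expr0n.
by rewrite integral_indic// setIT.
Qed.

(** Bumps of growing steepness converge to the indicator of the box and stay below 1, so dominated
    convergence applies. *)
Lemma integral_obox_eq0 U G a b : sqint mu G ->
  (forall m c d, 0 < m -> cbox c d `<=` U -> ip mu G (bump m c d) = 0) -> cbox a b `<=` U ->
  (\int[mu]_(x in obox a b) (G x)%:E = 0)%E.
Proof.
move=> sG HG abU; have [mG _] := sG; have mB := measurable_obox a b.
have muB : mu (obox a b) = (fine (mu (obox a b)))%:E.
  by rewrite fineK// ge0_fin_numE ?measure_ge0//; exact: lebesgue_obox_lty.
have iG := integrable_on mB muB sG.
pose f_ k x := (G x * bump k.+1%:R a b x)%:E.
have mb k : measurable_fun setT (bump k a b).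
  by apply: rV_continuous_measurable; apply: elem_continuous; exact: elem_bump.
have mf_ k : measurable_fun (obox a b) (f_ k).
  by apply: measurable_funTS; apply/measurable_EFinP; exact: measurable_funM.
have mf : measurable_fun (obox a b) (EFin \o G).
  by apply: measurable_funTS; exact/measurable_EFinP.
have f_f : {ae mu, forall x, obox a b x -> f_ ^~ x @ \oo --> (EFin \o G) x}.
  apply: aeW => x abx; apply/cvg_EFin; first exact: nearW.
  have -> : fine \o f_ ^~ x = (fun k => G x * bump k.+1%:R a b x) by [].
  rewrite -[X in _ --> X]mulr1; apply: cvgM; first exact: cvg_cst.
  have := @bump_cvg R n a b x; rewrite indicE mem_set// => Hb.
  by move: Hb; rewrite -(cvg_shiftS (fun k => bump k%:R a b x)).
have ig : mu.-integrable (obox a b) (fun x => `|(G x)%:E|%E) by exact: integrable_abse.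
have f_g : {ae mu, forall x k, obox a b x -> (`|f_ k x| <= `|(G x)%:E|)%E}.
  apply: aeW => x k _; rewrite /f_ /= lee_fin normrM ler_piMr//.
  by rewrite ger0_norm ?bump_ge0// bump_le1.
have [_ _] := dominated_convergence mB mf_ mf f_f ig f_g.
have -> : [sequence (\int[mu]_(x in obox a b) f_ k x)%E]_k = cst 0%E.
  apply/funext => k /=.
  have sb : sqint mu (bump k.+1%:R a b) := Cc_sqint (bump_Cc (ltr0Sn _ _) abU).
  have ib := sqint_ip sG sb.
  have I0 : (\int[mu]_x (G x * bump k.+1%:R a b x)%:E = 0)%E.
    rewrite -[LHS](fineK (integrable_fin_num measurableT ib)); congr EFin.
    exact: (HG k.+1%:R a b (ltr0Sn _ _) abU).
  transitivity (\int[mu]_x (G x * bump k.+1%:R a b x)%:E)%E; last exact: I0.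
  rewrite integral_mkcond; apply: eq_integral => x _.
  rewrite patchE; case: ifPn => // /negP xab; rewrite (_ : bump _ _ _ _ = 0) ?mulr0//.
  by apply/eqP; apply: contra_notT xab => xb; apply: mem_set; exact: (bump_neq0 (ltr0Sn _ k) xb).
by move=> H; apply/esym; apply: (cvg_unique _ (cvg_cst _) H).
Qed.

(** A Lindelof argument: the rational boxes on which P holds almost everywhere cover U. They are
    enumerated by [unpickle], so that a countable union of null sets is discarded. *)
Lemma ae_local U (P : V -> Prop) : open U ->
  (forall x, U x -> exists N, [/\ open N, N x & {ae mu, forall y, N y -> P y}]) ->
  {ae mu, forall x, U x -> P x}.
Proof.
move=> oU HU.
pose good (p : 'rV[rat]_n * 'rV[rat]_n) :=
  {ae mu, forall y : V, obox (rVrat p.1) (rVrat p.2) y -> P y}.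
suff : {ae mu, forall (x : V) (k : nat) p, unpickle k = Some p -> good p ->
   obox (rVrat p.1) (rVrat p.2) x -> P x}.
  apply: filterS => x Hx Ux; have [N [oN + HN]] := HU x Ux.
  rewrite (open_rat_boxes oN) => -[p [e e0 eN] px].
  apply: (Hx (pickle p) p) => //; first exact: pickleK.
  apply: filterS HN => y Hy yp; apply: Hy; apply: eN => i.
  have := yp i; rewrite !mxE => /andP[h1 h2].
  by rewrite ltrBlDr (lt_trans h1) ?ltrDl//= (lt_trans h2)// ltrDl.
apply: ae_foralln => k; case E : (unpickle k) => [p|]; last exact: aeW.
have [Up|Up] := pselect (good p); last by apply: aeW => x _ [<-].
by apply: filterS Up => x Hx _ [<-].
Qed.

Lemma fundamental_lemma U G : open U -> sqint mu G ->
  (forall m c d, 0 < m -> cbox c d `<=` U -> ip mu G (bump m c d) = 0) ->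
  {ae mu, forall x, U x -> G x = 0}.
Proof.
move=> oU sG HG; have [mG _] := sG.
apply: (ae_local oU) => x Ux.
have [A [B [xQ QU]]] : exists A B : V, obox A B x /\ cbox A B `<=` U.
  have [e e0 eU] := nbhs_obox (open_nbhs_nbhs (conj oU Ux)).
  exists (x - const_mx (e / 2)), (x + const_mx (e / 2)); split.
    by apply: obox_center; exact: divr_gt0.
  move=> z zAB; apply: eU => i; have := zAB i; rewrite !mxE => /andP[h1 h2].
  by apply/andP; split; lra.
pose Q := obox A B; have mQ : measurable Q by exact: measurable_obox.
exists Q; split; [exact: obox_open|exact: xQ|].
have s1 : sqint mu (\1_Q : V -> R) by apply: sqint_indic; last exact: lebesgue_obox_lty.
pose G1 x := G x * \1_Q x.
have iG1 : mu.-integrable setT (fun x => (G1 x)%:E) by exact: sqint_ip.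
have iaG1 : mu.-integrable setT (fun x => `|(G1 x)%:E|%E) by exact: integrable_abse.
have mG1 : measurable_fun setT G1 by apply: measurable_funM => //; exact: measurable_indic.
have G10 a b : (\int[mu]_(x in obox a b) (G1 x)%:E = 0)%E.
  rewrite -(@integral_obox_eq0 U G (\row_i Num.max (a ord0 i) (A ord0 i))
    (\row_i Num.min (b ord0 i) (B ord0 i)) sG HG).
    rewrite -oboxI integral_mkcondr; apply: eq_integral => z _.
    by rewrite patchE /G1 indicE -/Q; case: ifP; rewrite ?mulr1 ?mulr0.
  move=> z xab; apply: QU => i; have := xab i; rewrite !mxE ge_max le_min.
  by move=> /andP[/andP[_ ->] /andP[_ ->]].
(* G1 is signed, whereas uniqueness is available for measures. The two non-negative functions |G1| +
   G1 and |G1| - G1 have equal integrals over boxes, hence agree almost everywhere, which means G1 =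
   0. *)
pose g1 x : \bar R := (`|G1 x| + G1 x)%:E.
pose g2 x : \bar R := (`|G1 x| - G1 x)%:E.
have mg1 : measurable_fun setT g1.
  by apply/measurable_EFinP; apply: measurable_funD => //; exact: measurableT_comp.
have mg2 : measurable_fun setT g2.
  by apply/measurable_EFinP; apply: measurable_funB => //; exact: measurableT_comp.
have g10 z : (0 <= g1 z)%E.
  by rewrite lee_fin -lerBlDr sub0r -normrN ler_norm.
have g20 z : (0 <= g2 z)%E by rewrite lee_fin subr_ge0 ler_norm.
have ig1 : mu.-integrable setT g1 by exact: (integrableD measurableT iaG1 iG1).
have G12 a b : (\int[mu]_(x in obox a b) g1 x = \int[mu]_(x in obox a b) g2 x)%E.
  have mB := measurable_obox a b.
  have i1 := integrableS measurableT mB (@subsetT _ _) iaG1.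
  have i2 := integrableS measurableT mB (@subsetT _ _) iG1.
  transitivity (\int[mu]_(x in obox a b) `|(G1 x)%:E| + \int[mu]_(x in obox a b) (G1 x)%:E)%E.
    by rewrite -(integralD mB i1 i2).
  transitivity (\int[mu]_(x in obox a b) `|(G1 x)%:E| - \int[mu]_(x in obox a b) (G1 x)%:E)%E.
    by rewrite G10 sube0 adde0.
  by rewrite -(integralB mB i1 i2).
have foo a b : (\int[mu]_(x in obox a b) g1 x < +oo)%E.
  have mB := measurable_obox a b.
  have i1 := integrableS measurableT mB (@subsetT _ _) ig1.
  by have := integrable_fin_num mB i1; rewrite ge0_fin_numE//; apply: integral_ge0.
have key := integral_obox_unique mg1 mg2 g10 g20 G12 foo.
have := integral_ae_eq measurableT ig1 mg2 (fun E _ mE => key E mE).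
apply: filterS => z /(_ I) [g12] Qx.
have : G1 z = 0 by move: g12; set t := `|_|; lra.
by rewrite /G1 indicE mem_set// mulr1.
Qed.

End fundamental_lemma.

Lemma Rintegral_oppD d (T : measurableType d) (R : realType)
    (m : {measure set T -> \bar R}) (f g : T -> R) :
  m.-integrable setT (EFin \o f) -> m.-integrable setT (EFin \o g) ->
  \int[m]_x (- (f x + g x)) = - (\int[m]_x f x + \int[m]_x g x).
Proof.
move=> fi gi; have fgi := integrableD measurableT fi gi.
rewrite -(RintegralD measurableT fi gi) -[RHS]mulN1r -(RintegralZl (-1) measurableT fgi).
by apply: eq_Rintegral => x _; rewrite mulN1r.
Qed.

(** * Substitutions in double integrals *)

Section shear.
Context {R : realType} {n : nat}.
Local Notation mu := (@lebesgue_rV R n).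
Local Notation V := 'rV[R]_n.
Variables (F : V * V -> R) (iF : (mu \x mu)%E.-integrable setT (EFin \o F)).

Let mF : measurable_fun setT F.
Proof. by have /integrableP[+ _] := iF; move/measurable_EFinP. Qed.

Let mEF : measurable_fun setT (EFin \o F).
Proof. exact/measurable_EFinP. Qed.

Section fiberwise.
Variable T : V -> V -> V.
Hypothesis mT : measurable_fun setT (fun p : V * V => T p.1 p.2).
Hypothesis hT : forall y (f : V -> \bar R), measurable_fun setT f ->
  (forall z, 0 <= f z)%E -> (\int[mu]_z f (T y z) = \int[mu]_z f z)%E.

Let G (p : V * V) : R := F (p.1, T p.1 p.2).

Let mG : measurable_fun setT G.
Proof. exact: (measurableT_comp mF (measurable_fun_pair measurable_fst mT)). Qed.

Lemma fiber_integral y (f : V -> \bar R) : measurable_fun setT f ->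
  (\int[mu]_z f (T y z) = \int[mu]_z f z)%E.
Proof.
move=> mf; rewrite integralE [RHS]integralE.
congr (_ - _)%E.
  rewrite -[RHS](hT y (measurable_funepos mf) (funepos_ge0 f)).
  by apply: eq_integral => z _; rewrite !funeposE.
rewrite -[RHS](hT y (measurable_funeneg mf) (funeneg_ge0 f)).
by apply: eq_integral => z _; rewrite !funenegE.
Qed.

Lemma shear_integrable : (mu \x mu)%E.-integrable setT (EFin \o G).
Proof.
apply/integrable12ltyP; first exact/measurable_EFinP.
apply: le_lt_trans ((integrable12ltyP mu mu mEF).1 iF).
rewrite le_eqVlt; apply/orP; left; apply/eqP.
apply: eq_integral => x _.
have mFx : measurable_fun setT (fun y => `|(F (x, y))%:E|%E).
  apply: measurableT_comp => //; apply/measurable_EFinP.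
  exact: (measurableT_comp mF (pair1_measurable x)).
exact: (hT x mFx (fun=> abse_ge0 _)).
Qed.

(** The substitution acts on z for fixed y, but the left side integrates in y first; Fubini for the
    sheared function exchanges the order. *)
Lemma shear_integral : (\int[mu]_z \int[mu]_y (G (y, z))%:E =
  \int[(mu \x mu)%E]_p (F p)%:E)%E.
Proof.
rewrite -(Fubini shear_integrable) -(integral12_prod_meas1 iF).
apply: eq_integral => y _; apply: (fiber_integral y (f := fun z => (F (y, z))%:E)).
by apply/measurable_EFinP; exact: (measurableT_comp mF (pair1_measurable y)).
Qed.

End fiberwise.

Lemma swap_integrable : (mu \x mu)%E.-integrable setT (fun p => (F (p.2, p.1))%:E).
Proof.
have mF' : measurable_fun setT (fun p : V * V => (F (p.2, p.1))%:E).
  apply/measurable_EFinP.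
  exact: (measurableT_comp mF (measurable_fun_pair measurable_snd measurable_fst)).
apply/(integrable12ltyP mu mu mF').
exact: ((integrable21ltyP mu mu mEF).1 iF).
Qed.

Lemma swap_integral : \int[(mu \x mu)%E]_p F (p.2, p.1) = \int[(mu \x mu)%E]_p F p.
Proof.
rewrite /Rintegral; congr fine.
by rewrite -(integral12_prod_meas1 swap_integrable) -(integral21_prod_meas1 iF).
Qed.

Lemma Rintegral_antisym : \int[(mu \x mu)%E]_p (- (F p + F (p.2, p.1))) =
  - 2 * \int[(mu \x mu)%E]_p F p.
Proof.
have := Rintegral_oppD iF swap_integrable; rewrite swap_integral => ->.
by rewrite mulNr mulr_natl mulr2n.
Qed.

End shear.

(** * Antilocality for functions of finite energy *)

Section antilocality.
Context {R : realType} {n : nat} (s : R) (n_gt0 : (0 < n)%N) (s_gt0 : 0 < s) (s_lt1 : s < 1).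
Local Notation mu := (@lebesgue_rV R n).
Local Notation sigma := (@sphere_measure R n).
Local Notation V := 'rV[R]_n.
Implicit Types u v w f h : V -> R.
Variables (a : V -> R) (ia : sigma.-integrable sphere (EFin \o a)).
Hypothesis aA2 : condA2 a.
Local Notation k := (jump_kernel s a).
Local Notation fe := (fe s a).
Local Notation energy := (energy s a).

Section disjoint_supports.
Variables (w h : V -> R) (fw : fe w) (fh : fe h) (D : set V) (mD : measurable D).
Hypotheses (w0 : forall x, ~ D x -> w x = 0) (h0 : forall x, D x -> h x = 0).
Let F (p : V * V) := w p.1 * h p.2 * k (p.1 - p.2).

Let difdif p : dif w k p * dif h k p = - F p - F (p.2, p.1).
Proof.
rewrite /dif mulrACA -expr2 sqr_sqrtr; last exact: (jump_kernel_ge0 s_gt0 aA2).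
rewrite /F /= -(jump_kernelN s aA2 (p.2 - p.1)) opprB.
have [E1 E2] : w p.1 * h p.1 = 0 /\ w p.2 * h p.2 = 0.
  by split; [have [Dp|Dp] := pselect (D p.1)|have [Dp|Dp] := pselect (D p.2)];
     rewrite ?(h0 Dp) ?(w0 Dp) ?mulr0 ?mul0r.
transitivity ((w p.1 * h p.1 + w p.2 * h p.2 - w p.1 * h p.2 - w p.2 * h p.1) * k (p.1 - p.2)).
  by ring.
by rewrite E1 E2; ring.
Qed.

(** Only the product of the two [dif] is known to be integrable. On D times its complement the
    swapped term vanishes and this product is -F; everywhere else F is 0. Hence the factor [g]. *)
Lemma disjoint_integrable : (mu \x mu)%E.-integrable setT (EFin \o F).
Proof.
have [[_ dw] [_ dh]] := (fw, fh).
have := sqint_ip dw dh.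
pose g (p : V * V) : R := - \1_(D `*` ~` D) p.
have mg : measurable_fun setT g.
  apply: measurableT_comp => //; apply: measurable_indic.
  by apply: measurableX => //; exact: measurableC.
have g1 p : `|g p| <= 1 by rewrite /g normrN indicE; case: (_ \in _); rewrite ?normr1 ?normr0.
move=> /integrable_mul_bounded -/(_ g 1 mg g1).
rewrite (_ : _ \* _ = F)//; apply/funext => p; rewrite /g /= difdif indicE.
have [Dx|Dx] := pselect (D p.1); last first.
  rewrite memNset => [|[//]]; rewrite oppr0 mulr0 /F w0// !mul0r//.
have [Dy|Dy] := pselect (D p.2).
  by rewrite memNset => [|[_]//]; rewrite oppr0 mulr0 /F h0// mulr0 mul0r.
by rewrite mem_set//= /F /= (w0 Dy) !mul0r subr0 mulrNN mulr1.
Qed.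

Lemma energy_disjoint : energy w h = - 2 * \int[(mu \x mu)%E]_p F p.
Proof.
rewrite -(Rintegral_antisym disjoint_integrable).
by apply: eq_Rintegral => p _; rewrite difdif opprD.
Qed.

End disjoint_supports.

(** As the convolution vanishes at x, only its values at x + z and x - z contribute to L(D). Each
    contribution is the given double integral after p.2 = y - z, respectively p.2 = y + z, the
    second by evenness of the kernel; integrability on the product justifies the splitting. *)
Lemma LD_conv_eq0 U w f x : mu.-integrable setT (EFin \o w) -> Cc_smooth U f ->
  conv w f x = 0 ->
  (mu \x mu)%E.-integrable setT (fun p : V * V => (w p.1 * f (x - p.2) * k (p.1 - p.2))%:E) ->
  \int[(mu \x mu)%E]_(p in setT) (w p.1 * f (x - p.2) * k (p.1 - p.2)) = 0 ->
  LD s a (conv w f) x = 0.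
Proof.
move=> iw Cf c0 iF F0.
have F0' : (\int[(mu \x mu)%E]_p (w p.1 * f (x - p.2) * k (p.1 - p.2))%:E = 0)%E.
  by rewrite -[LHS](fineK (integrable_fin_num measurableT iF)); congr EFin; exact: F0.
have key (T : V -> V -> V) (r : V -> V) :
    measurable_fun setT (fun p : V * V => T p.1 p.2) ->
    (forall y (g : V -> \bar R), measurable_fun setT g ->
      (forall z, 0 <= g z)%E -> (\int[mu]_z g (T y z) = \int[mu]_z g z)%E) ->
    (forall y z, x - T y z = r z - y) -> (forall y z, k (y - T y z) = k z) ->
    mu.-integrable setT (fun z => (conv w f (r z) * k z)%:E) /\
    \int[mu]_z (conv w f (r z) * k z) = 0.
  move=> mT hT xT kT.
  have E z : (\int[mu]_y (w y * f (x - T y z) * k (y - T y z))%:E = (conv w f (r z) * k z)%:E)%E.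
    rewrite (eq_integral (fun y => (w y * f (r z - y) * k z)%:E)); last first.
      by move=> y _; rewrite xT kT.
    have i1 := conv_integrable iw (r z) Cf.
    have i1k := integrableZr measurableT (k z) i1.
    rewrite -[LHS](fineK (integrable_fin_num measurableT i1k)); congr EFin.
    exact: (RintegralZr (k z) measurableT i1).
  have i2 := integrable_fubini_F (swap_integrable (shear_integrable iF mT hT)).
  have := shear_integral iF mT hT.
  rewrite /= F0' => I0; split.
    by apply: eq_integrable i2; [exact: measurableT|move=> z _; exact: E].
  rewrite /Rintegral -[RHS]/(fine 0%E) -I0; congr fine.
  by apply: eq_integral => z _; rewrite E.
have [i1 I1] : mu.-integrable setT (fun z => (conv w f (x + z) * k z)%:E) /\
    \int[mu]_z (conv w f (x + z) * k z) = 0.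
  apply: (key (fun y z => y - z)).
  - exact: measurable_subrV.
  - by move=> y g; exact: ge0_integral_reflect.
  - by move=> y z; rewrite opprB addrA.
  - by move=> y z; rewrite opprB addrC subrK.
have [i2 I2] : mu.-integrable setT (fun z => (conv w f (x - z) * k z)%:E) /\
    \int[mu]_z (conv w f (x - z) * k z) = 0.
  apply: (key (fun y z => y + z)).
  - exact: measurable_addrV.
  - move=> y g mg g0; rewrite -[RHS](ge0_integral_shift y mg g0).
    by apply: eq_integral => z _; rewrite addrC.
  - by move=> y z; rewrite opprD addrA addrAC.
  - by move=> y z; rewrite opprD addrA subrr sub0r (jump_kernelN s aA2).
transitivity (\int[mu]_(z in setT)
    (- (conv w f (x + z) * k z + conv w f (x - z) * k z))).
  by apply: eq_Rintegral => z _; rewrite c0; ring.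
rewrite (@Rintegral_oppD _ _ _ _ (fun z => conv w f (x + z) * k z)
  (fun z => conv w f (x - z) * k z) i1 i2).
by rewrite I1 I2 addr0 oppr0.
Qed.

Lemma dcone_open C : open C -> open (dcone C : set V).
Proof.
move=> oC; apply: openU => //.
rewrite (_ : [set _ | _ in _] = (fun x : V => - x) @^-1` C).
  by apply: open_comp => // x _; exact: (@oppr_continuous R V).
apply/seteqP; split => [_ [x Cx <-]|x Cx] /=; first by rewrite opprK.
by exists (- x) => //; rewrite opprK.
Qed.

Lemma bump_reflect (m : R) (r x y : V) : bump m (- r) r (x - y) = bump m (x - r) (x + r) y.
Proof.
rewrite /bump; apply: eq_bigr => i _; rewrite mulrC !mxE.
by congr (psi 1 (m * _) * psi 1 (m * _)); ring.
Qed.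

Lemma energy_antilocal (C Omega W : set V) w :
  open C -> antilocal s a C -> open Omega -> bounded_set Omega -> open W ->
  (forall x, W x -> ~ Omega x) -> Omega `<=` cone_nbhd C W ->
  fe w -> {ae mu, forall x, (~` Omega) x -> w x = 0} ->
  (forall h, Cc_smooth W h -> energy w h = 0) ->
  {ae mu, forall x, w x = 0}.
Proof.
move=> oC aC oO [B [Br HB]] oW WO OW fw w_off Ew.
have mO : measurable Omega := rV_open_measurable oO.
(* A version of w that vanishes at every point off Omega, as the computation for disjoint supports
   is pointwise. *)
pose v : V -> R := w \_ Omega.
have v_off x : ~ Omega x -> v x = 0 by move=> Ox; rewrite /v patchE memNset.
have [[mw w2] [mdw dw2]] := fw.
have mv : measurable_fun setT v.
  by apply: (measurable_restrictT _ mO).1; exact: measurable_funTS.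
have wv : {ae mu, forall x, w x = v x}.
  apply: filterS w_off => x Hx; rewrite /v patchE; case: ifPn => // /negP xO.
  by apply: Hx => Ox; apply: xO; exact: mem_set.
have k0 := jump_kernel_ge0 s_gt0 aA2.
have mk : measurable_fun setT k := measurable_jump_kernel s_gt0 ia.
have dwv : {ae (mu \x mu)%E, forall p, dif w k p = dif v k p}.
  by have := ae_prod wv; apply: filterS => p [p1 p2]; rewrite /dif p1 p2.
have fv : fe v.
  split; split => //.
  - apply: le_lt_trans w2; rewrite le_eqVlt; apply/orP; left; apply/eqP.
    apply: ae_eq_integral => //; try exact: measurable_sq.
    by apply: filterS wv => x -> .
  - exact: measurable_dif.
  - apply: le_lt_trans dw2; rewrite le_eqVlt; apply/orP; left; apply/eqP.
    apply: ae_eq_integral => //; try by apply: measurable_sq => //; exact: measurable_dif.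
    by apply: filterS dwv => p ->.
have Ev h : Cc_smooth W h -> energy v h = 0.
  move=> Ch; have [_ [mdh _]] := Cc_fe n_gt0 s_gt0 s_lt1 ia aA2 Ch.
  rewrite -[RHS](Ew h Ch); apply/esym; apply: ip_ae => //; exact: measurable_dif.
suff v0 : {ae mu, forall x, Omega x -> v x = 0}.
  apply: filterS2 wv v0 => x -> Hx; have [Ox|Ox] := pselect (Omega x); first exact: Hx.
  exact: v_off.
have OB x : Omega x -> `|x| <= `|B| + 1.
  by apply: HB => //; rewrite (le_lt_trans (ler_norm B))// ltrDl.
have [sv _] := fv.
have iv : mu.-integrable setT (EFin \o v).
  have lO : (mu Omega < +oo)%E by exact: (bounded_rV_lty mO OB).
  have muO : mu Omega = (fine (mu Omega))%:E by rewrite fineK// ge0_fin_numE.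
  have := integrable_on mO muO sv.
  rewrite integrable_mkcond//; apply: eq_integrable => // x _.
  by rewrite patchE; case: ifPn => // /negP xO; rewrite /= v_off// => Ox; apply: xO; exact: mem_set.
apply: (ae_local oO) => x Ox.
have [y Wy [t Ct yt]] := OW x Ox.
have [d d0 dC] : exists2 d : R, 0 < d & obox (t - const_mx d) (t + const_mx d) `<=` dcone C.
  by apply: nbhs_obox; apply: open_nbhs_nbhs; split => //; exact: dcone_open.
have [e e0 eW] := nbhs_obox (open_nbhs_nbhs (conj oW Wy)).
(* The bound by d keeps the centres of the tested boxes in the cone through y. The bound by e/4
   keeps their half-sides small enough for the same box, recentred within e/2 of y, to lie in W. *)
pose d' := Num.min d (e / 4).
have d'0 : 0 < d' by rewrite lt_min d0 divr_gt0.
pose N := obox (x - const_mx d') (x + const_mx d').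
exists N; split; [exact: obox_open|exact: obox_center|].
apply: fundamental_lemma; [exact: obox_open|exact: sv|].
move=> m b c m0 bcN.
have [abc|abc] := pselect (forall i, b ord0 i < c ord0 i); last first.
  rewrite (_ : bump m b c = fun=> 0).
    by rewrite /ip; under eq_Rintegral do rewrite mulr0; rewrite Rintegral_cst// mul0r.
  apply/funext => z; apply/eqP; apply: contra_notT abc => bz i.
  by have /andP[h1 h2] := bump_neq0 m0 bz i; exact: lt_trans h1 h2.
(* Half-sides and centre of the box. Its bump is the reflection through o of a bump centred at 0, so
   testing against it is evaluating a convolution at o. *)
pose r : V := (2^-1 : R) *: (c - b); pose o : V := (2^-1 : R) *: (c + b).
have rE i : r ord0 i = (c ord0 i - b ord0 i) / 2 by rewrite !mxE mulrC.
have oE i : o ord0 i = (c ord0 i + b ord0 i) / 2 by rewrite !mxE mulrC.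
have bE : b = o - r by apply/rowP => i; rewrite !mxE; field.
have cE : c = o + r by apply/rowP => i; rewrite !mxE; field.
have bN : N b by apply: bcN => i; rewrite lexx ltW.
have cN : N c by apply: bcN => i; rewrite lexx ltW.
have oN : N o.
  by apply: bcN => i; rewrite oE; have := abc i; move=> ?; apply/andP; split; lra.
have d'e : d' <= e / 4 by rewrite ge_min lexx orbT.
have d'd : d' <= d by rewrite ge_min lexx.
clearbody d'; clearbody r o.
have r_e i : 0 < r ord0 i <= e / 4.
  rewrite rE; have := abc i; have := bN i; have := cN i; rewrite !mxE.
  by move=> /andP[? ?] /andP[? ?] ?; apply/andP; split; lra.
pose rho := bump m (- r) r : V -> R.
pose U := obox (y - const_mx (e / 2)) (y + const_mx (e / 2)).
have Crho : Cc_smooth setT rho by exact: bump_Cc.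
have bW z : U z -> cbox (z - r) (z + r) `<=` W.
  move=> Uz q zq; apply: eW => i; have := zq i; have := Uz i; have := r_e i; rewrite !mxE.
  by move=> /andP[? ?] /andP[? ?] /andP[? ?]; apply/andP; split; lra.
have v_conv z : conv v rho z = ip mu v (bump m (z - r) (z + r)).
  by apply: eq_Rintegral => q _; rewrite /rho bump_reflect.
(* Near y the recentred bump is a test function in W: it misses Omega, which makes the convolution
   vanish, and its energy pairing with v is 0, which makes L(D) of the convolution vanish. *)
have H : forall z, cone_nbhd C U z -> conv v rho z = 0.
  apply: aC.
  - apply: (conv_Cc iv (r := `|B| + 1) _ Crho) => z Bz; apply: v_off => /OB.
    by rewrite leNgt Bz.
  - exact: obox_open.
  - by exists y; apply: obox_center; exact: divr_gt0.
  move=> z Uz.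
  have Cb : Cc_smooth W (bump m (z - r) (z + r)) by apply: bump_Cc => //; exact: bW.
  have b0 q : Omega q -> bump m (z - r) (z + r) q = 0.
    move=> Oq; apply/eqP; apply: contraPT Oq => bq; apply: WO; apply: (bW z Uz).
    by apply: obox_cbox; exact: bump_neq0 bq.
  have c0 : conv v rho z = 0.
    transitivity (\int[mu]_(q in setT) (cst 0 q : R)); last by rewrite Rintegral_cst// mul0r.
    rewrite v_conv; apply: eq_Rintegral => q _.
    have [Oq|Oq] := pselect (Omega q); first by rewrite b0// mulr0.
    by rewrite v_off// mul0r.
  have fb := Cc_fe n_gt0 s_gt0 s_lt1 ia aA2 Cb.
  split => //; apply: (LD_conv_eq0 iv Crho c0).
    have := disjoint_integrable fv fb mO v_off b0.
    by apply: eq_integrable => // p _; rewrite /= /rho bump_reflect.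
  have := energy_disjoint fv fb mO v_off b0; rewrite Ev// => /esym/eqP.
  rewrite mulf_eq0 oppr_eq0 pnatr_eq0 /= => /eqP <-.
  by apply: eq_Rintegral => p _; rewrite /rho bump_reflect.
rewrite bE cE -v_conv; apply: H.
exists y; first by apply: obox_center; exact: divr_gt0.
exists (o - y); last by rewrite addrC subrK.
apply: dC => i; have := oN i; rewrite -yt !mxE => /andP[? ?]; apply/andP; split; lra.
Qed.

End antilocality.

(** * Forms that are coercive up to finite rank *)

Section projection.
Context {R : realType} {T : lmodType R}.
Implicit Types (u v w y : T) (t : R).

(** Serves both for Cauchy-Schwarz and for turning near-minimality of a distance into
    near-orthogonality, including when the leading coefficient is 0. *)
Lemma discriminant_le0 (al be ga : R) : 0 <= ga ->
  (forall t, 0 <= al + 2 * t * be + t ^+ 2 * ga) -> be ^+ 2 <= al * ga.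
Proof.
move=> ga0 H; have al0 : 0 <= al by have := H 0; rewrite !expr2 !mulr0 !mul0r !addr0.
have [gaP|gaN] := ltP 0 ga.
  have := H (- be / ga); set t := - be / ga => Ht.
  have tga : t * ga = - be by rewrite /t mulfVK// gt_eqF.
  have : 0 <= (al + 2 * t * be + t ^+ 2 * ga) * ga by rewrite mulr_ge0// ltW.
  have -> : (al + 2 * t * be + t ^+ 2 * ga) * ga = al * ga + 2 * (t * ga) * be + (t * ga) ^+ 2.
    by ring.
  by rewrite tga; nra.
have ga_0 : ga = 0 by apply/eqP; rewrite eq_le gaN.
rewrite ga_0 mulr0; have [->|be0] := eqVneq be 0; first by rewrite expr0n.
have := H (- (al + 1) / (2 * be)).
have -> : 2 * (- (al + 1) / (2 * be)) * be = - (al + 1) by field.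
by rewrite ga_0; lra.
Qed.

Variables (X Y : T -> Prop) (b : T -> T -> R) (N : T -> R).
Hypotheses (XD : forall u v, X u -> X v -> X (u + v)) (XZ : forall t u, X u -> X (t *: u)).
Hypotheses (YX : forall u, Y u -> X u) (Y0 : Y 0).
Hypotheses (YD : forall u v, Y u -> Y v -> Y (u + v)) (YZ : forall t u, Y u -> Y (t *: u)).
Hypothesis bC : forall u v, b u v = b v u.
Hypothesis bD : forall u v w, X u -> X v -> X w -> b (u + v) w = b u w + b v w.
Hypothesis bZ : forall t u w, X u -> X w -> b (t *: u) w = t * b u w.

Let XB u v : X u -> X v -> X (u - v).
Proof. by move=> Xu Xv; rewrite -scaleN1r; apply: XD => //; exact: XZ. Qed.

Lemma form_line u w t : X u -> X w ->
  b (u + t *: w) (u + t *: w) = b u u + 2 * t * b u w + t ^+ 2 * b w w.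
Proof.
move=> Xu Xw; have Xtw := XZ t Xw; have Xutw := XD Xu Xtw.
rewrite bD// bZ// !(bC _ (u + t *: w)) !bD// !bZ// (bC w u); ring.
Qed.

Section linear_combinations.
Variables (m : nat) (F : 'I_m -> T) (XF : forall j, X (F j)) (c : 'I_m -> R).

Lemma space_sum : X 0 -> X (\sum_j c j *: F j).
Proof. by move=> X0; apply: big_ind => // j _; exact: XZ. Qed.

Lemma functional_sum (l : T -> R) : l 0 = 0 -> X 0 ->
  (forall u v, X u -> X v -> l (u + v) = l u + l v) ->
  (forall t u, X u -> l (t *: u) = t * l u) ->
  l (\sum_j c j *: F j) = \sum_j c j * l (F j).
Proof.
move=> l0 X0 lD lZ.
suff : X (\sum_j c j *: F j) /\ l (\sum_j c j *: F j) = \sum_j c j * l (F j) by case.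
apply: (big_ind2 (fun u r => X u /\ l u = r)) => [//|u r v r' [Xu <-] [Xv <-]|j _].
  by split; [exact: XD|exact: lD].
by split; [exact: XZ|exact: lZ].
Qed.

End linear_combinations.

Section orthogonal_projection.
Variables (c K : R) (c0 : 0 < c) (N0 : forall u, 0 <= N u).
Hypotheses (b_ge : forall u, X u -> c * N u <= b u u) (b_le : forall u, X u -> b u u <= K * N u).
Hypothesis Y_complete : forall y : nat -> T, (forall j, Y (y j)) ->
  (forall e, 0 < e -> exists M, forall i j, (M <= i)%N -> (M <= j)%N -> N (y i - y j) < e) ->
  exists2 p, Y p & forall e, 0 < e -> exists M, forall i, (M <= i)%N -> N (y i - p) < e.

Let b_ge0 u : X u -> 0 <= b u u.
Proof. by move=> Xu; apply: le_trans (b_ge Xu); rewrite mulr_ge0// ltW. Qed.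

(** A minimising sequence is Cauchy by the parallelogram identity. N plays the role of a squared
    norm comparable to b, and completeness is only asked of Y. *)
Lemma orthogonal_projection v : X v -> exists2 p, Y p & forall w, Y w -> b (v - p) w = 0.
Proof.
move=> Xv.
pose A : set R := [set b (v - y) (v - y) | y in Y].
have Ainf : has_inf A.
  split; first by exists (b (v - 0) (v - 0)); exists 0.
  by exists 0 => _ [y Yy <-]; apply: b_ge0; apply: XB => //; exact: YX.
have leA y : Y y -> inf A <= b (v - y) (v - y).
  by move=> Yy; apply: ge_inf; [exact: Ainf.2|exists y].
have adh (j : nat) : exists y, Y y /\ b (v - y) (v - y) < inf A + j.+1%:R^-1.
  have j0 : 0 < j.+1%:R^-1 :> R by rewrite invr_gt0.
  have [_ [y Yy <-] yj] := inf_adherent j0 Ainf.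
  by exists y.
have [y /all_and2[Yy yA]] := choice adh.
have Xvy j : X (v - y j) by apply: XB => //; exact: YX.
have Yhalf i j : Y (2^-1 *: (y i + y j)) by apply: YZ; exact: YD.
have par i j : b (y i - y j) (y i - y j) <= 2 * i.+1%:R^-1 + 2 * j.+1%:R^-1.
  have h1 := leA _ (Yhalf i j).
  have -> : y i - y j = (v - y j) + (-1) *: (v - y i).
    by rewrite scaleN1r opprB [RHS]addrC addrA subrK.
  (* The midpoint of y i and y j lies in Y, so its distance to v is at least the infimum. *)
  move: h1; have -> : v - 2^-1 *: (y i + y j) = 2^-1 *: ((v - y j) + 1 *: (v - y i)).
    rewrite scale1r addrACA -opprD -mulr2n [y j + _]addrC [RHS]scalerBr.
    by rewrite -[v *+ 2]scaler_nat scalerA mulVf ?scale1r// pnatr_eq0.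
  have XX : X (v - y j + 1 *: (v - y i)) by apply: XD => //; exact: XZ.
  rewrite bZ//; last exact: XZ.
  rewrite bC bZ// !form_line//; have := yA i; have := yA j.
  move: (b _ _) (b _ _) (b _ _) (inf A) (i.+1%:R^-1) (j.+1%:R^-1) => p q r z x y0; rewrite expr1n sqrrN expr1n; lra.
have [p Yp yp] : exists2 p, Y p & forall e, 0 < e ->
    exists M, forall i, (M <= i)%N -> N (y i - p) < e.
  apply: Y_complete => // e e0.
  exists (Num.truncn (4 / (c * e))) => i j Mi Mj.
  have ce : 0 < c * e by rewrite mulr_gt0.
  have small k : (Num.truncn (4 / (c * e)) <= k)%N -> k.+1%:R^-1 < c * e / 4.
    move=> Mk; rewrite -[X in _ < X]invf_div ltf_pV2 ?posrE ?divr_gt0//.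
    by rewrite (lt_le_trans (truncnS_gt _))// ler_nat ltnS.
  rewrite -(ltr_pM2l c0); apply: le_lt_trans (b_ge _) _.
    by apply: XB; exact: YX.
  apply: le_lt_trans (par i j) _; have := small _ Mi; have := small _ Mj.
  by move: (i.+1%:R^-1) (j.+1%:R^-1) => ? ?; lra.
exists p => // w Yw; have Xw := YX Yw; have Xp := YX Yp.
(* Moving y j along w stays in Y, so the excess over the infimum is a non-negative quadratic
   polynomial in t, with constant term below 1/(j+1). *)
have bound j : b (v - y j) w ^+ 2 <= j.+1%:R^-1 * b w w.
  have q t : 0 <= (b (v - y j) (v - y j) - inf A) + 2 * t * b (v - y j) w + t ^+ 2 * b w w.
    have Yt : Y (y j - t *: w) by rewrite -scaleNr; apply: YD => //; exact: YZ.
    by have := leA _ Yt; rewrite opprB addrCA addrC form_line//; lra.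
  have := discriminant_le0 (b_ge0 Xw) q; move/le_trans; apply.
  rewrite ler_wpM2r ?b_ge0//; have := yA j.
  by move: (j.+1%:R^-1) => ?; lra.
have CS u : X u -> b u w ^+ 2 <= b u u * b w w.
  move=> Xu; apply: discriminant_le0 => [|t]; first exact: b_ge0.
  by rewrite -form_line//; apply: b_ge0; apply: XD => //; exact: XZ.
apply/eqP; rewrite -sqrf_eq0 eq_le sqr_ge0 andbT.
apply/ler_addgt0Pr => e e0; rewrite add0r.
have bw := b_ge0 Xw.
(* Makes the two error terms in [h4] add up to at most e; |K| is used because no sign of K is
   assumed. *)
pose d := e / (4 * (b w w + 1) * (`|K| + 1)).
have d0 : 0 < d by rewrite divr_gt0// !mulr_gt0// ltr_wpDl.
have [M HM] := yp _ d0.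
pose j := maxn M (Num.truncn (d^-1)).
have jd : j.+1%:R^-1 < d.
  rewrite -[X in _ < X]invrK ltf_pV2 ?posrE ?invr_gt0//.
  by rewrite (lt_le_trans (truncnS_gt _))// ler_nat ltnS leq_maxr.
have Xyp : X (y j - p) by apply: XB => //; exact: YX.
have -> : b (v - p) w = b (v - y j) w + b (y j - p) w.
  by rewrite -bD//; congr b; rewrite addrA subrK.
have h1 := bound j; have h2 := CS _ Xyp.
have h3 : b (y j - p) (y j - p) <= (`|K| + 1) * d.
  apply: (le_trans (b_le Xyp)); apply: (@le_trans _ _ ((`|K| + 1) * N (y j - p))).
    by rewrite ler_wpM2r// (le_trans (ler_norm K))// lerDl.
  by rewrite ler_wpM2l ?addr_ge0// ltW// HM// leq_maxl.
have h4 : 2 * (d * b w w) + 2 * ((`|K| + 1) * d * b w w) <= e.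
  have -> : e = 4 * (b w w + 1) * (`|K| + 1) * d.
    by rewrite /d mulrC divfK// gt_eqF// !mulr_gt0// ltr_wpDl.
  have : 0 <= `|K| * d by rewrite mulr_ge0// ltW.
  have : 0 <= `|K| * d * b w w by rewrite mulr_ge0// mulr_ge0// ltW.
  have : 0 <= d * b w w by rewrite mulr_ge0// ltW.
  by nra.
have h5 : j.+1%:R^-1 * b w w <= d * b w w by rewrite ler_wpM2r// ltW.
have h6 : b (y j - p) (y j - p) * b w w <= (`|K| + 1) * d * b w w by rewrite ler_wpM2r.
have := sqr_ge0 (b (v - y j) w - b (y j - p) w).
move: (le_trans h1 h5) (le_trans h2 h6) h4.
move: (b (v - y j) w) (b (y j - p) w) (d * b w w) ((`|K| + 1) * d * b w w) => r1 r2 s1 s2.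
rewrite !expr2 => ? ? ? ?; lra.
Qed.

End orthogonal_projection.

End projection.

Lemma exists_kernel_vector {R : realType} (m : nat) (A : 'M[R]_(m.+1, m)) :
  exists2 c : 'rV[R]_m.+1, c != 0 & c *m A = 0.
Proof.
have : kermx A != 0.
  by rewrite -mxrank_eq0 mxrank_ker subn_eq0 -ltnNge ltnS rank_leq_col.
by move=> /rowV0Pn[c /sub_kermxP cA c0]; exists c.
Qed.

Section finite_corank.
Context {R : realType} {T : lmodType R} {I : finType}.
Variables (X Y : T -> Prop) (b : T -> T -> R) (N : T -> R) (l : I -> T -> R).
Hypotheses (XD : forall u v, X u -> X v -> X (u + v)) (XZ : forall t u, X u -> X (t *: u)).
Hypotheses (YX : forall u, Y u -> X u) (Y0 : Y 0).
Hypotheses (YD : forall u v, Y u -> Y v -> Y (u + v)) (YZ : forall t u, Y u -> Y (t *: u)).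
Hypothesis bC : forall u v, b u v = b v u.
Hypothesis bD : forall u v w, X u -> X v -> X w -> b (u + v) w = b u w + b v w.
Hypothesis bZ : forall t u w, X u -> X w -> b (t *: u) w = t * b u w.
Hypothesis lD : forall i u v, X u -> X v -> l i (u + v) = l i u + l i v.
Hypothesis lZ : forall i t u, X u -> l i (t *: u) = t * l i u.
Let B u v := b u v + \sum_i l i u * l i v.
Variables (c K : R) (c0 : 0 < c) (N0 : forall u, 0 <= N u).
Hypotheses (B_ge : forall u, X u -> c * N u <= B u u) (B_le : forall u, X u -> B u u <= K * N u).
Hypothesis Y_complete : forall y : nat -> T, (forall j, Y (y j)) ->
  (forall e, 0 < e -> exists M, forall i j, (M <= i)%N -> (M <= j)%N -> N (y i - y j) < e) ->
  exists2 p, Y p & forall e, 0 < e -> exists M, forall i, (M <= i)%N -> N (y i - p) < e.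

(* A form which is coercive up to finitely many functionals has a kernel
   relative to any closed subspace of infinite codimension. *)
Lemma exists_orthogonal (psi : nat -> T) : (forall j, X (psi j)) ->
  (forall m (r : 'I_m -> R), Y (\sum_j r j *: psi j) -> forall j, r j = 0) ->
  exists phi, [/\ X phi, ~ Y phi & forall w, Y w -> b phi w = 0].
Proof.
move=> Xpsi indep; have X0 := YX Y0.
have BC u v : B u v = B v u.
  by rewrite /B bC; congr (_ + _); apply: eq_bigr => i _; rewrite mulrC.
have BD u v w : X u -> X v -> X w -> B (u + v) w = B u w + B v w.
  move=> Xu Xv Xw; rewrite /B bD// addrACA -big_split/=; congr (_ + _).
  by apply: eq_bigr => i _; rewrite lD// mulrDl.
have BZ t u w : X u -> X w -> B (t *: u) w = t * B u w.
  move=> Xu Xw; rewrite /B bZ// mulrDr mulr_sumr; congr (_ + _).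
  by apply: eq_bigr => i _; rewrite lZ// mulrA.
have ex j : exists q, Y q /\ forall w, Y w -> B (psi j - q) w = 0.
  have [q Yq Hq] := orthogonal_projection XD XZ YX Y0 YD YZ BC BD BZ c0 N0 B_ge B_le
    Y_complete (Xpsi j).
  by exists q.
have [p /all_and2[Yp Bp]] := choice ex.
pose F j := psi j - p j.
have XF j : X (F j).
  by rewrite /F -scaleN1r; apply: XD => //; apply: XZ; exact: YX.
(* One more vector than functionals: some nontrivial combination is killed by all of them, and
   pairing with it gives the same value for B and b. *)
pose A : 'M[R]_(#|I|.+1, #|I|) := \matrix_(j, i) l (enum_val i) (F j).
have [r r0 rA] := exists_kernel_vector A.
pose phi := \sum_(j < #|I|.+1) r 0 j *: F j.
have Xphi : X phi by apply: (space_sum XD XZ) => //.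
have l0 i : l i 0 = 0 by rewrite -(scale0r 0) lZ// mul0r.
have lphi i : l i phi = 0.
  rewrite (functional_sum XD XZ (F := fun j : 'I_(#|I|.+1) => F j))//; last 2 first.
  - exact: lD.
  - exact: lZ.
  have := congr1 (fun M : 'rV_(#|I|) => M 0 (enum_rank i)) rA; rewrite !mxE => rA0.
  rewrite -[RHS]rA0; apply: eq_bigr => j _.
  by rewrite mxE enum_rankK.
exists phi; split => // [Yphi|w Yw].
  have : Y (\sum_(j < #|I|.+1) r 0 j *: psi j).
    have -> : \sum_(j < #|I|.+1) r 0 j *: psi j = phi + \sum_(j < #|I|.+1) r 0 j *: p j.
      rewrite -big_split/=; apply: eq_bigr => j _.
      by rewrite -scalerDr subrK.
    apply: YD => //; apply: (space_sum YD YZ) => //.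
  move=> /indep rj; move/eqP: r0; apply; apply/rowP => j.
  by rewrite mxE; exact: rj.
have Xw := YX Yw.
have : B phi w = 0.
  rewrite (functional_sum XD XZ (F := fun j : 'I_(#|I|.+1) => F j) (fun j => XF j)
    (fun j => r 0 j) (l := B ^~ w))//.
  - by rewrite big1// => j _; rewrite Bp// mulr0.
  - by rewrite -(scale0r 0) BZ// mul0r.
  - by move=> u v Xu Xv; exact: BD.
  - by move=> t u Xu; exact: BZ.
by rewrite /B big1 ?addr0// => i _; rewrite lphi mul0r.
Qed.

End finite_corank.

(** * The Dirichlet problem *)

(** Replaces the potential by a version bounded at every point and zero off U, so that products with
    it are handled pointwise on the whole space. *)
Lemma Linfty_bounded {R : realType} {n : nat} (U : set 'rV[R]_n) (q : 'rV[R]_n -> R) :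
  measurable U -> Linfty U q -> exists (q' : 'rV[R]_n -> R) (M : R),
  [/\ measurable_fun setT q', forall x, `|q' x| <= M, forall x, ~ U x -> q' x = 0 &
      {ae @lebesgue_rV R n, forall x, U x -> q x = q' x}].
Proof.
move=> mU Lq; have mqU : measurable_fun setT (q \_ U) by move/sub_Lfun_mfun : Lq; rewrite inE.
move: Lq => /andP[_]; rewrite inE /= /finite_norm unlock.
case: ifPn => [mu0|]; last first.
  (* Degenerate branch of the L^oo norm: the total measure is 0 and any choice works. *)
  rewrite -leNgt => mu0 _; exists (fun=> 0), 0; split => //.
  - by move=> x; rewrite normr0.
  - exists setT; split => //; apply/eqP; rewrite eq_le mu0; exact: measure_ge0.
set S := (X in (X < _)%E) => Soo.
have S0 : (0 <= S)%E by apply: ess_sup_gee => //; apply: aeW => x; exact: abse_ge0.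
have Sfin : S \is a fin_num by rewrite ge0_fin_numE.
pose A := [set x | `|(q \_ U) x| <= fine S].
have mA : measurable A.
  rewrite (_ : A = (fun x => `|(q \_ U) x|) @^-1` `]-oo, fine S]); last first.
    by apply/seteqP; split => x; rewrite /A /= in_itv.
  rewrite -[X in measurable X]setTI.
  by apply: measurableT_comp mqU _ _ _ => //.
exists (fun x => (q \_ U) x * \1_A x), (fine S); split.
- by apply: measurable_funM => //; exact: measurable_indic.
- move=> x; rewrite indicE; case: (boolP (x \in A)) => [/set_mem xA|_]; first by rewrite mulr1.
  by rewrite mulr0 normr0 fine_ge0.
- by move=> x Ux; rewrite patchE memNset// mul0r.
- have := ess_sup_ge (@lebesgue_rV R n) (abse \o (EFin \o q \_ U)).
  apply: filterS => x; rewrite -/S -(fineK Sfin) lee_fin => xS Ux.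
  by rewrite indicE mem_set// mulr1 patchE mem_set.
Qed.

Section cone_neighbourhood.
Context {R : realType} {n : nat} (s : R) (s_gt0 : 0 < s).
Local Notation V := 'rV[R]_n.
Variables (a : V -> R) (aA2 : condA2 a) (C : set V) (aA3 : condA3 C a).
Local Notation k := (jump_kernel s a).

Lemma dconeN x : dcone C x -> dcone C (- x).
Proof.
by move=> [[y Cy <-]|Cx]; [right; rewrite opprK|left; exists x].
Qed.

Lemma dconeZ (t : R) x : 0 < t -> dcone C x -> dcone C (t *: x).
Proof.
have [[_ _ _ coneC _] _] := aA3.
move=> t0 [[y Cy <-]|Cx]; last by right; exact: coneC.
by left; exists (t *: y); [exact: coneC|rewrite scalerN].
Qed.

Lemma jump_kernel_cone x : k x != 0 -> dcone C x.
Proof.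
have [_ HC] := aA3.
move=> kx; have x0 : x != 0.
  by apply: contra_neq kx => ->; exact: (jump_kernel0 s_gt0 a).
have e0 : 0 < enorm x by rewrite enorm_gt0.
have : dcone C (unit_dir x).
  apply/(HC _ (sphere_unit_dir x0)); apply: contra_neq kx.
  by rewrite /jump_kernel => ->; rewrite mul0r.
by move=> /(dconeZ e0); rewrite /unit_dir scalerA mulfV ?gt_eqF// scale1r.
Qed.

(** A nonzero kernel places y - x in the double cone, hence y in C(U): a point of U only interacts
    with C(U). *)
Lemma jump_kernel_off (U : set V) x y : U x -> ~ cone_nbhd C U y -> k (x - y) = 0.
Proof.
move=> Ux Dy; apply/eqP; apply: contra_notT Dy => kxy.
exists x => //; exists (y - x); last by rewrite addrC subrK.
by rewrite -opprB; apply: dconeN; exact: jump_kernel_cone.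
Qed.

Lemma open_shift (U : set V) (z : V) : open U -> open (fun x : V => U (x - z)).
Proof.
move=> oU; apply: (@open_comp _ _ (fun x : V => x - z) U) => // x _.
by apply: (@continuousB R V V id (fun=> z)); [move=> ?|exact: cst_continuous].
Qed.

Lemma cone_nbhd_open (U : set V) : open (cone_nbhd C U).
Proof.
have [[_ oC _ _ _] _] := aA3.
rewrite (_ : cone_nbhd C U = \bigcup_(z in U) (fun x : V => dcone C (x - z))).
  by apply: bigcup_open => z _; apply: open_shift; exact: dcone_open.
apply/seteqP; split => [_ [x Ux [y Cy <-]]|x [z Uz Cxz]].
  by exists x => //=; rewrite addrAC subrr add0r.
by exists z => //; exists (x - z) => //; rewrite addrC subrK.
Qed.

(** The origin is not in the cone, but openness of U allows a small step backwards along a cone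
    direction. *)
Lemma sub_cone_nbhd (U : set V) : open U -> U `<=` cone_nbhd C U.
Proof.
have [[_ _ [c Cc] coneC _] _] := aA3 => oU x Ux.
have [e e0 eU] := nbhs_obox (open_nbhs_nbhs (conj oU Ux)).
pose t := e / (`|c| + 1).
have c1 : 0 < `|c| + 1 by rewrite ltr_wpDl.
have t0 : 0 < t by rewrite divr_gt0.
exists (x - t *: c); last first.
  by exists (t *: c); [right; exact: coneC|rewrite subrK].
apply: eU => i; rewrite !mxE.
have : `|t * c ord0 i| < e.
  rewrite normrM gtr0_norm// /t mulrAC ltr_pdivrMr// ltr_pM2l//.
  by rewrite (le_lt_trans (rV_coord_le _ _))// ltrDl.
by rewrite ltr_norml => /andP[? ?]; apply/andP; split; lra.
Qed.

End cone_neighbourhood.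

Section bilinear_form.
Context {R : realType} {n : nat} (s : R) (s_gt0 : 0 < s).
Local Notation mu := (@lebesgue_rV R n).
Local Notation sigma := (@sphere_measure R n).
Local Notation V := 'rV[R]_n.
Implicit Types u v w f h : V -> R.
Variables (a : V -> R) (ia : sigma.-integrable sphere (EFin \o a)).
Hypothesis aA2 : condA2 a.
Variables (C : set V) (aA3 : condA3 C a).
Local Notation k := (jump_kernel s a).
Local Notation fe := (fe s a).
Local Notation energy := (energy s a).
Variables (Omega : set V) (Oo : open Omega).
Local Notation D := (cone_nbhd C Omega).

Definition cone_energy u v : R :=
  ip (mu \x mu)%E (fun p => \1_(D `*` D) p * dif u k p) (dif v k).

Let mD : measurable D.
Proof. by apply: rV_open_measurable; exact: (cone_nbhd_open aA3). Qed.

Let mDD : measurable_fun setT (\1_(D `*` D) : V * V -> R).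
Proof. by apply: measurable_indic; exact: measurableX. Qed.

Let sDD u : fe u -> sqint (mu \x mu)%E (fun p => \1_(D `*` D) p * dif u k p).
Proof.
move=> [_ du]; apply: (sqint_bM (M := 1)) => // p.
by rewrite indicE; case: (_ \in _); rewrite ?normr1 ?normr0.
Qed.

Lemma cone_energyC u v : cone_energy u v = cone_energy v u.
Proof. by apply: eq_Rintegral => p _; rewrite mulrAC [_ * dif u k p]mulrC mulrA. Qed.

Lemma cone_energyB u v h : fe u -> fe v -> fe h ->
  cone_energy (fun x => u x - v x) h = cone_energy u h - cone_energy v h.
Proof.
move=> fu fv fh; have [_ dh] := fh.
have E : cone_energy u h = cone_energy (fun x => u x - v x) h + cone_energy v h.
  rewrite /cone_energy -ipDl//; [|exact: sDD (feB fu fv)|exact: sDD].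
  by apply: eq_Rintegral => p _; rewrite /dif; congr (_ * _); ring.
by rewrite E addrK.
Qed.

(** For a pair outside C(Omega) x C(Omega), either both points are off Omega, where the difference
    of v is 0 almost everywhere, or one is in Omega and the other off C(Omega), where the kernel is
    0. *)
Lemma cone_energyE u v : fe u -> fe v ->
  {ae mu, forall x, (~` Omega) x -> v x = 0} -> cone_energy u v = energy u v.
Proof.
move=> fu fv v0; have [_ [mdu _]] := fu; have [_ [mdv _]] := fv.
rewrite /cone_energy /energy /ip /Rintegral; congr fine.
apply: ae_eq_integral; [exact: measurableT| | |].
- by apply/measurable_EFinP; apply: measurable_funM => //; exact: measurable_funM.
- by apply/measurable_EFinP; exact: measurable_funM.
have := ae_prod v0; apply: filterS => p [p1 p2] _; congr EFin.
rewrite indicE; case: (boolP (p \in _)) => [_|/negP pD]; first by rewrite mul1r.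
rewrite mul0r mul0r; suff -> : dif v k p = 0 by rewrite mulr0.
have OD := sub_cone_nbhd aA3 Oo.
rewrite /dif; case: (pselect (Omega p.1)) (pselect (Omega p.2)) => O1 [] O2.
- by exfalso; apply: pD; apply: mem_set; split; exact: OD.
- rewrite (jump_kernel_off s_gt0 aA3 O1) ?sqrtr0 ?mulr0// => D2.
  by apply: pD; apply: mem_set; split => //; exact: OD.
- rewrite -(jump_kernelN s aA2) opprB (jump_kernel_off s_gt0 aA3 O2) ?sqrtr0 ?mulr0// => D1.
  by apply: pD; apply: mem_set; split => //; exact: OD.
- by rewrite p1// p2// subrr mul0r.
Qed.

Variables (q q' : V -> R).
Hypotheses (mq : measurable_fun Omega q) (mq' : measurable_fun setT q')
  (q'0 : forall x, ~ Omega x -> q' x = 0)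
  (qq' : {ae mu, forall x, Omega x -> q x = q' x}).

(** The values of a weak solution off C(Omega) are arbitrary, so it is replaced by a function of
    finite energy on the whole space with the same values on C(Omega). *)
Lemma Bform_cone_energy u u' v : (forall x, D x -> u x = u' x) -> fe u' -> fe v ->
  Bform s a C Omega q u v = 2^-1 * cone_energy u' v + ip mu (fun x => q' x * u' x) v.
Proof.
move=> uu' fu fv; have [[mu_ _] [mdu _]] := fu; have [[mv _] dv] := fv.
have mO := rV_open_measurable Oo.
rewrite /Bform; congr (_ * _ + _); rewrite /cone_energy /ip /Rintegral; congr fine.
  rewrite -(integral12_prod_meas1 (sqint_ip (sDD fu) dv)) integral_mkcond.
  apply: eq_integral => x _; rewrite patchE; case: ifPn => [/set_mem Dx|Dx].
    rewrite integral_mkcond; apply: eq_integral => y _; rewrite patchE.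
    case: ifPn => [/set_mem Dy|Dy]; last first.
      rewrite indicE (_ : _ \in _ = false) ?mul0r//; apply/negP => /set_mem[_ /= Dy'].
      by move/negP : Dy; apply; exact: mem_set.
    rewrite indicE mem_set//= mul1r !uu'// /dif /=; congr EFin.
    rewrite [RHS]mulrACA -expr2 sqr_sqrtr//; exact: (jump_kernel_ge0 s_gt0 aA2).
  apply/esym/integral0_eq => y _; rewrite indicE (_ : _ \in _ = false) ?mul0r//.
  by apply/negP => /set_mem[/= Dx' _]; move/negP : Dx; apply; exact: mem_set.
transitivity (\int[mu]_(x in Omega) (q x * u' x * v x)%:E)%E.
  by apply: eq_integral => x /set_mem Ox; rewrite uu'//; exact: (sub_cone_nbhd aA3 Oo).
transitivity (\int[mu]_(x in Omega) (q' x * u' x * v x)%:E)%E.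
  have muO : measurable_fun Omega u' by exact: measurable_funTS.
  have mvO : measurable_fun Omega v by exact: measurable_funTS.
  have mqO : measurable_fun Omega q' by exact: measurable_funTS.
  apply: ae_eq_integral; [exact: mO| | |].
  - by apply/measurable_EFinP; apply: measurable_funM => //; exact: measurable_funM.
  - by apply/measurable_EFinP; apply: measurable_funM => //; exact: measurable_funM.
  - by apply: filterS qq' => x Hx Ox; rewrite Hx.
transitivity (\int[mu]_x (q' x * u' x * v x)%:E)%E; last by [].
rewrite [LHS]integral_mkcond; apply: eq_integral => x _; rewrite patchE.
case: ifPn => // /negP xO; rewrite q'0 ?mul0r// => Ox; apply: xO; exact: mem_set.
Qed.

End bilinear_form.

Section polynomial_null.
Context {R : realType} {n : nat}.
Local Notation mu := (@lebesgue_rV R n).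
Local Notation V := 'rV[R]_n.

Lemma root_finite (p : {poly R}) : p != 0 -> finite_set [set t | root p t].
Proof.
move=> p0; apply: contrapT => /(infinite_set_fset (size p))[B Bp sB].
have := @max_poly_roots _ p (finmap.enum_fset B) p0.
rewrite finmap.fset_uniq ltnNge sB => H.
suff : all (root p) (finmap.enum_fset B) by move=> /H /(_ isT).
by apply/allP => t tB; exact: Bp.
Qed.

(** The exceptional set is a box with one finite side, hence of measure 0. *)
Lemma poly_coord_neq0 (p : {poly R}) (i : 'I_n) : p != 0 ->
  {ae mu, forall x : V, p.[x ord0 i] != 0}.
Proof.
move=> p0; pose A (j : 'I_n) : set R := if j == i then [set t | root p t] else setT.
have mA j : measurable (A j).
  rewrite /A; case: ifP => _; last exact: measurableT.
  apply: countable_measurable => [t|]; first exact: measurable_set1.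
  by apply: finite_set_countable; exact: root_finite.
exists [set x : V | forall j, A j (x ord0 j)]; split.
- exact: measurable_box.
- rewrite lebesgue_rV_box// (bigD1 i)//= {1}/A eqxx.
  rewrite countable_lebesgue_measure0 ?mul0e//.
  by apply: finite_set_countable; exact: root_finite.
- move=> x /= /negP; rewrite negbK => px j; rewrite /A; case: eqVneq => [->|//].
  exact: px.
Qed.

End polynomial_null.

(** * The function orthogonal to everything that vanishes on E *)

Section test_function.
Context {R : realType} {n : nat} (s : R) (n_gt0 : (0 < n)%N) (s_gt0 : 0 < s) (s_lt1 : s < 1).
Local Notation mu := (@lebesgue_rV R n).
Local Notation sigma := (@sphere_measure R n).
Local Notation V := 'rV[R]_n.
Implicit Types u v w f h : V -> R.
Variables (a : V -> R) (ia : sigma.-integrable sphere (EFin \o a)).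
Hypothesis aA2 : condA2 a.
Variables (C : set V) (aA3 : condA3 C a).
Local Notation fe := (fe s a).
Local Notation energy := (energy s a).
Local Notation nrm := (enormsq s a).
Variables (q : V -> R) (M : R) (mq : measurable_fun setT q) (qM : forall x, `|q x| <= M).

Definition qform u v : R := 2^-1 * energy u v + ip mu (fun x => q x * u x) v.

Let sq u : sqint mu u -> sqint mu (fun x => q x * u x).
Proof. by move=> su; exact: (sqint_bM su mq qM). Qed.

Lemma qformC u v : qform u v = qform v u.
Proof.
by rewrite /qform energyC; congr (_ + _); apply: eq_Rintegral => x _; rewrite mulrAC.
Qed.

Lemma qformDl u v w : fe u -> fe v -> fe w ->
  qform (fun x => u x + v x) w = qform u w + qform v w.
Proof.
move=> fu fv fw; rewrite /qform energyDl// mulrDr addrACA; congr (_ + _).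
have [[su _] [sv _]] := (fu, fv); have [sw _] := fw.
rewrite -(ipDl (sq su) (sq sv) sw).
by apply: eq_Rintegral => x _; rewrite mulrDr.
Qed.

Lemma qformZl t u w : fe u -> fe w -> qform (fun x => t * u x) w = t * qform u w.
Proof.
move=> fu fw; rewrite /qform energyZl// mulrDr mulrCA; congr (_ + _).
have [su _] := fu; have [sw _] := fw.
rewrite -(ipZl t (sq su) sw).
by apply: eq_Rintegral => x _; rewrite mulrCA.
Qed.

Lemma ip_potential_le u : sqint mu u -> `|ip mu (fun x => q x * u x) u| <= M * ip mu u u.
Proof.
move=> su; have sMu := sqintZ M su; have squ := sq su.
have h1 : 0 <= M * ip mu u u + ip mu (fun x => q x * u x) u.
  rewrite -(ipZl M su su) -(ipDl sMu squ su).
  apply: Rintegral_ge0 => // x _; rewrite -mulrDl -mulrA -expr2 mulr_ge0 ?sqr_ge0//.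
  by have := qM x; rewrite ler_norml => /andP[]; rewrite -lerBlDl sub0r.
have h2 : 0 <= M * ip mu u u - ip mu (fun x => q x * u x) u.
  rewrite -[- ip _ _ _]mulN1r -(ipZl M su su) -(ipZl (-1) squ su).
  rewrite -(ipDl sMu (sqintZ (-1) squ) su).
  apply: Rintegral_ge0 => // x _.
  rewrite mulN1r -mulrBl -mulrA -expr2 mulr_ge0 ?sqr_ge0// subr_ge0.
  exact: le_trans (ler_norm _) (qM x).
by rewrite ler_norml; apply/andP; split; lra.
Qed.

Variables (Omega : set V) (Oo : open Omega) (Ob : bounded_set Omega).
Local Notation X := (inX s a Omega).

Lemma elem_coordX i j : elem (fun x : V => x ord0 i ^+ j).
Proof.
elim: j => [|j IH]; first exact: (elem_cst 1).
by under eq_fun do rewrite exprS; exact: (elem_mul (elem_coord i) IH).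
Qed.

Lemma exists_test (E : set V) : measurable E -> E `<=` Omega ->
  ~ {ae mu, forall x, ~ E x} -> exists phi,
  [/\ X phi, ~ {ae mu, forall x, E x -> phi x = 0} &
      forall w, X w -> {ae mu, forall x, E x -> w x = 0} -> qform phi w = 0].
Proof.
move=> mE EO Epos.
have M0 : 0 <= M by apply: le_trans (qM 0).
(* If E were negligible in every closed box inside Omega, it would be negligible by localisation. *)
have [A [B [ABO EAB]]] : exists A B : V, cbox A B `<=` Omega /\
    ~ {ae mu, forall x, obox A B x -> ~ E x}.
  apply: contrapT => H; apply: Epos.
  suff : {ae mu, forall x, Omega x -> ~ E x}.
    by apply: filterS => x Hx Ex; exact: (Hx (EO x Ex)).
  apply: (ae_local Oo) => x Ox.
  have [e e0 eO] := nbhs_obox (open_nbhs_nbhs (conj Oo Ox)).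
  exists (obox (x - const_mx (e / 2)) (x + const_mx (e / 2))); split.
  - exact: obox_open.
  - by apply: obox_center; exact: divr_gt0.
  - apply: contrapT => HN; apply: H.
    exists (x - const_mx (e / 2)), (x + const_mx (e / 2)); split => // z zAB.
    apply: eO => i; have := zAB i; rewrite !mxE => /andP[h1 h2].
    by apply/andP; split; lra.
pose i0 := Ordinal n_gt0.
(* Infinitely many elements of X, independent modulo functions vanishing on E: the bump is positive
   on the box and a nonzero polynomial in one coordinate has a null zero set. *)
pose psi j : V -> R := (fun x : V => x ord0 i0 ^+ j) * bump 1 A B.
pose Y u := X u /\ {ae mu, forall x, E x -> u x = 0}.
(* Multiplied by M + 1, the finite rank estimate bounds (M + 1) times the squared L^2 norm by a
   quarter of the energy plus squares. This absorbs the potential and leaves a quarter of the energy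
   from its coefficient one half, hence the constant 1/4 in [B_ge]. *)
have de0 : 0 < (4 * (M + 1))^-1 by rewrite invr_gt0 mulr_gt0// ltr_wpDl.
have [m [Q [c [c0 mQ Qoo HQ]]]] := finite_rank_estimate s_gt0 ia aA2 aA3 Ob de0.
pose La := (M + 1) * c.
have La0 : 0 <= La by rewrite mulr_ge0// addr_ge0.
have sQ j : sqint mu (\1_(Q j) : V -> R) by apply: sqint_indic.
pose l (j : {ffun 'I_n -> 'I_m}) u := Num.sqrt La * ip mu u \1_(Q j).
have Xfe u : X u -> fe u by exact: inX_fe.
have Xs u : X u -> sqint mu u by move=> /Xfe[].
have lsq u j : l j u * l j u = La * ip mu u \1_(Q j) ^+ 2.
  by rewrite /l mulrACA -expr2 sqr_sqrtr// -expr2.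
pose m1 := La * \sum_j ip mu (\1_(Q j) : V -> R) \1_(Q j).
have m10 : 0 <= m1 by rewrite mulr_ge0//; apply: sumr_ge0 => j _; exact: ip_ge0.
have mO := rV_open_measurable Oo.
have B_ge u : X u -> 4^-1 * nrm u <= qform u u + \sum_j l j u * l j u.
  move=> Xu; have u0 := inX_ae0 mO Xu.
  have := HQ u (Xfe u Xu) u0.
  under eq_bigr do rewrite Rintegral_ip_indic.
  under [X in _ -> _ <= _ + X]eq_bigr do rewrite lsq.
  rewrite -mulr_sumr /La; set S := \sum_j _.
  have S0 : 0 <= S by apply: sumr_ge0 => j _; exact: sqr_ge0.
  have := ip_potential_le (Xs u Xu); rewrite ler_norml => /andP[+ _].
  rewrite /qform /enormsq; have := energy_ge0 s a u; have := ip_ge0 mu u.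
  move: (ip mu u u) (energy u u) (ip mu _ u) => r t z r0 t0 h1.
  rewrite -(ler_pM2l (_ : 0 < M + 1)); last by rewrite ltr_wpDl.
  have -> : (M + 1) * ((4 * (M + 1))^-1 * t + c * S) = 4^-1 * t + (M + 1) * c * S.
    by field; rewrite gt_eqF// ltr_wpDl.
  by rewrite mulrDl mul1r => h2; lra.
have B_le u : X u -> qform u u + \sum_j l j u * l j u <= (1 + M + m1) * nrm u.
  move=> Xu; have su := Xs u Xu.
  have : \sum_j l j u * l j u <= m1 * ip mu u u.
    under eq_bigr do rewrite lsq.
    rewrite -mulr_sumr /m1 -mulrA ler_wpM2l// mulr_suml ler_sum// => j _.
    by rewrite mulrC; exact: ip_CS.
  have := ip_potential_le su; rewrite ler_norml => /andP[_].
  rewrite /qform /enormsq; have := energy_ge0 s a u; have := ip_ge0 mu u.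
  move: (ip mu u u) (energy u u) (ip mu _ u) (\sum_j _) => r t z S r0 t0 h1 h2.
  have : 0 <= M * t by rewrite mulr_ge0.
  have : 0 <= m1 * t by rewrite mulr_ge0.
  by rewrite !mulrDl !mulrDr !mul1r; lra.
have XD u v : X u -> X v -> X (u + v) by exact: inX_D.
have XZ t u : X u -> X (t *: u) by exact: inX_Z.
have YX u : Y u -> X u by case.
have Y0 : Y 0.
  split; last by apply: aeW.
  have : X (fun x => 0 * bump 1 A B x).
    have Xb : X (bump 1 A B) by exact: (inX_Cc n_gt0 s_gt0 s_lt1 ia aA2 (bump_Cc ltr01 ABO)).
    exact: inX_Z.
  by rewrite (_ : (fun x => _) = 0)//; apply/funext => x; rewrite mul0r.
have YD u v : Y u -> Y v -> Y (u + v).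
  move=> [Xu u0] [Xv v0]; split; first exact: XD.
  by apply: filterS2 u0 v0 => x ux vx Ex; rewrite fctE ux// vx// addr0.
have YZ t u : Y u -> Y (t *: u).
  move=> [Xu u0]; split; first exact: XZ.
  by apply: filterS u0 => x ux Ex; rewrite fctE ux// scaler0.
have fD u v w : X u -> X v -> X w -> qform (u + v) w = qform u w + qform v w.
  by move=> Xu Xv Xw; apply: qformDl; exact: Xfe.
have fZ t u w : X u -> X w -> qform (t *: u) w = t * qform u w.
  by move=> Xu Xw; apply: qformZl; exact: Xfe.
have lD j u v : X u -> X v -> l j (u + v) = l j u + l j v.
  by move=> Xu Xv; rewrite /l -mulrDr; congr (_ * _); apply: ipDl => //; exact: Xs.
have lZ j t u : X u -> l j (t *: u) = t * l j u.
  by move=> Xu; rewrite /l mulrCA; congr (_ * _); apply: ipZl => //; exact: Xs.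
have Y_complete (y : nat -> V -> R) : (forall j, Y (y j)) ->
    (forall e, 0 < e -> exists N, forall i j, (N <= i)%N -> (N <= j)%N -> nrm (y i - y j) < e) ->
    exists2 p, Y p & forall e, 0 < e -> exists N, forall i, (N <= i)%N -> nrm (y i - p) < e.
  move=> Yy yC; have Xy j : X (y j) by exact: YX.
  have [p Xp yp] : exists2 p, X p & forall e, 0 < e -> exists N, forall i, (N <= i)%N -> nrm (fun x => y i x - p x) < e.
    exact: inX_complete.
  exists p => //; split => //; apply: (ae_eq0_on mE (Xs p Xp)) => e e0.
  have [N HN] := yp e e0; have [_ y0] := Yy N.
  exists (y N); split; [exact: Xs|exact: y0|].
  apply: le_lt_trans (ip_le_nrm _ _ _) _; rewrite nrmBC.
  exact: HN (leqnn N).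
have Xpsi j : X (psi j).
  by apply: inX_Cc => //; apply: elem_bump_Cc => //; exact: elem_coordX.
have indep N (r : 'I_N -> R) : Y (\sum_j r j *: psi j) -> forall j, r j = 0.
  move=> [_ r0]; pose p := \poly_(j < N) (if insub j is Some i then r i else 0).
  have pj (j : 'I_N) : p`_j = r j by rewrite coef_poly ltn_ord valK.
  suff p0 : p = 0 by move=> j; rewrite -pj p0 coef0.
  apply/eqP; apply: contra_notT EAB => p0.
  apply: filterS2 r0 (poly_coord_neq0 i0 p0) => x Hx px xAB Ex.
  have E1 : (\sum_j r j *: psi j) x =
      (\sum_(j < N) p`_j * x ord0 i0 ^+ j) * bump 1 A B x.
    rewrite fct_sumE mulr_suml; apply: eq_bigr => j _.
    by rewrite pj -mulrA.
  move: (Hx Ex); rewrite E1 => /eqP; rewrite mulf_eq0 (gt_eqF (bump_gt0 ltr01 xAB)) orbF.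
  by move: px; rewrite (@horner_coef_wide _ N) ?size_poly// => /negP.
have c40 : (0 : R) < 4^-1 by rewrite invr_gt0.
have N0 u : 0 <= nrm u by exact: enormsq_ge0.
have [phi [Xphi Yphi Hphi]] := exists_orthogonal XD XZ YX Y0 YD YZ qformC fD fZ lD lZ
  c40 N0 B_ge B_le Y_complete Xpsi indep.
exists phi; split => // [phi0|w Xw w0]; first by apply: Yphi.
by apply: Hphi.
Qed.

End test_function.

(** * Weak solutions with a test function as exterior datum *)

Section weak_equation.
Context {R : realType} {n : nat} (s : R) (n_gt0 : (0 < n)%N) (s_gt0 : 0 < s) (s_lt1 : s < 1).
Local Notation mu := (@lebesgue_rV R n).
Local Notation sigma := (@sphere_measure R n).
Local Notation V := 'rV[R]_n.
Implicit Types u v w f h : V -> R.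

Lemma Cc_off (U : set V) f x : Cc_smooth U f -> ~ U x -> f x = 0.
Proof.
move=> /Cc_smoothP[K [_ KU fK]] Ux; apply/eqP; apply: contra_notT Ux => fx.
exact: KU (fK _ fx).
Qed.

Lemma Cc_Hs_tilde (U : set V) v : Cc_smooth U v -> Hs_tilde s U v.
Proof.
move=> Cv; split; first exact: (Cc_Hs n_gt0 s_gt0 s_lt1 Cv).
move=> e e0; exists v => //; rewrite (_ : (v \- v)%R = fun=> 0); last first.
  by apply/funext => x; rewrite /= subrr.
have g0 : @gagliardo_sq R n s (fun=> 0) = 0%E.
  apply: (@integral0_eq _ _ _ mu) => x _; apply: (@integral0_eq _ _ _ mu) => y _.
  by rewrite subrr expr0n mul0r.
have l0 : (\int[mu]_x ((0 ^+ 2)%R : R)%:E = 0)%E.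
  by apply: integral0_eq => x _; rewrite expr0n.
by rewrite /Hs_norm g0 l0 adde0 poweR0r ?lte_fin.
Qed.

Variables (a : V -> R) (ia : sigma.-integrable sphere (EFin \o a)).
Hypothesis aA2 : condA2 a.
Variables (C : set V) (aA3 : condA3 C a).
Local Notation fe := (fe s a).
Local Notation energy := (energy s a).
Local Notation nrm := (enormsq s a).
Variables (Omega : set V) (Oo : open Omega).
Local Notation X := (inX s a Omega).
Local Notation D := (cone_nbhd C Omega).

Let mO : measurable Omega.
Proof. exact: rV_open_measurable. Qed.

Lemma energy_ae u v w : fe u -> fe v -> fe w -> {ae mu, forall x, u x = v x} ->
  energy u w = energy v w.
Proof.
move=> [_ [mdu _]] [_ [mdv _]] [_ [mdw _]] uv; apply: ip_ae => //.
by have := ae_prod uv; apply: filterS => p [p1 p2]; rewrite /dif p1 p2.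
Qed.

Section one_potential.
Variables (q q' : V -> R) (M : R).
Hypotheses (mq : measurable_fun Omega q) (mq' : measurable_fun setT q')
  (q'M : forall x, `|q' x| <= M) (q'0 : forall x, ~ Omega x -> q' x = 0)
  (qq' : {ae mu, forall x, Omega x -> q x = q' x}).
Local Notation form := (qform s a q').

(** On C(Omega) the solution is f + w with w in X. The potential does not see f, which vanishes on
    Omega, nor does it see h, so [DN] reduces to the cone energy. *)
Lemma poisson_spec f (W : set V) : well_posed s a C Omega q ->
  W `<=` exterior C Omega -> Cc_smooth W f ->
  exists w, [/\ X w,
    forall v, Cc_smooth Omega v -> 2^-1 * energy v f + form v w = 0 &
    forall h W', Cc_smooth W' h -> W' `<=` exterior C Omega ->
      DN s a C Omega q f h =
      2^-1 * cone_energy s a C Omega (fun x => f x + w x) h].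
Proof.
move=> [K Hq] WD Cf.
have off W' h x : Cc_smooth W' h -> W' `<=` exterior C Omega -> Omega x -> h x = 0.
  move=> Ch W'D Ox; apply: (Cc_off Ch) => /W'D[_]; apply; exact: subset_closure.
have Hf : Hs s f := Cc_Hs n_gt0 s_gt0 s_lt1 Cf.
have Hof U : Hs_on s U f.
  split; first by apply: measurable_funTS; exact: Cc_measurable Cf.
  by exists f => //; apply: aeW.
have [u0 [wu0 _ _]] := Hq f (Hof _).
have [_ weq wtil] : weak_solution s a C Omega q f (poisson s a C Omega q f).
  by apply: xgetPex; exists u0.
set u := poisson s a C Omega q f in weq wtil *.
(* The datum f is its own extension to C(Omega), so the boundary condition puts w in [Hs_tilde]. *)
pose w := (u \- f) \_ D.
have Xw : X w.
  apply: (inX_Hs_tilde n_gt0 s_gt0 s_lt1 ia aA2); apply: wtil; first exact: Hof.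
  exact: aeW.
have ff := Cc_fe n_gt0 s_gt0 s_lt1 ia aA2 Cf.
have fw := inX_fe Xw.
have uE x : D x -> u x = f x + w x.
  by move=> Dx; rewrite /w patchE mem_set//= addrC subrK.
have ffw := feD ff fw.
exists w; split => // [v Cv|h W' Ch W'D].
  have fv := Cc_fe n_gt0 s_gt0 s_lt1 ia aA2 Cv.
  have := weq v (Cc_Hs_tilde Cv).
  rewrite (Bform_cone_energy s_gt0 aA2 aA3 Oo mq mq' q'0 qq' uE ffw fv).
  rewrite (cone_energyE s_gt0 aA2 aA3 Oo ffw fv); last first.
    by apply: aeW => x; exact: (Cc_off Cv).
  rewrite (energyDl ff fw fv) mulrDr -addrA => h.
  rewrite energyC qformC /qform -[RHS]h; congr (_ + (_ + _)).
  apply: eq_Rintegral => x _; have [Ox|Ox] := pselect (Omega x).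
    by rewrite (off _ _ _ Cf WD Ox) add0r.
  by rewrite q'0// !mul0r.
have fh := Cc_fe n_gt0 s_gt0 s_lt1 ia aA2 Ch.
rewrite /DN (Bform_cone_energy s_gt0 aA2 aA3 Oo mq mq' q'0 qq' uE ffw fh).
rewrite [X in _ + X](_ : _ = 0) ?addr0//.
transitivity (\int[mu]_(x in setT) (0 : R)); last by rewrite Rintegral_cst// mul0r.
apply: eq_Rintegral => x _; have [Ox|Ox] := pselect (Omega x).
  by rewrite (off _ _ _ Ch W'D Ox) mulr0.
by rewrite q'0// !mul0r.
Qed.

(** The left side is linear in the tested function and continuous for the energy norm:
    Cauchy-Schwarz bounds its square by 3K times the squared norm. Density of test functions in X
    concludes. *)
Lemma weak_equation_density f w phi : fe f -> X w -> X phi ->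
  (forall v, Cc_smooth Omega v -> 2^-1 * energy v f + form v w = 0) ->
  2^-1 * energy phi f + form phi w = 0.
Proof.
move=> ff Xw Xphi H; have fw := inX_fe Xw; have [fphi Hphi] := Xphi.
have [sw _] := fw; have sqw := sqint_bM sw mq' q'M.
pose L z := 2^-1 * energy z f + form z w.
pose K := energy f f + energy w w + ip mu (fun x => q' x * w x) (fun x => q' x * w x).
have K0 : 0 <= K by rewrite !addr_ge0 ?energy_ge0 ?ip_ge0.
have Lle z : fe z -> L z ^+ 2 <= 3 * K * nrm z.
  move=> fz; have [sz _] := fz.
  rewrite /L qformC /qform [energy z f]energyC.
  have h1 := energy_CS ff fz; have h2 := energy_CS fw fz; have h3 := ip_CS sqw sz.
  rewrite /K /enormsq.
  have := energy_ge0 s a z; have := energy_ge0 s a f; have := energy_ge0 s a w.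
  have := ip_ge0 mu z; have := ip_ge0 mu (fun x => q' x * w x).
  move: h1 h2 h3.
  set qw := fun x => q' x * w x.
  move: (energy f z) (energy w z) (ip mu qw z) (energy f f) (energy w w) (ip mu qw qw)
    (energy z z) (ip mu z z) => x y t ef ew iw ez iz h1 h2 h3 g1 g2 g3 g4 g5.
  have := sqr_ge0 (x - y); have := sqr_ge0 (x - t); have := sqr_ge0 (y - t).
  have := sqr_ge0 (x - 2 * t); have := sqr_ge0 (y - 2 * t).
  have e1 := mulr_ge0 g4 g2; have e2 := mulr_ge0 g3 g2.
  have e3 := mulr_ge0 g1 g5.
  by move: h1 h2 h3; rewrite !expr2; nra.
apply/eqP; rewrite -sqrf_eq0 eq_le sqr_ge0 andbT.
apply/ler_addgt0Pr => e e0; rewrite add0r.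
have K1 : 0 < 3 * K + 1 by rewrite ltr_wpDl// mulr_ge0.
have [v Cv phiv] := Hphi _ (divr_gt0 e0 K1).
have fv := Cc_fe n_gt0 s_gt0 s_lt1 ia aA2 Cv.
have fd := feB fphi fv.
have E : L phi = L (fun x => phi x - v x).
  have -> : phi = (fun x => (phi x - v x) + v x) by apply/funext => x; rewrite subrK.
  rewrite {1}/L (energyDl fd fv ff) (qformDl mq' q'M fd fv fw) mulrDr addrACA.
  rewrite (H v Cv) addr0 /L; congr (_ * energy _ _ + form _ _).
    by apply/funext => x; rewrite subrK.
  by apply/funext => x; rewrite subrK.
rewrite -/(L phi) E; apply: (le_trans (Lle _ fd)).
apply: (@le_trans _ _ ((3 * K + 1) * (e / (3 * K + 1)))).
  apply: ler_pM; [by rewrite mulr_ge0|exact: enormsq_ge0|by rewrite lerDl|exact: ltW].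
by rewrite mulrC divfK// gt_eqF.
Qed.

End one_potential.

End weak_equation.

(** * Equality of the potentials *)

Theorem theorem3 (R : realType) (n : nat) (n_gt0 : (0 < n)%N)
    (s : R) (s_gt0 : 0 < s) (s_lt1 : s < 1)
    (a : 'rV[R]_n -> R) (C : set 'rV[R]_n)
    (aA1 : condA1 s a) (aA2 : condA2 a) (aA3 : condA3 C a)
    (Omega : set 'rV[R]_n) (Omega_open : open Omega)
    (Omega_neq0 : Omega !=set0) (Omega_bounded : bounded_set Omega)
    (q1 q2 : 'rV[R]_n -> R)
    (q1_Linfty : Linfty Omega q1) (q2_Linfty : Linfty Omega q2)
    (q1_well_posed : well_posed s a C Omega q1)
    (q2_well_posed : well_posed s a C Omega q2)
    (LD_antilocal : antilocal s a C)
    (W1 W2 : set 'rV[R]_n)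
    (W1_open : open W1) (W1_neq0 : W1 !=set0)
    (W1_ext : W1 `<=` cone_nbhd C Omega `\` closure Omega)
    (Omega_W1 : Omega `<=` cone_nbhd C W1)
    (W2_open : open W2) (W2_neq0 : W2 !=set0)
    (W2_ext : W2 `<=` cone_nbhd C Omega `\` closure Omega)
    (Omega_W2 : Omega `<=` cone_nbhd C W2)
    (DN_eq : forall f, Cc_smooth W1 f -> forall h, Cc_smooth W2 h ->
       DN s a C Omega q1 f h = DN s a C Omega q2 f h) :
  q1 = q2 %[ae @lebesgue_rV R n in Omega].
Proof.
have [ia _] := aA1; have [[_ C_open _ _ _] _] := aA3.
have mO := rV_open_measurable Omega_open.
have disj W : W `<=` cone_nbhd C Omega `\` closure Omega -> forall x, W x -> ~ Omega x.
  by move=> WO x /WO[_ Ox] /subset_closure.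
have mq q : Linfty Omega q -> measurable_fun Omega q.
  move=> Lq; apply/(measurable_restrictT q mO).
  by move/sub_Lfun_mfun : Lq; rewrite inE.
have [r1 [M1 [mr1 r1M r1O qr1]]] := Linfty_bounded mO q1_Linfty.
have [r2 [M2 [mr2 r2M r2O qr2]]] := Linfty_bounded mO q2_Linfty.
pose E := [set x | Omega x /\ r1 x != r2 x].
have mE : measurable E.
  rewrite (_ : E = Omega `&` ((fun x => r1 x - r2 x) @^-1` ~` [set 0])).
    apply: measurableI => //; rewrite -[X in measurable X]setTI.
    have := measurable_funB mr1 mr2; apply => //.
    by apply: measurableC; exact: measurable_set1.
  apply/seteqP; split => x [Ox] /=.
    by move=> /eqP r12; split => // /eqP; rewrite subr_eq0 => /eqP.
  by move=> r12; split => //; apply/eqP => r12'; apply: r12; rewrite r12' subrr.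
(* Each exterior datum in W1 yields the same interior part w for both potentials, and this common w
   vanishes where they differ. *)
have solution f : Cc_smooth W1 f -> exists w, [/\ inX s a Omega w,
    forall v, Cc_smooth Omega v -> 2^-1 * energy s a v f + qform s a r1 v w = 0 &
    {ae @lebesgue_rV R n, forall x, E x -> w x = 0}].
  move=> Cf; have ff := Cc_fe n_gt0 s_gt0 s_lt1 ia aA2 Cf.
  have [w1 [X1 eq1 DN1]] := poisson_spec n_gt0 s_gt0 s_lt1 ia aA2 aA3 Omega_open
    (mq q1 q1_Linfty) mr1 r1O qr1 q1_well_posed W1_ext Cf.
  have [w2 [X2 eq2 DN2]] := poisson_spec n_gt0 s_gt0 s_lt1 ia aA2 aA3 Omega_open
    (mq q2 q2_Linfty) mr2 r2O qr2 q2_well_posed W1_ext Cf.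
  have [f1 f2] := (inX_fe X1, inX_fe X2).
  have w12 : {ae @lebesgue_rV R n, forall x, w1 x = w2 x}.
    have X12 : inX s a Omega (fun x => w1 x + -1 * w2 x).
      by apply: inX_D => //; exact: inX_Z.
    suff : {ae @lebesgue_rV R n, forall x, w1 x + -1 * w2 x = 0}.
      by apply: filterS => x; rewrite mulN1r => /eqP; rewrite subr_eq0 => /eqP.
    have off := inX_ae0 mO X12.
    apply: (energy_antilocal n_gt0 s_gt0 s_lt1 ia aA2 C_open LD_antilocal Omega_open
      Omega_bounded W2_open (disj _ W2_ext) Omega_W2 (inX_fe X12) off) => h Ch.
    have fh := Cc_fe n_gt0 s_gt0 s_lt1 ia aA2 Ch.
    (* Since w1 - w2 vanishes off Omega, its full energy against h equals the cone energy, on which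
       the two Dirichlet-to-Neumann maps agree. *)
    rewrite energyC -(cone_energyE s_gt0 aA2 aA3 Omega_open fh (inX_fe X12) off).
    rewrite cone_energyC.
    have := DN_eq f Cf h Ch; rewrite (DN1 h W2)// (DN2 h W2)//.
    have two0 : (2^-1 : R) != 0 by rewrite invr_eq0 pnatr_eq0.
    move/(mulfI two0) => DN12.
    have -> : (fun x => w1 x + -1 * w2 x) = (fun x => (f x + w1 x) - (f x + w2 x)).
      by apply/funext => x; ring.
    by rewrite (cone_energyB aA3 Omega (feD ff f1) (feD ff f2) fh) DN12 subrr.
  exists w1; split => //.
  have [s1 _] := f1; have [s2 _] := f2; have [[mw1 _] [mw2 _]] := (s1, s2).
  have s11 := sqint_bM s1 mr1 r1M; have s21 := sqint_bM s1 mr2 r2M.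
  (* Subtracting the two weak equations for the same w removes the energy terms and leaves (r1 - r2)
     w orthogonal to all bumps in Omega. *)
  suff : {ae @lebesgue_rV R n, forall x, Omega x -> r1 x * w1 x - r2 x * w1 x = 0}.
    apply: filterS => x Hx [Ox r12]; have /eqP := Hx Ox.
    by rewrite -mulrBl mulf_eq0 subr_eq0 (negbTE r12) => /eqP.
  apply: (fundamental_lemma Omega_open (sqintB s11 s21)) => m b c m0 bcO.
  have Cv : Cc_smooth Omega (bump m b c) by exact: bump_Cc.
  have fv := Cc_fe n_gt0 s_gt0 s_lt1 ia aA2 Cv; have [sv _] := fv; have [mv _] := sv.
  have e12 : energy s a w1 (bump m b c) = energy s a w2 (bump m b c).
    exact: energy_ae.
  have i12 : ip (@lebesgue_rV R n) (fun x => r2 x * w2 x) (bump m b c) = ip (@lebesgue_rV R n) (fun x => r2 x * w1 x) (bump m b c).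
    apply: ip_ae => //; [exact: measurable_funM|exact: measurable_funM|].
    by apply: filterS w12 => x ->.
  have := etrans (eq1 _ Cv) (esym (eq2 _ Cv)) => /addrI.
  rewrite qformC [in RHS]qformC /qform e12 i12 => /addrI i1.
  have -> : (fun x => r1 x * w1 x - r2 x * w1 x) = (fun x => r1 x * w1 x + -1 * (r2 x * w1 x)).
    by apply/funext => x; rewrite mulN1r.
  by rewrite (ipDl s11 (sqintZ (-1) s21) sv) (ipZl (-1) s21 sv) i1 mulN1r subrr.
suff E0 : {ae @lebesgue_rV R n, forall x, ~ E x}.
  apply: filterS3 qr1 qr2 E0 => x h1 h2 Ex Ox; rewrite h1// h2//.
  by apply/eqP; apply: contrapT => /negP r12; apply: Ex.
apply: contrapT => Epos.
have EO : E `<=` Omega by move=> x [].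
have [phi [Xphi phi0 Hphi]] := exists_test n_gt0 s_gt0 s_lt1 ia aA2 aA3 mr1 r1M
  Omega_open Omega_bounded mE EO Epos.
apply: phi0.
suff : {ae @lebesgue_rV R n, forall x, phi x = 0} by apply: filterS => x ->.
apply: (energy_antilocal n_gt0 s_gt0 s_lt1 ia aA2 C_open LD_antilocal Omega_open
  Omega_bounded W1_open (disj _ W1_ext) Omega_W1 (inX_fe Xphi) (inX_ae0 mO Xphi)) => f Cf.
have ff := Cc_fe n_gt0 s_gt0 s_lt1 ia aA2 Cf.
have [w [Xw weq w0]] := solution f Cf.
(* The form term vanishes because w is in X and is zero on E; what remains is that the energy of phi
   against f is 0. *)
have := weak_equation_density n_gt0 s_gt0 s_lt1 ia aA2 mr1 r1M ff Xw Xphi weq.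
by rewrite (Hphi w Xw w0) addr0 => /eqP; rewrite mulf_eq0 invr_eq0 pnatr_eq0 => /eqP.
Qed.
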